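(* Let $f\in\mathbb{C}(z)$ be a rational map of degree $d\ge 1$ and $F$ a homogeneous lift of $f$. View $R_F$ as a function on the hyperbolic ball $\mathbb{B}\subseteq\mathbb{R}^3$. Then for every $\xi\in\mathbb{B}$, $$\nabla_h R_F(\xi)=-\int_{S^2}\zeta\ d\widehat{\omega_{f^{\gamma_\xi}}}(\zeta),$$ where $[\gamma_\xi]\in \mathrm{SL}_2(\mathbb{C})/\mathrm{SU}(2)$ is the class corresponding to $\xi$. In particular, if $[\gamma]\in\mathrm{SL}_2(\mathbb{C})/\mathrm{SU}(2)$ minimizes $R_F$, then the conformal barycenter $\mathrm{Bary}(\widehat{\omega_{f^\gamma}})$ is the origin of $\mathbb{B}$.
   Context: A homogeneous lift of $f$ is $F=(F_0,F_1):\mathbb{C}^2\to\mathbb{C}^2$ with $F_0,F_1$ coprime homogeneous polynomials of degree $d$ and $f(z)=F_0(z,1)/F_1(z,1)$. For $\gamma\in\mathrm{SL}_2(\mathbb{C})$: $F^\gamma(v)=\gamma^{-1}\cdot F(\gamma\cdot v)$ and $f^\gamma=\gamma^{-1}\circ f\circ\gamma$. With $\sigma$ the rotation-invariant probability measure on the unit sphere $S^3\subset\mathbb{C}^2$, put $R(F)=\int_{S^3}\log\|F\|\,d\sigma$ and $R_F([\gamma])=R(F^\gamma)$, a well-defined function on $\mathrm{SL}_2(\mathbb{C})/\mathrm{SU}(2)$. Ball model: $\mathbb{B}$ is the open unit ball of $\mathbb{R}^3$. It is identified with $\mathbb{H}=\{(z,t):z\in\mathbb{C},t>0\}$ by the map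 $\iota$ = (inversion in the sphere with centre $(0,0,1)$ and radius $\sqrt2$) followed by reflection in the plane $\{x_3=0\}$; it sends $0$ to $j=(0,1)$ and extends to $S^2\to\mathbb{P}^1(\mathbb{C})$ as stereographic projection $\Sigma(\zeta)=(\zeta_1+i\zeta_2)/(1-\zeta_3)$, $\Sigma(0,0,1)=\infty$. $\mathrm{SL}_2(\mathbb{C})$ acts on $\mathbb{H}$ by the usual (Poincaré) extension of fractional linear transformations and on $\mathbb{B}$ via $\iota$; the class $[\gamma]$ corresponds to $\gamma\cdot 0\in\mathbb{B}$. Hyperbolic gradient: $\nabla_hR_F(\xi)$ denotes the Euclidean gradient at $x=0$ of the function $x\mapsto R_F(\gamma_\xi\cdot x)$ on $\mathbb{B}$, where $\gamma_\xi\in\mathrm{SL}_2(\mathbb{C})$ is a representative with $\gamma_\xi\cdot 0=\xi$ (the same representative being used on both sides of the formula). Measures: $\omega_{\mathbb{C}}=\frac{i}{2\pi}(1+|\alpha|^2)^{-2}d\alpha\wedge d\bar\alpha$ is the Fubini–Study probability measure on $\mathbb{P}^1(\mathbb{C})$, and $\omega_f=f^*\omega_{\mathbb{C}}+f_*\omega_{\mathbb{C}}$ (pullback and pushforward as measures), a positive measure of mass $d+1$; $\widehat{\omega_f}$ is its transport to $S^2$ via $\Sigma^{-1}$. Conformal barycenter: for a positive finite measure $\mu$ on $S^2$ with no atom of mass $\ge\frac12\mu(S^2)$, $\mathrm{Bary}(\mu)$ is the unique minimum point on $\mathbb{B}$ of $h_\mu(z)=-\frac12\int_{S^2}\log\left(\frac{1-|z|^2}{|z-\zeta|^2}\right)d\mu(\zeta)$.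 *)

(* Defs.v *)
(* The real numbers are any [R : realType], the complex numbers are [R[i]], and
   R^n is ['rV[R]_n]. *)
From HB Require Import structures.
From mathcomp Require Import all_boot all_order all_algebra.
(* The notations of mpoly clash with those of MathComp-Analysis. *)
From mathcomp Require Import -(notations) mpoly.
From mathcomp Require Import all_classical all_reals all_analysis.
From mathcomp Require Import measurable_realfun.
From mathcomp Require Import complex.

Set Implicit Arguments.
Unset Strict Implicit.
Unset Printing Implicit Defensive.

Import Order.TTheory GRing.Theory Num.Theory.
Import numFieldNormedType.Exports.

Local Open Scope classical_set_scope.
Local Open Scope ring_scope.
Local Open Scope complex_scope.

(* The Borel sigma-algebra of R^n, generated by the coordinates. *)
Definition rV_display : measure_display. Proof. by []. Qed.

Section measurable_rV.
Context {R : realType} (n : nat).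

Let coor (i : 'I_n) (v : 'rV[R]_n) : R := v ord0 i.

Let rV_set0 : g_sigma_preimage coor set0.
Proof. exact: sigma_algebra0. Qed.

Let rV_setC A : g_sigma_preimage coor A -> g_sigma_preimage coor (~` A).
Proof. exact: sigma_algebraC. Qed.

Let rV_bigcup (A : (set 'rV[R]_n)^nat) :
  (forall i, g_sigma_preimage coor (A i)) ->
  g_sigma_preimage coor (\bigcup_i A i).
Proof. exact: sigma_algebra_bigcup. Qed.

HB.instance Definition _ := @isMeasurable.Build rV_display 'rV[R]_n
  (g_sigma_preimage coor) rV_set0 rV_setC rV_bigcup.

End measurable_rV.

Section euclidean.
Context {R : realType}.

Definition sqnorm n (x : 'rV[R]_n) : R := \sum_i x ord0 i ^+ 2.

Definition unit_ball n : set 'rV[R]_n := [set x | sqnorm x < 1].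

Definition unit_sphere n : set 'rV[R]_n := [set x | sqnorm x = 1].

Definition gradient n (g : 'rV[R]_n -> R) (a : 'rV[R]_n) : 'rV[R]_n :=
  \row_i 'D_(delta_mx ord0 i) g a.

Definition abs2 (z : R[i]) : R := complex.Re z ^+ 2 + complex.Im z ^+ 2.

End euclidean.

Arguments unit_ball {R} n.
Arguments unit_sphere {R} n.

Section riemann_sphere.
Context (R : realType).

(* P^1(C), with [None] the point at infinity. *)
Definition riemann_sphere : Type := option R[i].

HB.instance Definition _ := Choice.on riemann_sphere.
HB.instance Definition _ := Pointed.on riemann_sphere.

Definition finite_point (p : R * R) : riemann_sphere := Some (p.1 +i* p.2).

(* The Borel sigma-algebra of P^1(C): the trace on C is Borel, and the point at
   infinity is measurable. *)
Definition riemann_sphere_measurable : set (set riemann_sphere) :=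
  [set A | measurable (finite_point @^-1` A)].

Let P1_set0 : riemann_sphere_measurable set0.
Proof. by rewrite /riemann_sphere_measurable /= preimage_set0. Qed.

Let P1_setC A :
  riemann_sphere_measurable A -> riemann_sphere_measurable (~` A).
Proof.
move=> mA; rewrite /riemann_sphere_measurable /= preimage_setC.
exact: measurableC.
Qed.

Let P1_bigcup (A : (set riemann_sphere)^nat) :
  (forall i, riemann_sphere_measurable (A i)) ->
  riemann_sphere_measurable (\bigcup_i A i).
Proof.
move=> mA; rewrite /riemann_sphere_measurable /= preimage_bigcup.
exact: bigcupT_measurable.
Qed.

Definition riemann_sphere_display : measure_display. Proof. by []. Qed.

HB.instance Definition _ := @isMeasurable.Build riemann_sphere_display
  riemann_sphere riemann_sphere_measurable
  P1_set0 P1_setC P1_bigcup.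

End riemann_sphere.

Section complex_plane.
Context {R : realType}.
Local Notation C := R[i].
Local Notation P1 := (riemann_sphere R).

Definition col2 (x y : C) : 'cV[C]_2 := \col_i (if i == ord0 then x else y).

Definition homog_coord (P : P1) : 'cV[C]_2 :=
  if P is Some z then col2 z 1 else col2 1 0.

Definition of_homog_coord (v : 'cV[C]_2) : P1 :=
  if v ord_max ord0 == 0 then None else Some (v ord0 ord0 / v ord_max ord0).

Definition mobius (g : 'M[C]_2) (P : P1) : P1 :=
  of_homog_coord (g *m homog_coord P).

Definition SL2 : set 'M[C]_2 := [set g | \det g = 1].

(* f^g, for a self-map f of P^1(C). *)
Definition conj_self_map (g : 'M[C]_2) (f : P1 -> P1) : P1 -> P1 :=
  mobius (invmx g) \o f \o mobius g.

(* F^g, for a self-map F of C^2. *)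
Definition conj_lift (g : 'M[C]_2) (F : 'cV[C]_2 -> 'cV[C]_2) :
    'cV[C]_2 -> 'cV[C]_2 :=
  fun v => invmx g *m F (g *m v).

End complex_plane.

Section homogeneous_lift.
Context {R : realType}.
Local Notation C := R[i].
Local Notation P1 := (riemann_sphere R).

Definition coprime_mpoly n (p q : mpoly n C) : Prop :=
  forall e p' q' : mpoly n C, p = e * p' -> q = e * q' -> e \is a GRing.unit.

(* The self-map of C^2 with components F_0 and F_1. *)
Definition poly_map (F : 'I_2 -> mpoly 2 C) (v : 'cV[C]_2) : 'cV[C]_2 :=
  \col_i meval (fun j => v j ord0) (F i).

(* F is a homogeneous lift of f, and f has degree d. *)
Definition homogeneous_lift (d : nat) (F : 'I_2 -> mpoly 2 C) (f : P1 -> P1) :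
    Prop :=
  [/\ forall i, F i \is @ishomog1 _ _ d mdeg,
      coprime_mpoly (F ord0) (F ord_max) &
      forall P, f P = of_homog_coord (poly_map F (homog_coord P))].

(* The order of vanishing at P of a binary form, read in the affine chart
   (X : 1) if P is finite, and in (1 : X) if P is the point at infinity. *)
Definition form_mult (G : mpoly 2 C) (P : P1) : nat :=
  if P is Some z
  then mup z (mmap polyC (fun i : 'I_2 => if i == ord0 then 'X else 1) G)
  else mup 0 (mmap polyC (fun i : 'I_2 => if i == ord0 then 1 else 'X) G).

(* The form whose zeros are the preimages of w under the map lifted by F. *)
Definition fiber_form (F : 'I_2 -> mpoly 2 C) (w : P1) : mpoly 2 C :=
  homog_coord w ord_max ord0 *: F ord0 - homog_coord w ord0 ord0 *: F ord_max.

(* The multiplicity of P as a preimage of f(P), for a rational map f: it does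
   not depend on the lift with which it is computed. *)
Definition local_degree (f : P1 -> P1) (P : P1) : nat :=
  xget 0%N [set m | exists d F, homogeneous_lift d F f /\
                                m = form_mult (fiber_form F (f P)) P].

End homogeneous_lift.

Section measures.
Context {R : realType}.
Local Notation C := R[i].
Local Notation P1 := (riemann_sphere R).
Local Open Scope ereal_scope.

(* As (i/2) d(alpha) /\ d(conj alpha) is the Lebesgue measure dx dy, the
   coefficient i/(2 pi) becomes 1/pi. *)
Definition fubini_study_density (p : R * R) : R :=
  (pi^-1 * (1 + abs2 (p.1 +i* p.2)) ^- 2)%R.

Definition fubini_study (A : set P1) : \bar R :=
  \int[@lebesgue_measure R \x @lebesgue_measure R]_(p in @finite_point R @^-1` A)
    (fubini_study_density p)%:E.

Lemma fubini_study_density_ge0 p : (0 <= fubini_study_density p)%R.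
Proof.
rewrite /fubini_study_density mulr_ge0 ?invr_ge0 ?pi_ge0// exprn_ge0//.
by rewrite !addr_ge0 ?sqr_ge0.
Qed.

Lemma measurable_fubini_study_density :
  measurable_fun setT fubini_study_density.
Proof.
have -> : fubini_study_density = fun p : R * R =>
    (pi^-1 * (1 + (p.1 ^+ 2 + p.2 ^+ 2)) `^ (- 2%:R))%R.
  apply/funext => p; rewrite powR_invn// -[0%R]addr0 lerD ?addr_ge0 ?sqr_ge0//.
apply: measurable_funM => //; apply: (measurableT_comp (measurable_powR _)).
apply: measurable_funD => //.
by apply: measurable_funD; apply: measurable_funX.
Qed.

Let fubini_study0 : fubini_study set0 = 0.
Proof. by rewrite /fubini_study preimage_set0 integral_set0. Qed.

Let fubini_study_ge0 A : 0 <= fubini_study A.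
Proof.
by apply: integral_ge0 => p _; rewrite lee_fin fubini_study_density_ge0.
Qed.

Let fubini_study_sigma_additive : semi_sigma_additive fubini_study.
Proof.
move=> A mA tA mUA; rewrite /fubini_study preimage_bigcup.
have mf : measurable_fun setT (EFin \o fubini_study_density).
  by apply/measurable_EFinP; exact: measurable_fubini_study_density.
have additive := @semi_sigma_additive_nng_induced _ _ R
  (product_measure1 (@lebesgue_measure R) (@lebesgue_measure R)) _ mf.
apply: additive => //=.
- by move=> p; rewrite lee_fin fubini_study_density_ge0.
- apply/trivIsetP => i j _ _ ij.
  by rewrite -preimage_setI; move/trivIsetP : tA => ->.
Qed.

HB.instance Definition _ := isMeasure.Build _ _ _ fubini_study
  fubini_study0 fubini_study_ge0 fubini_study_sigma_additive.

(* f^* mu, for a rational map f: preimages count with multiplicity. *)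
Definition pullback_measure (f : P1 -> P1) (mu : set P1 -> \bar R)
    (A : set P1) : \bar R :=
  \int[mu]_a \esum_(P in A `&` f @^-1` [set a]) (local_degree f P)%:R%:E.

Definition omega (f : P1 -> P1) (A : set P1) : \bar R :=
  pullback_measure f fubini_study A + pushforward fubini_study f A.

(* Sigma, meaningful on the unit sphere only. *)
Definition stereographic (x : 'rV[R]_3) : P1 :=
  if x ord0 ord_max == 1%R then None
  else Some ((x ord0 ord0 +i* x ord0 1%R) / (1 - x ord0 ord_max)%:C)%R.

(* The transport to the unit sphere by Sigma^-1, as a measure on R^3 carried by
   the sphere. *)
Definition sphere_transport (mu : set P1 -> \bar R) (A : set 'rV[R]_3) :
    \bar R :=
  mu (stereographic @` (A `&` unit_sphere 3)).

(* The vector-valued integral of the position vector over the unit sphere. *)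
Definition first_moment (mu : set 'rV[R]_3 -> \bar R) : 'rV[R]_3 :=
  \row_i fine (\int[mu]_(x in unit_sphere 3) (x ord0 i)%:E).

Definition bary_potential (mu : set 'rV[R]_3 -> \bar R) (z : 'rV[R]_3) : R :=
  (- 2^-1 * fine (\int[mu]_(x in unit_sphere 3)
     (ln ((1 - sqnorm z) / sqnorm (z - x)))%:E))%R.

(* Bary(mu) is defined and equal to z. *)
Definition is_conformal_barycenter (mu : set 'rV[R]_3 -> \bar R)
    (z : 'rV[R]_3) : Prop :=
  let h := bary_potential mu in
  let is_min w := unit_ball 3 w /\ forall u, unit_ball 3 u -> (h w <= h u)%R in
  [/\ mu (unit_sphere 3) < +oo,
      forall x, unit_sphere 3 x -> mu [set x] < (2^-1)%:E * mu (unit_sphere 3),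
      is_min z & forall w, is_min w -> w = z].

End measures.

Section hyperbolic_space.
Context {R : realType}.
Local Notation C := R[i].

Definition row3 (x y z : R) : 'rV[R]_3 := \row_i nth 0 [:: x; y; z] i.

Definition inversion n (c : 'rV[R]_n) (r : R) (x : 'rV[R]_n) : 'rV[R]_n :=
  c + (r ^+ 2 / sqnorm (x - c)) *: (x - c).

Definition ball_inversion : 'rV[R]_3 -> 'rV[R]_3 :=
  inversion (row3 0 0 1) (Num.sqrt 2).

Definition reflection (x : 'rV[R]_3) : 'rV[R]_3 :=
  row3 (x ord0 ord0) (x ord0 1) (- x ord0 ord_max).

(* A point (z, t) of H is a pair in C * R. *)
Definition iota (x : 'rV[R]_3) : C * R :=
  let y := reflection (ball_inversion x) in
  (y ord0 ord0 +i* y ord0 1, y ord0 ord_max).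

(* Inversion and reflection are involutions. *)
Definition iota_inv (p : C * R) : 'rV[R]_3 :=
  ball_inversion (reflection (row3 (complex.Re p.1) (complex.Im p.1) p.2)).

(* For det g = 1. *)
Definition poincare_extension (g : 'M[C]_2) (p : C * R) : C * R :=
  let: (z, t) := p in
  let a := g ord0 ord0 in let b := g ord0 ord_max in
  let c := g ord_max ord0 in let d := g ord_max ord_max in
  let D := abs2 (c * z + d) + abs2 c * t ^+ 2 in
  (((a * z + b) * (c * z + d)^* + a * c^* * (t ^+ 2)%:C) / D%:C, t / D).

Definition ball_action (g : 'M[C]_2) (x : 'rV[R]_3) : 'rV[R]_3 :=
  iota_inv (poincare_extension g (iota x)).

End hyperbolic_space.

Section energy.
Context {R : realType}.
Local Notation C := R[i].

(* The unique rotation-invariant probability measure on the unit sphere, as a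
   measure on R^n carried by the sphere (unique for n >= 2). *)
Definition rotation_invariant_on_sphere n (sigma : probability 'rV[R]_n R) :
    Prop :=
  sigma (unit_sphere n) = 1%E /\
  forall (Q : 'M[R]_n), Q *m Q^T = 1%:M -> \det Q = 1 ->
    forall A : set 'rV[R]_n, measurable A ->
      sigma ((fun x => x *m Q) @^-1` A) = sigma A.

Definition to_C2 (x : 'rV[R]_4) : 'cV[C]_2 :=
  let r k := x ord0 (inord k) in col2 (r 0 +i* r 1) (r 2 +i* r 3).

Definition hermitian_norm (v : 'cV[C]_2) : R :=
  Num.sqrt (\sum_i abs2 (v i ord0)).

Definition mean_log_norm (sigma : probability 'rV[R]_4 R)
    (F : 'cV[C]_2 -> 'cV[C]_2) : R :=
  \int[sigma]_(x in unit_sphere 4) ln (hermitian_norm (F (to_C2 x))).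

(* R_F at the class [g]. *)
Definition RF_class (sigma : probability 'rV[R]_4 R)
    (F : 'I_2 -> mpoly 2 C) (g : 'M[C]_2) : R :=
  mean_log_norm sigma (conj_lift g (poly_map F)).

(* R_F on the ball. A representative g exists for every x in the ball, and the
   value does not depend on the one chosen. *)
Definition RF_ball (sigma : probability 'rV[R]_4 R)
    (F : 'I_2 -> mpoly 2 C) (x : 'rV[R]_3) : R :=
  RF_class sigma F (xget 1%:M [set g | SL2 g /\ ball_action g 0 = x]).

(* The hyperbolic gradient of rho at g . 0, computed with the representative g;
   it is meaningful when [rho \o ball_action g] is differentiable at 0. *)
Definition hyperbolic_gradient (rho : 'rV[R]_3 -> R) (g : 'M[C]_2) :
    'rV[R]_3 :=
  gradient (rho \o ball_action g) 0.

End energy.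

(* Main.v *)
(** A log-energy argument.  Let [u(P, Q) >= 0] be minus the logarithm of the
    squared chordal distance on P^1(C).  The Fubini-Study measure is the image of
    [sigma] under the Hopf map (two evaluations of a Gaussian integral over
    S^3 x C^2), so by rotation invariance the integral of [u(P, _)] over S^3 is a
    constant [c'], independent of [P].  The fibres of [f] can be enumerated by
    measurable maps [r_1, ..., r_d], with
      |F(v) /\ Q| = |k_Q| \prod_i |v /\ r_i(Q)|
    in homogeneous coordinates, and the pullback of a measure is the sum of its
    images under the [r_i].  For [h] in SL_2(C), integrating [u(F(h v), Q)] in [Q]
    first gives [c']; integrating first in [v] gives, by the product formula, the
    mean of log |F(h v)|^2 plus terms depending on [Q] only.  Comparing [h] with
    the identity yields
      2 R(F^h) - 2 R(F) = \int J(F(h v)) d sigma(v) + \sum_i \int J(r_i(Q)) dQ,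
    where [J(P) = log (|h^-1 P|^2 / |P|^2)].  For the positive hermitian matrix
    [h] carrying the origin of the ball to [x], and [zeta(P)] the point of S^2
    above [P],
      J(P) = log ((1 + |x|^2 - 2 x.zeta(P)) / (1 - |x|^2)) = - 2 x.zeta(P) + O(|x|^2),
    hence [R(F^h) = R(F) - x.m + O(|x|^2)] with [m] the first moment of the
    transport of omega_f.  Applying this to the lift F^g of f^g gives the gradient
    at an arbitrary point.  At a minimum [m = 0], and then concavity of the
    logarithm (the argument above is affine in x.zeta) shows that the potential of
    the barycenter is positive away from the origin, the measure having no atoms. *)
From HB Require Import structures.
Require Import Defs.
From mathcomp Require Import all_boot all_order all_algebra.
From mathcomp Require Import -(notations) mpoly.
From mathcomp Require Import all_classical all_reals all_analysis.
From mathcomp Require Import measurable_realfun.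
From mathcomp Require Import complex.
From mathcomp Require Import ring lra.

Set Implicit Arguments.
Unset Strict Implicit.
Unset Printing Implicit Defensive.

Import Order.TTheory GRing.Theory Num.Theory.
Import numFieldNormedType.Exports.

Local Open Scope classical_set_scope.
Local Open Scope ring_scope.
Local Open Scope complex_scope.

(** * Integration over the plane and the 3-sphere *)

(** Polar coordinates on C^2 are replaced by averaging a Gaussian over SU(2), whose action on plane
    integrals decomposes into shears. The energy is never differentiated under the integral sign: J
    is explicit, and only its first-order term matters. All interchanges of integrals are Tonelli's,
    which is why u takes values in [0, +oo]; the finiteness of c' then permits subtraction.
    Integrating in v first produces d copies of c', one per fibre point, and they disappear only in
    the comparison with the identity. The term J(F(h v)) is evaluated at a point that itself moves
    with h. As F is Lipschitz near the sphere and bounded away from 0 on it, this point stays at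
    chordal distance O(|x|) from F(v), and the scalar product with x turns the displacement into an
    error O(|x|^2). This is the branch that yields the pushforward part of omega_f, while the r_i
    yield the pullback part: d + 1 images of sigma in all. An expansion at the origin suffices
    because R_F(g . x) is the energy of the lift F^g at x, once R_F is known to depend only on the
    class. *)

Section measure_pack.
Context d d' (T1 : measurableType d) (T2 : measurableType d') (R : realType).
Variables (m : {measure set T1 -> \bar R}) (f : T1 -> T2).
Hypothesis mf : measurable_fun setT f.

Definition pushforward_pack : {measure set T2 -> \bar R} :=
  measure_function_pushforward__canonical__measure_function_Measure m mf.

Lemma pushforward_packE A : pushforward_pack A = m (f @^-1` A).
Proof. by []. Qed.

Lemma integral_pushforward_pack (h : T2 -> \bar R) : measurable_fun setT h ->
  (forall y, 0 <= h y)%E ->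
  (\int[pushforward_pack]_y h y = \int[m]_x h (f x))%E.
Proof.
by move=> mh h0; rewrite ge0_integral_pushforward// preimage_setT.
Qed.

End measure_pack.

Section lebesgue_affine.
Context {R : realType}.
Local Notation mu := (@lebesgue_measure R).
Local Open Scope ereal_scope.

Lemma lebesgue_measure_affine (a b : R) : (a != 0)%R ->
  forall A : set R, measurable A ->
  mu A = `|a|%:E * pushforward mu (fun x : measurableTypeR R => a * x + b : measurableTypeR R)%R A.
Proof.
move=> a0.
have mphi : measurable_fun setT
   (fun x : measurableTypeR R => a * x + b : measurableTypeR R)%R.
  by apply: measurable_funD => //; exact: measurable_funM.
set phi := (fun x : measurableTypeR R => _) in mphi *.
pose nu := mscale (NngNum (normr_ge0 a)) (pushforward_pack mu mphi).
move=> A mA; rewrite [LHS](@lebesgue_measure_unique _ nu)// => _ [[c d]] _ <-.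
rewrite /nu/= /mscale/= /pushforward.
have [a_gt0|a_lt0|a_eq0] := ltrgtP a 0; last by rewrite a_eq0 eqxx in a0.
(* For negative [a] the preimage of a half-open interval is half-open on the other side, which does
   not change its length. *)
- rewrite (_ : phi @^-1` _ = [set` `[((d - b) / a)%R, ((c - b) / a)%R[]); last first.
    apply/seteqP; split=> x /=; rewrite !in_itv/= => /andP[].
      by move=> ? ?; rewrite ler_ndivrMr// ltr_ndivlMr// ![(x * a)%R]mulrC lerBrDr ltrBlDr; apply/andP; split.
    by rewrite ler_ndivrMr// ltr_ndivlMr// ![(x * a)%R]mulrC lerBrDr ltrBlDr => -> ->.
  rewrite !lebesgue_measure_itv/= !lte_fin ltr_nM2r ?invr_lt0//.
  rewrite ltrD2r; case: ifPn => // _; last by rewrite mule0.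
  by rewrite -!EFinB -EFinM ltr0_norm//; congr (_%:E); field.
- rewrite (_ : phi @^-1` _ = [set` `]((c - b) / a)%R, ((d - b) / a)%R]]); last first.
    apply/seteqP; split=> x /=; rewrite !in_itv/= => /andP[].
      by move=> ? ?; rewrite ler_pdivlMr// ltr_pdivrMr// ![(x * a)%R]mulrC lerBrDr ltrBlDr; apply/andP; split.
    by rewrite ler_pdivlMr// ltr_pdivrMr// ![(x * a)%R]mulrC lerBrDr ltrBlDr => -> ->.
  rewrite !lebesgue_measure_itv/= !lte_fin ltr_pM2r ?invr_gt0//.
  rewrite ltrD2r; case: ifPn => // _; last by rewrite mule0.
  by rewrite -!EFinB -EFinM gtr0_norm//; congr (_%:E); field.
Qed.

Lemma integral_affine (a b : R) (f : R -> \bar R) : (a != 0)%R ->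
  measurable_fun setT f -> (forall x, 0 <= f x) ->
  `|a|%:E * \int[mu]_x f (a * x + b)%R = \int[mu]_x f x.
Proof.
move=> a0 mf f0.
have mphi : measurable_fun setT
   (fun x : measurableTypeR R => a * x + b : measurableTypeR R)%R.
  by apply: measurable_funD => //; exact: measurable_funM.
set phi := (fun x : measurableTypeR R => _) in mphi *.
transitivity (\int[mscale (NngNum (normr_ge0 a)) (pushforward_pack mu mphi)]_x f x).
  rewrite ge0_integral_mscale//=; congr (_ * _).
  by rewrite integral_pushforward_pack.
by apply: eq_measure_integral => A mA _; rewrite [RHS](lebesgue_measure_affine b a0).
Qed.

End lebesgue_affine.

(** * Measurability of complex-valued functions *)

Section complex_measurability.
Context {R : realType}.
Local Notation C := R[i].

Definition cplx_of (p : R * R) : C := p.1 +i* p.2.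
Definition pair_of (z : C) : R * R := (complex.Re z, complex.Im z).

Lemma pair_ofK : cancel pair_of cplx_of. Proof. by case. Qed.
Lemma cplx_ofK : cancel cplx_of pair_of. Proof. by case. Qed.

Lemma cReD (x y : C) : complex.Re (x + y) = complex.Re x + complex.Re y.
Proof. by case: x; case: y. Qed.
Lemma cImD (x y : C) : complex.Im (x + y) = complex.Im x + complex.Im y.
Proof. by case: x; case: y. Qed.
Lemma cReN (x : C) : complex.Re (- x) = - complex.Re x.
Proof. by case: x. Qed.
Lemma cImN (x : C) : complex.Im (- x) = - complex.Im x.
Proof. by case: x. Qed.
Lemma cReM (x y : C) : complex.Re (x * y) =
  complex.Re x * complex.Re y - complex.Im x * complex.Im y.
Proof. by case: x; case: y. Qed.
Lemma cImM (x y : C) : complex.Im (x * y) =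
  complex.Re x * complex.Im y + complex.Im x * complex.Re y.
Proof. by case: x; case: y. Qed.

Lemma abs2_ge0 (z : C) : 0 <= abs2 z.
Proof. by rewrite addr_ge0 ?sqr_ge0. Qed.

Lemma abs2_eq0 (z : C) : (abs2 z == 0) = (z == 0).
Proof.
case: z => a b; rewrite /abs2/= paddr_eq0 ?sqr_ge0// !sqrf_eq0.
by rewrite eq_complex.
Qed.

Lemma abs2_gt0 (z : C) : (0 < abs2 z) = (z != 0).
Proof. by rewrite lt_def abs2_ge0 andbT abs2_eq0. Qed.

Lemma abs2M (x y : C) : abs2 (x * y) = abs2 x * abs2 y.
Proof. by rewrite /abs2 cReM cImM; ring. Qed.

Lemma abs2N (x : C) : abs2 (- x) = abs2 x.
Proof. by rewrite /abs2 cReN cImN !sqrrN. Qed.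

Lemma abs2_conj (x : C) : abs2 x^* = abs2 x.
Proof. by case: x => a b; rewrite /abs2/= sqrrN. Qed.

Lemma abs20 : abs2 (0 : C) = 0.
Proof. by rewrite /abs2/= expr0n addr0. Qed.
Lemma abs21 : abs2 (1 : C) = 1.
Proof. by rewrite /abs2/= expr1n expr0n addr0. Qed.

Lemma abs2_prod I (r : seq I) (P : pred I) (F : I -> C) :
  abs2 (\prod_(i <- r | P i) F i) = \prod_(i <- r | P i) abs2 (F i).
Proof. by apply: (big_morph _ abs2M abs21). Qed.

Lemma abs2X (x : C) n : abs2 (x ^+ n) = abs2 x ^+ n.
Proof.
by elim: n => [|n IH]; rewrite ?expr0 ?abs21// !exprS abs2M IH.
Qed.

Lemma mulcJ (z : C) : z * z^* = (abs2 z)%:C.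
Proof.
by apply/eqP; rewrite eq_complex; case: z => a b; rewrite /abs2 cReM cImM/=; apply/andP; split; apply/eqP; ring.
Qed.

Lemma abs2V (z : C) : abs2 z^-1 = (abs2 z)^-1.
Proof.
have [->|z0] := eqVneq z 0; first by rewrite invr0 abs20 invr0.
have z0' : abs2 z != 0 by rewrite abs2_eq0.
by apply: (mulfI z0'); rewrite -abs2M divff// abs21 divff.
Qed.

Lemma invcE (z : C) : z^-1 = z^* * ((abs2 z)^-1)%:C.
Proof.
have [->|z0] := eqVneq z 0.
  by apply/eqP; rewrite eq_complex invr0 cReM cImM/= oppr0 !mul0r subr0 addr0 eqxx.
apply: (mulfI z0); rewrite divff// mulrA mulcJ -rmorphM/= divff// abs2_eq0//.
Qed.

Section cmeas.
Context d (T : measurableType d).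
Implicit Types f g : T -> C.

(** Measurability into C is read through the identification of C with R x R. *)
Definition cmeas f := measurable_fun setT (pair_of \o f).

Lemma cmeasP f : cmeas f <-> measurable_fun setT (fun t => complex.Re (f t)) /\
  measurable_fun setT (fun t => complex.Im (f t)).
Proof. exact: measurable_fun_pairP. Qed.

Lemma cmeas_cst c : cmeas (fun=> c).
Proof. by apply/cmeasP; split; exact: measurable_cst. Qed.

Lemma cmeas_real (f : T -> R) : measurable_fun setT f -> cmeas (fun t => (f t)%:C).
Proof. by move=> mf; apply/cmeasP; split => //=; exact: measurable_cst. Qed.

Lemma cmeasD f g : cmeas f -> cmeas g -> cmeas (fun t => f t + g t).
Proof.
move=> /cmeasP[f1 f2] /cmeasP[g1 g2]; apply/cmeasP; split.
  by under eq_fun do rewrite cReD; exact: measurable_funD.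
by under eq_fun do rewrite cImD; exact: measurable_funD.
Qed.

Lemma cmeasN f : cmeas f -> cmeas (fun t => - f t).
Proof.
move=> /cmeasP[f1 f2]; apply/cmeasP; split.
  by under eq_fun do rewrite cReN; exact: measurable_funN.
by under eq_fun do rewrite cImN; exact: measurable_funN.
Qed.

Lemma cmeasB f g : cmeas f -> cmeas g -> cmeas (fun t => f t - g t).
Proof. by move=> mf mg; apply: cmeasD => //; exact: cmeasN. Qed.

Lemma cmeasM f g : cmeas f -> cmeas g -> cmeas (fun t => f t * g t).
Proof.
move=> /cmeasP[f1 f2] /cmeasP[g1 g2]; apply/cmeasP; split.
  by under eq_fun do rewrite cReM; apply: measurable_funB; exact: measurable_funM.
by under eq_fun do rewrite cImM; apply: measurable_funD; exact: measurable_funM.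
Qed.

Lemma cmeas_conj f : cmeas f -> cmeas (fun t => (f t)^*).
Proof.
move=> /cmeasP[f1 f2]; apply/cmeasP; split.
  by apply: eq_measurable_fun f1 => t _; case: (f t).
apply: (eq_measurable_fun (fun t => - complex.Im (f t))).
  by move=> t _; case: (f t).
exact: measurable_funN.
Qed.

Lemma measurable_abs2 f : cmeas f -> measurable_fun setT (fun t => abs2 (f t)).
Proof.
by move=> /cmeasP[f1 f2]; apply: measurable_funD; exact: measurable_funX.
Qed.

(** On non-negative reals the inverse is the power of exponent -1, including at 0 where both take
    the value 0. *)
Lemma measurable_invr_nneg (f : T -> R) : (forall t, 0 <= f t) ->
  measurable_fun setT f -> measurable_fun setT (fun t => (f t)^-1).
Proof.
move=> f0 mf; apply: (eq_measurable_fun (fun t => f t `^ (- 1%:R))).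
  by move=> t _; rewrite powR_invn ?expr1.
exact: (measurableT_comp (measurable_powR _)).
Qed.

Lemma cmeasV f : cmeas f -> cmeas (fun t => (f t)^-1).
Proof.
move=> mf; under eq_fun do rewrite invcE.
apply: cmeasM; first exact: cmeas_conj.
apply: cmeas_real; apply: measurable_invr_nneg => [t|]; first exact: abs2_ge0.
exact: measurable_abs2.
Qed.

Lemma cmeas_cplx (f : T -> R * R) : measurable_fun setT f -> cmeas (cplx_of \o f).
Proof.
by move=> mf; rewrite /cmeas; apply: eq_measurable_fun mf => t _; rewrite /= cplx_ofK.
Qed.

Lemma cmeas_sum (I : eqType) (r : seq I) (F : I -> T -> C) :
  (forall i, cmeas (F i)) -> cmeas (fun t => \sum_(i <- r) F i t).
Proof.
move=> mF; elim: r => [|i r IH].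
  by under eq_fun do rewrite big_nil; exact: cmeas_cst.
by under eq_fun do rewrite big_cons; exact: cmeasD.
Qed.

End cmeas.

Lemma cmeas_comp d d' (T : measurableType d) (T' : measurableType d')
  (g : T' -> T) (f : T -> C) : measurable_fun setT g -> cmeas f -> cmeas (f \o g).
Proof. by move=> mg mf; exact: measurableT_comp mf mg. Qed.

End complex_measurability.

(** * Changes of variables on C and C^2 *)

Section plane_integral.
Context {R : realType}.
Local Notation C := R[i].
Local Notation mu := (@lebesgue_measure R).

(** A named copy of the product measure, which carries the sigma-finite structure that Tonelli's
    theorem asks for. *)
Definition plane_measure : set (measurableTypeR R * measurableTypeR R)%type -> \bar R :=
  product_measure1 (@lebesgue_measure R) (@lebesgue_measure R).
HB.instance Definition _ := Measure.on plane_measure.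

Let plane_measure_sigma_finite : sigma_finite setT plane_measure.
Proof.
have /sigma_finiteP[F [TF ndF Foo]] := @sigma_finiteT _ _ _ mu.
exists (fun n => F n `*` F n) => [|n].
  apply/seteqP; split=> [[x y] _|//].
  have [[n _ Fnx] [m _ Fmy]] : (\bigcup_i F i) x /\ (\bigcup_i F i) y by rewrite -TF.
  exists (maxn n m) => //; split.
    by move: x Fnx; exact/subsetPset/ndF/leq_maxl.
  by move: y Fmy; exact/subsetPset/ndF/leq_maxr.
have [mFn Fn_fin] := Foo n; split; first exact: measurableX.
by rewrite /plane_measure product_measure1E// lte_mul_pinfty// ge0_fin_numE.
Qed.

HB.instance Definition _ := @Measure_isSigmaFinite.Build _ _ _ plane_measure
  plane_measure_sigma_finite.

Local Notation mu2 := plane_measure.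
Local Open Scope ereal_scope.

Lemma tonelli_swap d1 d2 (T1 : measurableType d1) (T2 : measurableType d2)
    (m1 : {sigma_finite_measure set T1 -> \bar R})
    (m2 : {sigma_finite_measure set T2 -> \bar R}) (f : T1 -> T2 -> \bar R) :
  measurable_fun setT (fun p : T1 * T2 => f p.1 p.2) -> (forall x y, 0 <= f x y) ->
  \int[m1]_x \int[m2]_y f x y = \int[m2]_y \int[m1]_x f x y.
Proof.
move=> mf f0.
have := @fubini_tonelli _ _ _ _ _ m1 m2 (fun p => f p.1 p.2) mf.
by apply => -[].
Qed.

Lemma measurable_tonelli_l d1 d2 (T1 : measurableType d1) (T2 : measurableType d2)
    (m2 : {sigma_finite_measure set T2 -> \bar R}) (f : T1 -> T2 -> \bar R) :
  measurable_fun setT (fun p : T1 * T2 => f p.1 p.2) -> (forall x y, 0 <= f x y) ->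
  measurable_fun setT (fun x => \int[m2]_y f x y).
Proof.
move=> mf f0.
have := @measurable_fun_fubini_tonelli_F _ _ T1 T2 R m2 (fun p => f p.1 p.2) mf.
by apply => -[].
Qed.

Lemma integral_plane (f : R -> R -> \bar R) :
  measurable_fun setT (fun p : R * R => f p.1 p.2) -> (forall x y, 0 <= f x y) ->
  \int[mu2]_p f p.1 p.2 = \int[mu]_x \int[mu]_y f x y.
Proof.
move=> mf f0.
have := @fubini_tonelli1 _ _ _ _ R mu mu (fun p => f p.1 p.2) mf.
by apply => -[].
Qed.

Lemma integral_plane' (f : R -> R -> \bar R) :
  measurable_fun setT (fun p : R * R => f p.1 p.2) -> (forall x y, 0 <= f x y) ->
  \int[mu2]_p f p.1 p.2 = \int[mu]_y \int[mu]_x f x y.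
Proof. by move=> mf f0; rewrite integral_plane// tonelli_swap. Qed.

Lemma measurable_affine2 (a b c : R) :
  measurable_fun setT (fun p : R * R => a * p.1 + b * p.2 + c)%R.
Proof.
by apply: measurable_funD => //; apply: measurable_funD => //; exact: measurable_funM.
Qed.

Lemma measurable_planemap (a b c a' b' c' : R) (f : R -> R -> \bar R) :
  measurable_fun setT (fun p : R * R => f p.1 p.2) ->
  measurable_fun setT (fun p : R * R =>
     f (a * p.1 + b * p.2 + c)%R (a' * p.1 + b' * p.2 + c')%R).
Proof.
move=> mf.
apply: (measurableT_comp mf (g := fun p : R * R =>
     ((a * p.1 + b * p.2 + c)%R, (a' * p.1 + b' * p.2 + c')%R))).
by apply: measurable_fun_pair; exact: measurable_affine2.
Qed.

Lemma integral_plane_translate (a b : R) (f : R -> R -> \bar R) :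
  measurable_fun setT (fun p : R * R => f p.1 p.2) -> (forall x y, 0 <= f x y) ->
  \int[mu2]_p f (p.1 + a)%R (p.2 + b)%R = \int[mu2]_p f p.1 p.2.
Proof.
move=> mf f0.
have mf' : measurable_fun setT (fun p : R * R => f (p.1 + a)%R (p.2 + b)%R).
  have := measurable_planemap 1 0 a 0 1 b mf.
  by under eq_fun do rewrite !mul1r !mul0r addr0 add0r.
rewrite (integral_plane mf f0) (integral_plane (f := fun x y => f (x + a)%R (y + b)%R))//.
transitivity (\int[mu]_x (\int[mu]_y f (x + a)%R y)).
  apply: eq_integral => x _.
  rewrite -[RHS](integral_affine b (oner_neq0 R) (f := fun y => f (x + a)%R y))//.
    by rewrite normr1 mul1e; apply: eq_integral => y _; rewrite mul1r.
  exact: (measurableT_comp mf (pair1_measurable (x + a)%R)).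
rewrite -[RHS](integral_affine a (oner_neq0 R) (f := fun x => \int[mu]_y f x y))//.
- by rewrite normr1 mul1e; apply: eq_integral => y _; rewrite mul1r.
- exact: measurable_tonelli_l.
- by move=> x; exact: integral_ge0.
Qed.

(** Multiplication by x + i y is factored into affine substitutions in one variable at a time. When
    x = 0 it exchanges the two coordinates up to scaling, and is treated apart. *)
Lemma integral_plane_cmul (x y : R) (f : R -> R -> \bar R) :
  (x ^+ 2 + y ^+ 2 != 0)%R ->
  measurable_fun setT (fun p : R * R => f p.1 p.2) -> (forall x y, 0 <= f x y) ->
  (x ^+ 2 + y ^+ 2)%:E * \int[mu2]_p f (x * p.1 - y * p.2)%R (x * p.2 + y * p.1)%R =
  \int[mu2]_p f p.1 p.2.
Proof.
move=> xy0 mf f0.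
have mf' : measurable_fun setT (fun p : R * R => f (x * p.1 - y * p.2)%R (x * p.2 + y * p.1)%R).
  have := measurable_planemap x (- y) 0 y x 0 mf.
  by under eq_fun do rewrite mulNr !addr0 (addrC (y * _)%R).
rewrite (integral_plane' (f := fun a b => f (x * a - y * b)%R (x * b + y * a)%R))//.
have [x0|x0] := eqVneq x 0%R.
  have y0 : y != 0%R by move: xy0; rewrite x0 expr0n add0r expf_eq0.
  rewrite x0 expr0n add0r -[(y ^+ 2)%R]ger0_norm ?sqr_ge0// normrX expr2 EFinM -muleA.
  transitivity (`|y|%:E * \int[mu]_b (\int[mu]_a f (- y * b)%R a)).
    congr (_ * _); rewrite -ge0_integralZl_EFin//.
    - apply: eq_integral => b _.
      rewrite -[RHS](integral_affine 0 y0 (f := fun a => f (- y * b)%R a))//.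
        by congr (_ * _); apply: eq_integral => a _; rewrite !mul0r !add0r addr0 mulNr.
      exact: (measurableT_comp mf (pair1_measurable _)).
    - by move=> b _; exact: integral_ge0.
    - apply: (@measurable_tonelli_l _ _ _ _ mu (fun b a => f (0 * a - y * b)%R (0 * b + y * a)%R)) => //.
      apply: eq_measurable_fun (measurable_planemap (- y) 0 0 0 y 0 mf) => p _ /=.
      by congr (f _ _); ring.
  have ny0 : (- y != 0)%R by rewrite oppr_eq0.
  rewrite integral_plane// -(normrN y).
  rewrite -[RHS](integral_affine 0 ny0 (f := fun b => \int[mu]_a f b a)).
  - by congr (_ * _); apply: eq_integral => b _; rewrite addr0.
  - exact: measurable_tonelli_l.
  - by move=> b; exact: integral_ge0.
(* Substituting the first coordinate, a becomes (a + y b) / x, and the second one becomes (y / x) a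
   + k b. The two scaling factors x and k multiply to x^2 + y^2. *)
pose k := (y ^+ 2 / x + x)%R.
have k0 : k != 0%R.
  apply: contra_neq xy0 => k0; rewrite -[RHS](mulr0 x) -k0 /k; field.
  by [].
have kx : (x ^+ 2 + y ^+ 2 = `|k| * `|x|)%R.
  rewrite -normrM (_ : (k * x)%R = (x ^+ 2 + y ^+ 2)%R) ?ger0_norm ?addr_ge0 ?sqr_ge0//.
  by rewrite /k; field.
rewrite kx EFinM -muleA -ge0_integralZl_EFin//; last 2 first.
- by move=> b _; exact: integral_ge0.
- apply: (@measurable_tonelli_l _ _ _ _ mu (fun b a => f (x * a - y * b)%R (x * b + y * a)%R)) => //.
  apply: eq_measurable_fun (measurable_planemap (- y) x 0 x y 0 mf) => p _ /=.
  by congr (f _ _); ring.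
transitivity (`|k|%:E * \int[mu]_b \int[mu]_a f a (y / x * a + k * b)%R).
  congr (_ * _); apply: eq_integral => b _.
  rewrite -[RHS](integral_affine (- (y * b)) x0 (f := fun a => f a (y / x * a + k * b)%R))//.
    congr (_ * _); apply: eq_integral => a _; congr (f _ _).
    by rewrite /k; field.
  have := measurableT_comp (measurable_planemap 1 0 0 (y / x) k 0 mf)
     (pair2_measurable b).
  by rewrite /comp/=; under eq_fun do rewrite mul1r mul0r !addr0.
have mk : measurable_fun setT (fun p : R * R => f p.1 (y / x * p.1 + k * p.2)%R).
  have := measurable_planemap 1 0 0 (y / x) k 0 mf.
  by under eq_fun do rewrite mul1r mul0r !addr0.
rewrite -(tonelli_swap mu mu (f := fun a b => f a (y / x * a + k * b)%R))//.
rewrite -ge0_integralZl_EFin//; last 2 first.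
- by move=> b _; exact: integral_ge0.
- exact: (@measurable_tonelli_l _ _ _ _ mu (fun a b => f a (y / x * a + k * b)%R)).
rewrite integral_plane//; apply: eq_integral => a _.
rewrite -[RHS](integral_affine (y / x * a) k0 (f := fun b => f a b))//.
  by congr (_ * _); apply: eq_integral => b _; rewrite addrC.
exact: (measurableT_comp mf (pair1_measurable _)).
Qed.

End plane_integral.

Section complex_integral.
Context {R : realType}.
Local Notation C := R[i].
Local Notation mu2 := (@plane_measure R).
Local Open Scope ereal_scope.

Definition cplx_integral (f : C -> \bar R) := \int[mu2]_p f (cplx_of p).

Definition cmeas1 (f : C -> \bar R) := measurable_fun setT (f \o cplx_of).

Definition cmeas2 (f : C -> C -> \bar R) :=
  measurable_fun setT (fun p : (R * R) * (R * R) => f (cplx_of p.1) (cplx_of p.2)).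

Lemma cmeas2_comp d (T : measurableType d) (f : C -> C -> \bar R) (g h : T -> C) :
  cmeas2 f -> cmeas g -> cmeas h -> measurable_fun setT (fun t => f (g t) (h t)).
Proof.
move=> mf mg mh.
apply: eq_measurable_fun (measurableT_comp mf (measurable_fun_pair mg mh)) => t _ /=.
by rewrite !pair_ofK.
Qed.

Lemma cmeas_cplx_of : cmeas (@cplx_of R).
Proof. exact: (cmeas_cplx (f := id)). Qed.

Lemma cmeas_fst : cmeas (fun p : (R * R) * (R * R) => cplx_of p.1).
Proof. exact: (cmeas_cplx (f := fst)). Qed.

Lemma cmeas_snd : cmeas (fun p : (R * R) * (R * R) => cplx_of p.2).
Proof. exact: (cmeas_cplx (f := snd)). Qed.

Lemma cmeas2_l (f : C -> C -> \bar R) z : cmeas2 f -> cmeas1 (f z).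
Proof.
move=> mf; apply: (cmeas2_comp mf (g := fun=> z)); first exact: cmeas_cst.
exact: cmeas_cplx_of.
Qed.

Lemma cmeas2_r (f : C -> C -> \bar R) z : cmeas2 f -> cmeas1 (f ^~ z).
Proof.
move=> mf; apply: (cmeas2_comp mf (h := fun=> z)); last exact: cmeas_cst.
exact: cmeas_cplx_of.
Qed.

Lemma cmeas1_integral (f : C -> C -> \bar R) : cmeas2 f ->
  (forall z w, 0 <= f z w) -> cmeas1 (fun z => cplx_integral (f z)).
Proof.
move=> mf f0.
exact: (@measurable_tonelli_l R _ _ _ _ mu2 (fun p q => f (cplx_of p) (cplx_of q))
  mf (fun _ _ => f0 _ _)).
Qed.

Lemma cplx_integral_ge0 (f : C -> \bar R) : (forall z, 0 <= f z) ->
  0 <= cplx_integral f.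
Proof. by move=> f0; exact: integral_ge0. Qed.

Lemma cplx_integral_swap (f : C -> C -> \bar R) : cmeas2 f ->
  (forall z w, 0 <= f z w) ->
  cplx_integral (fun z => cplx_integral (f z)) =
  cplx_integral (fun w => cplx_integral (f ^~ w)).
Proof.
move=> mf f0.
exact: (@tonelli_swap R _ _ _ _ mu2 mu2 (fun p q => f (cplx_of p) (cplx_of q)) mf (fun _ _ => f0 _ _)).
Qed.

Lemma eq_cplx_integral (f g : C -> \bar R) : f =1 g ->
  cplx_integral f = cplx_integral g.
Proof. by move=> fg; apply: eq_integral => p _; rewrite fg. Qed.

Lemma cplx_integralZl (f : C -> \bar R) (k : R) : (0 <= k)%R -> cmeas1 f ->
  (forall z, 0 <= f z) ->
  cplx_integral (fun z => k%:E * f z) = k%:E * cplx_integral f.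
Proof.
by move=> k0 mf f0; rewrite /cplx_integral ge0_integralZl_EFin// => p _; exact: f0.
Qed.

Lemma cplx_integralZr (f : C -> \bar R) (k : \bar R) : (0 <= k) -> cmeas1 f ->
  (forall z, 0 <= f z) ->
  cplx_integral (fun z => f z * k) = cplx_integral f * k.
Proof.
move=> k0 mf f0; rewrite /cplx_integral ge0_integralZr// => p _; exact: f0.
Qed.

Lemma cplx_integral_translate (a : C) (f : C -> \bar R) : cmeas1 f ->
  (forall z, 0 <= f z) -> cplx_integral (fun z => f (z + a)%R) = cplx_integral f.
Proof.
move=> mf f0.
rewrite -[RHS](@integral_plane_translate _ (complex.Re a) (complex.Im a)
  (fun x y => f (cplx_of (x, y)))) //.
by apply: eq_integral => p _; case: a.
Qed.

Lemma cplx_integral_mul (c : C) (f : C -> \bar R) : c != 0%R -> cmeas1 f ->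
  (forall z, 0 <= f z) ->
  (abs2 c)%:E * cplx_integral (fun z => f (c * z)%R) = cplx_integral f.
Proof.
move=> c0 mf f0.
rewrite -[RHS](@integral_plane_cmul _ (complex.Re c) (complex.Im c)
  (fun x y => f (cplx_of (x, y)))) //.
- by congr (_ * _); apply: eq_integral => p _; case: (c).
- by rewrite -[X in X != _]/(abs2 c) abs2_eq0.
Qed.

Definition cplx2_integral (f : C -> C -> \bar R) :=
  cplx_integral (fun z => cplx_integral (f z)).

Lemma cplx2_integral_shearl (b : C) (f : C -> C -> \bar R) : cmeas2 f ->
  (forall z w, 0 <= f z w) ->
  cplx2_integral (fun z w => f (z + b * w)%R w) = cplx2_integral f.
Proof.
move=> mf f0.
have m1 : cmeas2 (fun z w => f (z + b * w)%R w).
  apply: (cmeas2_comp mf); last exact: cmeas_snd.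
  apply: cmeasD; first exact: cmeas_fst.
  by apply: cmeasM; [exact: cmeas_cst|exact: cmeas_snd].
rewrite /cplx2_integral [RHS](cplx_integral_swap mf f0).
rewrite (cplx_integral_swap m1 (fun z w => f0 _ _)).
apply: eq_cplx_integral => w /=.
exact: (cplx_integral_translate (b * w)%R (f := f ^~ w) (cmeas2_r w mf) (f0 ^~ w)).
Qed.

Lemma cplx2_integral_shearr (b : C) (f : C -> C -> \bar R) : cmeas2 f ->
  (forall z w, 0 <= f z w) ->
  cplx2_integral (fun z w => f z (w + b * z)%R) = cplx2_integral f.
Proof.
move=> mf f0; rewrite /cplx2_integral.
apply: eq_cplx_integral => z /=.
by rewrite (cplx_integral_translate (b * z)%R (f := f z))//; exact: cmeas2_l.
Qed.

Lemma cmeas2_lin (a b c d : C) (f : C -> C -> \bar R) : cmeas2 f ->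
  cmeas2 (fun z w => f (a * z + b * w)%R (c * z + d * w)%R).
Proof.
move=> mf; apply: (cmeas2_comp mf); apply: cmeasD; apply: cmeasM;
  by [exact: cmeas_cst|exact: cmeas_fst|exact: cmeas_snd].
Qed.

(** For q <> 0 a matrix of determinant 1 with lower left entry q is a product of three shears
    (upper, lower, upper), with coefficients (p - 1) / q, q and (conj p - 1) / q. Each of them
    preserves the integral by translation invariance. For q = 0 the matrix is diagonal with entries
    of modulus 1. *)
Lemma cplx2_integral_SU2 (p q : C) (f : C -> C -> \bar R) :
  (abs2 p + abs2 q = 1)%R -> cmeas2 f -> (forall z w, 0 <= f z w) ->
  cplx2_integral (fun z w => f (p * z - conjc q * w)%R (q * z + conjc p * w)%R) =
  cplx2_integral f.
Proof.
move=> pq1 mf f0.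
have [q0|q0] := eqVneq q 0%R.
  have p1 : abs2 p = 1%R by move: pq1; rewrite q0 abs20 addr0.
  have p0 : p != 0%R by rewrite -abs2_eq0 p1 oner_eq0.
  have p0' : (conjc p) != 0%R by rewrite -abs2_eq0 abs2_conj p1 oner_eq0.
  transitivity (cplx2_integral (fun z w => f (p * z)%R (conjc p * w)%R)).
    apply: eq_cplx_integral => z; apply: eq_cplx_integral => w.
    by rewrite q0 conjc0 !mul0r subr0 add0r.
  rewrite /cplx2_integral.
  rewrite -[RHS](cplx_integral_mul p0 (f := fun z => cplx_integral (f z))); last 2 first.
  - exact: cmeas1_integral.
  - by move=> z; exact: cplx_integral_ge0.
  rewrite p1 mul1e; apply: eq_cplx_integral => z.
  rewrite -[RHS](cplx_integral_mul p0' (f := f (p * z)%R)) ?abs2_conj ?p1 ?mul1e//.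
  exact: cmeas2_l.
pose b := ((p - 1) / q)%R; pose d := ((conjc p - 1) / q)%R.
have m1 : cmeas2 (fun z w => f (z + b * w)%R w).
  have := cmeas2_lin 1%R b 0%R 1%R mf.
  by apply: eq_measurable_fun => x _; rewrite !mul1r mul0r add0r.
have m2 : cmeas2 (fun z w => f (z + b * (w + q * z))%R (w + q * z)%R).
  have := cmeas2_lin 1%R 0%R q 1%R m1.
  by apply: eq_measurable_fun => x _; rewrite !mul1r mul0r addr0 [(q * _ + _)%R]addrC.
rewrite -[RHS](cplx2_integral_shearl b mf f0).
rewrite -[RHS](cplx2_integral_shearr q m1 (fun z w => f0 _ _)).
rewrite -[RHS](cplx2_integral_shearl d m2 (fun z w => f0 _ _)).
have pp : (p * conjc p = 1 - q * conjc q)%R.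
  rewrite !mulcJ -(rmorph1 (real_complex R)) -rmorphB; congr (_ %:C)%R.
  by rewrite -pq1 addrK.
have bq : (b * q = p - 1)%R by rewrite /b divfK.
have dq : (q * d = conjc p - 1)%R by rewrite /d mulrC divfK.
apply: eq_cplx_integral => z; apply: eq_cplx_integral => w; congr (f _ _).
  apply: (mulIf q0).
  transitivity (p * q * z + (p * conjc p - 1) * w)%R; first by rewrite pp; ring.
  transitivity (z * q + q * d * w + b * q * (w + q * z + q * d * w))%R; last by ring.
  by rewrite bq dq; ring.
rewrite (_ : w + q * (z + d * w) = q * z + (1 + q * d) * w)%R; last by ring.
by rewrite dq; congr (_ + _ * _)%R; ring.
Qed.

End complex_integral.

(** * Rotations of the 3-sphere *)

Section quaternion_rotations.
Context {R : realType}.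
Local Notation C := R[i].

Definition mx4 (s : seq (seq R)) : 'M[R]_4 := \matrix_(i, j) nth 0 (nth [::] s i) j.

(* [e = 1] gives left multiplications by quaternions, [e = -1] right ones. *)
Definition quat_mx (e a b c d : R) : 'M[R]_4 := mx4
  [:: [:: a; b; c; d]; [:: - b; a; - (e * d); e * c];
      [:: - c; e * d; a; - (e * b)]; [:: - d; - (e * c); e * b; a]].

Lemma quat_mxT (e a b c d : R) : e ^+ 2 = 1 ->
  a ^+ 2 + b ^+ 2 + c ^+ 2 + d ^+ 2 = 1 ->
  quat_mx e a b c d *m (quat_mx e a b c d)^T = 1%:M.
Proof.
move=> /eqP; rewrite sqrf_eq1 => e1 n1.
apply/matrixP => i j; rewrite !mxE !big_ord_recl big_ord0 !mxE/=.
by case/orP: e1 => /eqP ->; case: i => -[|[|[|[|//]]]] ? ;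
  case: j => -[|[|[|[|//]]]] ? /=; rewrite ?mulr1n ?mulr0n; first [ring | by rewrite -[RHS]n1; ring].
Qed.

Lemma det_quat_mx (e a b c d : R) : e ^+ 2 = 1 ->
  \det (quat_mx e a b c d) = (a ^+ 2 + b ^+ 2 + c ^+ 2 + d ^+ 2) ^+ 2.
Proof.
move=> /eqP; rewrite sqrf_eq1 => e1.
rewrite (expand_det_row _ ord0) !big_ord_recl big_ord0 /cofactor.
rewrite !(expand_det_row _ ord0) !big_ord_recl !big_ord0 /cofactor.
rewrite !(expand_det_row _ ord0) !big_ord_recl !big_ord0 /cofactor !det_mx11.
rewrite !mxE/=.
by case/orP: e1 => /eqP ->; ring.
Qed.

End quaternion_rotations.

Section rV_measurability.
Context {R : realType}.

Lemma measurable_rV_coord n (i : 'I_n) :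
  measurable_fun setT (fun v : 'rV[R]_n => v ord0 i).
Proof.
move=> _ Y mY; rewrite setTI; apply: sub_sigma_algebra => /=.
rewrite -bigcup_seq/=; exists i => /=; first by rewrite mem_index_enum.
by exists Y => //; rewrite setTI.
Qed.

Lemma measurable_fun_rVP d (T : measurableType d) n (f : T -> 'rV[R]_n) :
  measurable_fun setT f <-> forall i, measurable_fun setT (fun t => f t ord0 i).
Proof.
split=> [mf i|mf].
  exact: measurableT_comp (measurable_rV_coord i) mf.
apply: (measurability
  (\big[setU/set0]_(i < n) preimage_set_system setT (fun v : 'rV[R]_n => v ord0 i) measurable)) => //.
rewrite -bigcup_seq => _ [_ [i _ [B mB <-] <-]].
rewrite !setTI -comp_preimage -[X in measurable X]setTI.
exact: mf.
Qed.

Lemma measurable_sqnorm n : measurable_fun setT (@sqnorm R n).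
Proof.
by apply: measurable_sum => i; apply: measurable_funX; exact: measurable_rV_coord.
Qed.

Lemma measurable_unit_sphere n : measurable (@unit_sphere R n).
Proof.
rewrite (_ : unit_sphere n = setT `&` (@sqnorm R n) @^-1` [set 1]).
  by apply: measurable_sqnorm => //; exact: measurable_set1.
by rewrite setTI; apply/seteqP; split.
Qed.

Lemma measurable_mulmxr n (Q : 'M[R]_n) :
  measurable_fun setT (fun x : 'rV[R]_n => x *m Q).
Proof.
apply/measurable_fun_rVP => i.
under eq_fun do rewrite mxE.
by apply: measurable_sum => j; apply: measurable_funM => //; exact: measurable_rV_coord.
Qed.

End rV_measurability.

Section C2_coordinates.
Context {R : realType}.
Local Notation C := R[i].

Definition z1 (x : 'rV[R]_4) : C := x ord0 (inord 0) +i* x ord0 (inord 1).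
Definition z2 (x : 'rV[R]_4) : C := x ord0 (inord 2) +i* x ord0 (inord 3).

Lemma to_C2E x : to_C2 x = col2 (z1 x) (z2 x). Proof. by []. Qed.

Lemma cmeas_z1 : cmeas z1.
Proof. by apply/cmeasP; split; exact: measurable_rV_coord. Qed.
Lemma cmeas_z2 : cmeas z2.
Proof. by apply/cmeasP; split; exact: measurable_rV_coord. Qed.

Lemma big_inord4 (F : 'I_4 -> R) :
  \sum_i F i = F (inord 0) + F (inord 1) + F (inord 2) + F (inord 3).
Proof.
rewrite !big_ord_recl big_ord0 addr0 !addrA; congr (_ + _ + _ + _); congr F;
  by apply/val_inj; rewrite /= inordK.
Qed.

Lemma sqnorm4E (x : 'rV[R]_4) : sqnorm x = abs2 (z1 x) + abs2 (z2 x).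
Proof. by rewrite /sqnorm big_inord4 /abs2/= !addrA. Qed.

Lemma z_mul_quat (e a b c d : R) x :
  z1 (x *m quat_mx e a b c d) =
    (a * x ord0 (inord 0) - b * x ord0 (inord 1) - c * x ord0 (inord 2) - d * x ord0 (inord 3)) +i*
    (b * x ord0 (inord 0) + a * x ord0 (inord 1) + e * d * x ord0 (inord 2) - e * c * x ord0 (inord 3)) /\
  z2 (x *m quat_mx e a b c d) =
    (c * x ord0 (inord 0) - e * d * x ord0 (inord 1) + a * x ord0 (inord 2) + e * b * x ord0 (inord 3)) +i*
    (d * x ord0 (inord 0) + e * c * x ord0 (inord 1) - e * b * x ord0 (inord 2) + a * x ord0 (inord 3)).
Proof.
by split; rewrite /z1 /z2 !mxE !big_inord4 !mxE !inordK//=;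
  apply/eqP; rewrite eq_complex/=; apply/andP; split; apply/eqP; ring.
Qed.

Definition lquat (p q : C) : 'M[R]_4 :=
  quat_mx 1 (complex.Re p) (complex.Im p) (complex.Re q) (complex.Im q).
Definition rquat (p q : C) : 'M[R]_4 :=
  quat_mx (-1) (complex.Re p) (complex.Im p) (complex.Re q) (complex.Im q).

Lemma z_lquat (p q : C) x :
  z1 (x *m lquat p q) = p * z1 x - q^* * z2 x /\
  z2 (x *m lquat p q) = q * z1 x + p^* * z2 x.
Proof.
have [-> ->] := z_mul_quat 1 (complex.Re p) (complex.Im p) (complex.Re q) (complex.Im q) x.
case: p => a b; case: q => c d.
split; apply/eqP; rewrite eq_complex !(cReD, cImD, cReN, cImN, cReM, cImM)/=;
  by apply/andP; split; apply/eqP; ring.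
Qed.

(** The result is the SU(2) matrix with first column [to_C2 x], applied to the fixed vector (p, q).
    Compared with [z_lquat], the point and the matrix have exchanged roles, and this map is again a
    rotation of R^4. *)
Lemma z_rquat (p q : C) x :
  z1 (x *m rquat p q) = z1 x * p - (z2 x)^* * q /\
  z2 (x *m rquat p q) = z2 x * p + (z1 x)^* * q.
Proof.
have [-> ->] := z_mul_quat (-1) (complex.Re p) (complex.Im p) (complex.Re q) (complex.Im q) x.
case: p => a b; case: q => c d.
split; apply/eqP; rewrite eq_complex !(cReD, cImD, cReN, cImN, cReM, cImM)/=;
  by apply/andP; split; apply/eqP; ring.
Qed.

End C2_coordinates.

Section sphere_integral.
Context {R : realType} (sigma : probability 'rV[R]_4 R).
Hypothesis sigma_rot : rotation_invariant_on_sphere sigma.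
Local Notation C := R[i].
Local Open Scope ereal_scope.

Lemma sigma_sphereC : sigma (~` unit_sphere 4) = 0.
Proof.
rewrite probability_setC; last exact: measurable_unit_sphere.
by rewrite sigma_rot.1 subee.
Qed.

Lemma ge0_integral_sphereT (f : 'rV[R]_4 -> \bar R) : measurable_fun setT f ->
  (forall x, 0 <= f x) -> \int[sigma]_(x in unit_sphere 4) f x = \int[sigma]_x f x.
Proof.
move=> mf f0; rewrite [RHS](@ge0_negligible_integral _ _ _ _ _ (~` unit_sphere 4))//.
- by rewrite setTD setCK.
- by apply: measurableC; exact: measurable_unit_sphere.
- exact: sigma_sphereC.
Qed.

Lemma eq_integral_sphereT (f g : 'rV[R]_4 -> \bar R) :
  measurable_fun setT f -> (forall x, 0 <= f x) ->
  measurable_fun setT g -> (forall x, 0 <= g x) ->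
  (forall x, unit_sphere 4 x -> f x = g x) ->
  \int[sigma]_x f x = \int[sigma]_x g x.
Proof.
move=> mf f0 mg g0 fg; rewrite -!ge0_integral_sphereT//.
by apply: eq_integral => x; rewrite inE; exact: fg.
Qed.

Lemma integral_rotation (Q : 'M[R]_4) (f : 'rV[R]_4 -> \bar R) :
  Q *m Q^T = 1%:M -> (\det Q = 1)%R ->
  measurable_fun setT f -> (forall x, 0 <= f x) ->
  \int[sigma]_x f (x *m Q) = \int[sigma]_x f x.
Proof.
move=> QQ detQ mf f0.
rewrite -(integral_pushforward_pack sigma (measurable_mulmxr Q) mf f0).
apply: eq_measure_integral => A mA _; rewrite pushforward_packE.
exact: sigma_rot.2.
Qed.

Lemma integral_lquat (p q : C) (f : 'rV[R]_4 -> \bar R) :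
  (abs2 p + abs2 q = 1)%R -> measurable_fun setT f -> (forall x, 0 <= f x) ->
  \int[sigma]_x f (x *m lquat p q) = \int[sigma]_x f x.
Proof.
rewrite /abs2 !addrA => pq1 mf f0; apply: integral_rotation => //.
  by apply: quat_mxT; rewrite ?expr1n.
by rewrite det_quat_mx ?expr1n// pq1 expr1n.
Qed.

Lemma integral_rquat (p q : C) (f : 'rV[R]_4 -> \bar R) :
  (abs2 p + abs2 q = 1)%R -> measurable_fun setT f -> (forall x, 0 <= f x) ->
  \int[sigma]_x f (x *m rquat p q) = \int[sigma]_x f x.
Proof.
rewrite /abs2 !addrA => pq1 mf f0; apply: integral_rotation => //.
  by apply: quat_mxT; rewrite ?sqrrN ?expr1n.
by rewrite det_quat_mx ?sqrrN ?expr1n// pq1 expr1n.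
Qed.

End sphere_integral.

(** * One-variable and Gaussian integrals *)

Section special_integrals.
Context {R : realType}.
Local Notation C := R[i].
Local Notation mu := (@lebesgue_measure R).

Lemma cvg_ln_pinfty : (ln x : R) @[x --> +oo] --> +oo.
Proof.
apply/cvgryPge => A; near=> x.
have x_gt : expR A < x by near: x; exact: nbhs_pinfty_gt.
by rewrite -(expRK A) ler_ln ?posrE ?expR_gt0 ?(lt_trans (expR_gt0 A) x_gt)// ltW.
Unshelve. all: by end_near. Qed.

Lemma cvg_powRN_pinfty (q : R) : 0 < q -> ((1 + x) `^ (- q) : R) @[x --> +oo] --> 0.
Proof.
move=> q0; apply: (@cvg_trans _ ((expR (- (q * ln (1 + x)))) @[x --> +oo])).
  apply: near_eq_cvg; near=> x.
  have x0 : 0 < x by near: x; exact: nbhs_pinfty_gt.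
  by rewrite /powR gt_eqF ?mulNr// addr_gt0.
apply: (@cvg_comp _ _ _ (fun x => q * ln (1 + x)) (fun z => expR (- z)) _
  (pinfty_nbhs R)); last exact: cvgr_expR.
apply: gt0_cvgMry => //.
apply: (@cvg_comp _ _ _ (fun x => 1 + x) (@ln R) _ (pinfty_nbhs R));
  last exact: cvg_ln_pinfty.
exact: cvg_addrl.
Unshelve. all: by end_near. Qed.

Lemma is_derive_1D_powR (a x : R) : -1 < x ->
  is_derive x 1 (fun x : R => (1 + x) `^ a) (a * (1 + x) `^ (a - 1)).
Proof.
move=> x0.
have x1 : 0 < 1 + x by rewrite -ltrBlDl sub0r.
have D1 : is_derive x 1 (fun x : R => 1 + x) 1.
  rewrite (_ : (fun x => 1 + x) = shift 1); first exact: is_derive_shift.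
  by apply/funext => y; rewrite addrC.
have := @is_derive1_comp _ (fun y : R => y `^ a) (fun x => 1 + x) x _ _
  (@is_derive1_powR R a _ x1) D1.
by rewrite mulr1.
Qed.

Lemma continuous_1D_powR (a x : R) : -1 < x ->
  {for x, continuous (fun x : R => (1 + x) `^ a)}.
Proof.
move=> x0; apply: differentiable_continuous; apply/derivable1_diffP.
by have [] := is_derive_1D_powR a x0.
Qed.

(** Needed for p = 2, in the second moment of the Gaussian, and for p = 3/2, in the finiteness of
    the mean log distance. *)
Lemma integral_1D_powR (p : R) : 1 < p ->
  (\int[mu]_(x in `[0%R, +oo[) ((1 + x) `^ (- p))%:E = ((p - 1)^-1)%:E)%E.
Proof.
move=> p1.
have q0 : 0 < p - 1 by rewrite subr_gt0.
rewrite (@ge0_continuous_FTC2y _ _ (fun x => - (p - 1)^-1 * (1 + x) `^ (- (p - 1))) _ 0).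
- by rewrite addr0 powR1 mulr1 EFinN oppeK add0e.
- by move=> x _; exact: powR_ge0.
- apply: continuous_in_subspaceT => x; rewrite inE/= in_itv/= andbT => x0.
  by apply: continuous_1D_powR; rewrite (lt_le_trans _ x0)// ltrN10.
- by rewrite -[X in _ --> X](mulr0 (- (p - 1)^-1)); apply: cvgMr; exact: cvg_powRN_pinfty.
- move=> x x0; apply: derivableM => //.
  by have [] := @is_derive_1D_powR (- (p - 1)) x (lt_trans (@ltrN10 R) x0).
- apply: cvg_at_right_filter; apply: cvgMr.
  exact: (@continuous_1D_powR (- (p - 1)) 0 (@ltrN10 R)).
- move=> x; rewrite in_itv/= andbT => x0; rewrite derive1E.
  have H := @is_derive_1D_powR (- (p - 1)) x (lt_trans (@ltrN10 R) x0).
  have [dH _] := H.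
  rewrite deriveM//.
  rewrite derive_val derive_cst scaler0 addr0.
  rewrite -[LHS]/(_ * _) mulrA mulrNN mulVf ?gt_eqF// mul1r; congr (_ `^ _); ring.
Qed.

Lemma integral_exponential (r : R) : 0 <= r -> 
  (\int[mu]_(t in `[0%R, +oo[) (r * expR (- (r * (1 + t))))%:E =
   (if r == 0 then 0 else expR (- r))%:E)%E.
Proof.
move=> r0; have [->|rn0] := eqVneq r 0.
  by under eq_integral do rewrite mul0r; rewrite integral0.
have {r0 rn0} r0 : 0 < r by rewrite lt_def rn0.
have -> : (\int[mu]_(t in `[0%R, +oo[) (r * expR (- (r * (1 + t))))%:E =
    \int[mu]_(t in `[0%R, +oo[) ((expR (- r))%:E * (exponential_pdf r t)%:E))%E.
  apply: eq_integral => t; rewrite inE/= in_itv/= andbT => t0.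
  rewrite exponential_pdfE// -EFinM mulrCA -expRD; congr (_ * expR _)%:E; ring.
rewrite ge0_integralZl_EFin ?expR_ge0//.
- rewrite -[RHS]mule1 -(integral_exponential_pdf r0) integral_mkcond; congr (_ * _)%E.
  apply: eq_integral => t _; rewrite restrict_EFin/= /exponential_pdf.
  by rewrite !patchE; case: (t \in _).
- by move=> x _; rewrite lee_fin exponential_pdf_ge0// ltW.
- by apply: measurable_funTS; apply/measurable_EFinP; exact: measurable_exponential_pdf.
Qed.

End special_integrals.

Section gaussian.
Context {R : realType}.
Local Notation C := R[i].
Local Notation mu := (@lebesgue_measure R).
Local Open Scope ereal_scope.

Let plane_set1 (p : R * R) : [set p] = [set p.1] `*` [set p.2].
Proof. by apply/seteqP; split=> [_ ->//|[a b] [/= -> ->]]; case: p. Qed.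

Lemma measurable_plane_set1 (p : R * R) : measurable [set p].
Proof. by rewrite plane_set1; apply: measurableX; exact: measurable_set1. Qed.

Lemma plane_measure_set1 (p : R * R) : plane_measure [set p] = 0.
Proof.
rewrite plane_set1.
by rewrite /plane_measure product_measure1E//= lebesgue_measure_set1 mul0e.
Qed.

Lemma cplx_integral_ae (c : C) (f g : C -> \bar R) : cmeas1 f -> cmeas1 g ->
  (forall z, 0 <= f z) -> (forall z, 0 <= g z) ->
  (forall z, z != c -> f z = g z) -> cplx_integral f = cplx_integral g.
Proof.
move=> mf mg f0 g0 fg; apply: ge0_ae_eq_integral => //.
exists [set pair_of c]; split; [exact: measurable_plane_set1|exact: plane_measure_set1|].
move=> p /=; rewrite not_implyE => -[_ /eqP fgp].
by apply/(can_inj (@cplx_ofK R)); rewrite pair_ofK; apply/eqP; apply: contraNT fgp => /fg ->.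
Qed.

Lemma cmeas1P (f : C -> R) : measurable_fun setT (f \o (@cplx_of R)) ->
  cmeas1 (fun z => (f z)%:E).
Proof. by move=> mf; apply/measurable_EFinP. Qed.

Lemma measurable_abs2_cplx : measurable_fun setT (fun p : R * R => abs2 (cplx_of p)).
Proof. by apply: measurable_abs2; exact: cmeas_cplx_of. Qed.

Lemma cmeas1_gauss : cmeas1 (fun z : C => (expR (- abs2 z))%:E).
Proof.
apply: cmeas1P; apply: (measurableT_comp (f := @expR R)) => //.
by apply: measurable_funN; exact: measurable_abs2_cplx.
Qed.

Lemma cplx_integral_gauss : cplx_integral (fun z : C => (expR (- abs2 z))%:E) = pi%:E.
Proof.
have mg : measurable_fun setT (fun p : R * R => (expR (- (p.1 ^+ 2 + p.2 ^+ 2)))%:E).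
  apply/measurable_EFinP; apply: measurableT_comp => //.
  by apply: measurable_funN; apply: measurable_funD; exact: measurable_funX.
rewrite /cplx_integral (integral_plane (f := fun x y => (expR (- (x ^+ 2 + y ^+ 2)))%:E))//.
transitivity (\int[mu]_x ((Num.sqrt pi)%:E * (gauss_fun x)%:E)).
  apply: eq_integral => x _.
  rewrite muleC -integralT_gauss -ge0_integralZl_EFin//.
  - by apply: eq_integral => y _; rewrite -EFinM /gauss_fun -expRD opprD.
  - by move=> y _; rewrite lee_fin gauss_fun_ge0.
  - by apply/measurable_EFinP; exact: measurable_gauss_fun.
  - exact: gauss_fun_ge0.
rewrite ge0_integralZl_EFin//.
- by rewrite integralT_gauss -EFinM -expr2 sqr_sqrtr ?pi_ge0.
- by move=> y _; rewrite lee_fin gauss_fun_ge0.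
- by apply/measurable_EFinP; exact: measurable_gauss_fun.
Qed.

Let K := cplx_integral (fun z : C => (abs2 z * expR (- abs2 z))%:E).

Let mK (a : R) : cmeas1 (fun z : C => (abs2 z * expR (- (abs2 z * a)))%:E).
Proof.
apply: cmeas1P; apply: measurable_funM => //; first exact: measurable_abs2_cplx.
apply: measurableT_comp => //; apply: measurable_funN.
by apply: measurable_funM => //; exact: measurable_abs2_cplx.
Qed.

Let K_ge0 (a : R) z : 0 <= (abs2 z * expR (- (abs2 z * a)))%:E.
Proof. by rewrite lee_fin mulr_ge0 ?abs2_ge0 ?expR_ge0. Qed.

Let scaled (a : R) : (0 < a)%R ->
  cplx_integral (fun z : C => (abs2 z * expR (- (abs2 z * a)))%:E) = (a ^- 2)%:E * K.
Proof.
move=> a0.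
have s2 : abs2 ((Num.sqrt a)%:C)%C = a.
  by rewrite /abs2/= expr0n addr0 sqr_sqrtr// ltW.
have s0 : ((Num.sqrt a)%:C)%C != 0%R by rewrite -abs2_eq0 s2 gt_eqF.
have K1 : cmeas1 (fun z : C => (abs2 z * expR (- abs2 z))%:E).
  by apply: eq_measurable_fun (mK 1%R) => p _; rewrite /= mulr1.
have K0 (z : C) : 0 <= (abs2 z * expR (- abs2 z))%:E.
  by rewrite lee_fin mulr_ge0 ?abs2_ge0 ?expR_ge0.
rewrite /K -(cplx_integral_mul s0 K1 K0) s2.
rewrite [in RHS](@eq_cplx_integral _ _ (fun z => a%:E * (abs2 z * expR (- (abs2 z * a)))%:E)); last first.
  by move=> z; rewrite /= abs2M s2 -EFinM; congr _%:E; rewrite mulrA [(a * abs2 z)%R]mulrC.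
rewrite cplx_integralZl ?ltW// !muleA -!EFinM (_ : (a ^- 2 * a * a = 1)%R) ?mul1e//.
by rewrite expr2; field; rewrite gt_eqF.
Qed.

(** For z <> 0, exp(-|z|^2) is the integral over t >= 0 of |z|^2 exp(-|z|^2 (1 + t)). Exchanging the
    integrals and rescaling z gives pi = K times the integral of (1 + t)^-2, and the latter is 1. *)
Lemma cplx_integral_abs2_gauss :
  cplx_integral (fun z : C => (abs2 z * expR (- abs2 z))%:E) = pi%:E.
Proof.
rewrite -/K -cplx_integral_gauss.
pose f (z : C) (t : R) := if (0 <= t)%R then (abs2 z * expR (- (abs2 z * (1 + t))))%:E else 0.
have f0 z t : 0 <= f z t by rewrite /f; case: ifP.
have mf : measurable_fun setT (fun p : (R * R) * R => f (cplx_of p.1) p.2).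
  apply: measurable_fun_ifT => //.
    by apply: measurable_fun_ler.
  apply/measurable_EFinP.
  have mz : measurable_fun setT (fun p : (R * R) * R => abs2 (cplx_of p.1)).
    exact: measurableT_comp measurable_abs2_cplx _.
  apply: measurable_funM => //; apply: measurableT_comp => //.
  by apply: measurable_funN; apply: measurable_funM => //; apply: measurable_funD.
have fz z : \int[mu]_t f z t = (if z == 0%R then 0 else expR (- abs2 z))%:E.
  rewrite -abs2_eq0 -integral_exponential ?abs2_ge0// [RHS]integral_mkcond.
  by apply: eq_integral => t _; rewrite patchE mem_setE in_itv/= andbT.
(* At z = 0 the integral in t is 0 instead of 1, but a point is negligible. *)
rewrite (@cplx_integral_ae 0%R _ (fun z => \int[mu]_t f z t)); last first.
- by move=> z z0; rewrite fz (negbTE z0).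
- by move=> z; exact: integral_ge0.
- by move=> z; rewrite lee_fin expR_ge0.
- exact: (@measurable_tonelli_l R _ _ _ _ mu (fun p t => f (cplx_of p) t) mf (fun _ _ => f0 _ _)).
- exact: cmeas1_gauss.
rewrite /cplx_integral (@tonelli_swap _ _ _ _ _ plane_measure mu (fun p t => f (cplx_of p) t))//.
transitivity (\int[mu]_(t in `[0%R, +oo[) (((1 + t) `^ (- 2%:R))%:E * K)); last first.
  rewrite integral_mkcond; apply: eq_integral => t _.
  rewrite patchE mem_setE in_itv/= andbT /f; case: ifPn => t0; last by rewrite integral0.
  have t1 : (0 < 1 + t)%R by rewrite (lt_le_trans ltr01)// lerDl.
  by rewrite -[RHS]/(cplx_integral (fun z => (abs2 z * expR (- (abs2 z * (1 + t))))%:E)) (scaled t1) powR_invn// ltW.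
rewrite ge0_integralZr//.
- by rewrite integral_1D_powR ?ltr1n// (_ : 2%:R - 1 = 1)%R ?invr1 ?mul1e//; ring.
- apply/measurable_EFinP; apply: measurable_funTS.
  apply: (measurableT_comp (measurable_powR _)).
  by apply: measurable_funD.
- by move=> t _; rewrite lee_fin powR_ge0.
- apply: cplx_integral_ge0 => z; rewrite lee_fin mulr_ge0 ?abs2_ge0 ?expR_ge0//.
Qed.

Lemma cplx_integral_abs2_gaussM (a : R) : (0 < a)%R ->
  cplx_integral (fun z : C => (abs2 z * expR (- (abs2 z * a)))%:E) = (pi * a ^- 2)%:E.
Proof.
by move=> a0; rewrite scaled// /K cplx_integral_abs2_gauss -EFinM mulrC.
Qed.

End gaussian.

(** * The Hopf map and the Fubini-Study measure *)

Section hopf_map.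
Context {R : realType}.
Local Notation C := R[i].
Local Notation P1 := (riemann_sphere R).

Lemma col20 (a b : C) : col2 a b ord0 ord0 = a. Proof. by rewrite mxE. Qed.
Lemma col21 (a b : C) : col2 a b ord_max ord0 = b. Proof. by rewrite mxE. Qed.

Lemma col2_eta (v : 'cV[C]_2) : v = col2 (v ord0 ord0) (v ord_max ord0).
Proof.
apply/matrixP => i j; rewrite (ord1 j) mxE; case: eqP => [->//|i0].
by congr (v _ _); apply/val_inj; case: i i0 => -[|[|//]] //= ? /eqP; rewrite -val_eqE.
Qed.

Lemma of_homog_col2 (a b : C) :
  of_homog_coord (col2 a b) = if b == 0 then None else Some (a / b) :> P1.
Proof. by rewrite /of_homog_coord col20 col21. Qed.

Lemma of_homog_scale (k a b : C) : k != 0 ->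
  of_homog_coord (col2 (a * k) (b * k)) = of_homog_coord (col2 a b) :> P1.
Proof.
move=> k0; rewrite !of_homog_col2 mulf_eq0 (negbTE k0) orbF.
by case: ifPn => // b0; congr Some; field; rewrite b0.
Qed.

Lemma measurable_P1 d (T : measurableType d) (h : P1 -> T) :
  measurable_fun setT (h \o (@finite_point R)) -> measurable_fun setT h.
Proof.
move=> mh _ B mB; rewrite setTI.
by have := mh measurableT B mB; rewrite setTI.
Qed.

Lemma measurable_finite_point : measurable_fun setT (@finite_point R).
Proof. by move=> _ B mB; rewrite setTI. Qed.

Lemma measurable_neq0 d (T : measurableType d) (b : T -> C) : cmeas b ->
  measurable_fun setT (fun t => b t == 0).
Proof.
move=> mb; under eq_fun do rewrite -abs2_eq0.
by apply: measurable_fun_eqr => //; exact: measurable_abs2.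
Qed.

Lemma measurable_Some d (T : measurableType d) (a : T -> C) : cmeas a ->
  measurable_fun setT (fun t => Some (a t) : P1).
Proof.
move=> ma; apply: eq_measurable_fun (measurableT_comp measurable_finite_point ma).
by move=> t _; rewrite /= -[in RHS](pair_ofK (a t)).
Qed.

Lemma measurable_of_homog d (T : measurableType d) (a b : T -> C) :
  cmeas a -> cmeas b ->
  measurable_fun setT (fun t => of_homog_coord (col2 (a t) (b t)) : P1).
Proof.
move=> ma mb; under eq_fun do rewrite of_homog_col2.
apply: measurable_fun_ifT => //; first exact: measurable_neq0.
by apply: measurable_Some; apply: cmeasM => //; exact: cmeasV.
Qed.

Definition hopf (x : 'rV[R]_4) : P1 := of_homog_coord (to_C2 x).

Lemma measurable_hopf : measurable_fun setT hopf.
Proof. by apply: measurable_of_homog; [exact: cmeas_z1|exact: cmeas_z2]. Qed.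

End hopf_map.

Lemma cplx_integral_eZl (R : realType) (f : R[i] -> \bar R) (k : \bar R) :
  (0 <= k -> cmeas1 f -> (forall z, 0 <= f z) ->
  cplx_integral (fun z => k * f z) = k * cplx_integral f)%E.
Proof.
by move=> k0 mf f0; rewrite /cplx_integral ge0_integralZl// => p _; exact: f0.
Qed.

Lemma mule_EFin_inj (R : realType) (k : R) (x y : \bar R) : 0 < k ->
  (x * k%:E = y * k%:E -> x = y)%E.
Proof.
move=> k0 xy; have kmul := @lee_pmul2r R k%:E isT k0.
by apply/eqP; rewrite eq_le -(kmul x y) -(kmul y x) xy lexx.
Qed.

Section hopf_pushforward.
Context {R : realType} (sigma : probability 'rV[R]_4 R).
Hypothesis sigma_rot : rotation_invariant_on_sphere sigma.
Local Notation C := R[i].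
Local Notation P1 := (riemann_sphere R).
Variable (phi : P1 -> \bar R).
Hypothesis mphi : measurable_fun setT phi.
Hypothesis phi0 : (forall P, 0 <= phi P)%E.
Local Open Scope ereal_scope.

Let G (z w : C) : \bar R := (expR (- (abs2 z + abs2 w)))%:E.
(** The SU(2) matrix with first column [q] is applied to (z, w), and the resulting point of P^1(C)
    is weighted by a Gaussian. With q fixed, SU(2)-invariance of the integral on C^2 removes q; with
    (z, w) fixed, rotation invariance of [sigma] removes (z, w). Comparing the two evaluations
    yields the law of the Hopf map. *)
Let Psi (q : 'rV[R]_4) (z w : C) : \bar R :=
  phi (of_homog_coord (col2 (z1 q * z - conjc (z2 q) * w)%R (z2 q * z + conjc (z1 q) * w)%R))
  * G z w.
Let Phi (z w : C) : \bar R := phi (of_homog_coord (col2 z w)) * G z w.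

Let mphi_homog d (T : measurableType d) (a b : T -> C) :
  cmeas a -> cmeas b -> measurable_fun setT (fun t => phi (of_homog_coord (col2 (a t) (b t)))).
Proof. by move=> ma mb; exact: measurableT_comp mphi (measurable_of_homog ma mb). Qed.

Let mG d (T : measurableType d) (a b : T -> C) :
  cmeas a -> cmeas b -> measurable_fun setT (fun t => G (a t) (b t)).
Proof.
move=> ma mb; apply/measurable_EFinP; apply: measurableT_comp => //.
by apply: measurable_funN; apply: measurable_funD; exact: measurable_abs2.
Qed.

Let G0 z w : 0 <= G z w. Proof. by rewrite lee_fin expR_ge0. Qed.
Let Psi0 q z w : 0 <= Psi q z w. Proof. by rewrite mule_ge0. Qed.
Let Phi0 z w : 0 <= Phi z w. Proof. by rewrite mule_ge0. Qed.

Let mPhi : cmeas2 Phi.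
Proof.
by apply: emeasurable_funM; [apply: mphi_homog|apply: mG];
  by [exact: cmeas_fst|exact: cmeas_snd].
Qed.

Let mPsi d (T : measurableType d) (q : T -> 'rV[R]_4) (a b : T -> C) :
  measurable_fun setT q -> cmeas a -> cmeas b ->
  measurable_fun setT (fun t => Psi (q t) (a t) (b t)).
Proof.
move=> mq ma mb.
have mq1 : cmeas (fun t => z1 (q t)) := cmeas_comp mq cmeas_z1.
have mq2 : cmeas (fun t => z2 (q t)) := cmeas_comp mq cmeas_z2.
apply: emeasurable_funM; last exact: mG.
apply: mphi_homog; [apply: cmeasB|apply: cmeasD]; apply: cmeasM => //;
  exact: cmeas_conj.
Qed.

Let rotate_average : \int[sigma]_q cplx2_integral (Psi q) = cplx2_integral Phi.
Proof.
have mL : measurable_fun setT (fun q => cplx2_integral (Psi q)).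
  apply: (@measurable_tonelli_l _ _ _ _ _ plane_measure
     (fun q p => cplx_integral (Psi q (cplx_of p)))); last first.
    by move=> q p; exact: cplx_integral_ge0.
  apply: (@measurable_tonelli_l _ _ _ _ _ plane_measure
     (fun qp p' => Psi qp.1 (cplx_of qp.2) (cplx_of p'))) => //.
  apply: mPsi.
  - exact: measurableT_comp measurable_fst measurable_fst.
  - exact: (cmeas_cplx (measurableT_comp measurable_snd measurable_fst)).
  - exact: (cmeas_cplx measurable_snd).
have L0 q : 0 <= cplx2_integral (Psi q).
  by apply: cplx_integral_ge0 => z; exact: cplx_integral_ge0.
rewrite -(ge0_integral_sphereT sigma_rot)//.
rewrite (eq_integral (fun=> cplx2_integral Phi)) => [|q].
  move: (cplx2_integral Phi) => c.
  rewrite (@integral_cst _ _ _ sigma _ (@measurable_unit_sphere R 4) c).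
  by rewrite [X in c * X](_ : _ = 1) ?mule1//; exact: sigma_rot.1.
rewrite inE/= /unit_sphere/= sqnorm4E => q1.
rewrite -[RHS](cplx2_integral_SU2 q1 mPhi Phi0).
apply: eq_cplx_integral => z; apply: eq_cplx_integral => w.
rewrite /Psi /Phi; congr (_ * _); congr (expR (- _))%:E.
transitivity ((abs2 (z1 q) + abs2 (z2 q)) * (abs2 z + abs2 w))%R.
  by rewrite q1 mul1r.
case: (z1 q) (z2 q) => a b [c e].
by rewrite /abs2 !cReD !cImD !cReN !cImN !cReM !cImM/=; ring.
Qed.

(** After (z, w) is normalized by the factor k, which does not move the point of P^1(C), the map in
    q is the rotation [rquat], so that (z, w) disappears. *)
Let average_fiber z w : z != 0%R ->
  \int[sigma]_q Psi q z w = \int[sigma]_q phi (hopf q) * G z w.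
Proof.
move=> z0; rewrite /Psi.
have mh : measurable_fun setT (fun q : 'rV[R]_4 => phi (hopf q)).
  exact: measurableT_comp mphi measurable_hopf.
rewrite ge0_integralZr//; last first.
  apply: mphi_homog; [apply: cmeasB|apply: cmeasD]; apply: cmeasM;
   by [exact: cmeas_cst|exact: cmeas_z1|exact: cmeas_z2|
       exact: cmeas_conj cmeas_z1|exact: cmeas_conj cmeas_z2].
congr (_ * _).
have n0 : (0 < abs2 z + abs2 w)%R.
  by rewrite ltr_pwDl ?abs2_ge0// abs2_gt0.
pose k : C := ((Num.sqrt (abs2 z + abs2 w))^-1)%:C%C.
have k2 : abs2 k = ((abs2 z + abs2 w)^-1)%R.
  by rewrite /k /abs2/= expr0n addr0 exprVn sqr_sqrtr// ltW.
have k0 : k != 0%R by rewrite -abs2_eq0 k2 invr_eq0 gt_eqF.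
have zk1 : (abs2 (z * k) + abs2 (w * k) = 1)%R.
  by rewrite !abs2M -mulrDl k2 divff ?gt_eqF.
rewrite -[RHS](integral_rquat sigma_rot zk1)//.
apply: eq_integral => q _; congr phi; rewrite /hopf to_C2E.
have [-> ->] := z_rquat (z * k)%R (w * k)%R q.
rewrite -(of_homog_scale _ _ k0); congr (of_homog_coord (col2 _ _)); ring.
Qed.

Let double_average :
  \int[sigma]_q cplx2_integral (Psi q) = \int[sigma]_q phi (hopf q) * (pi ^+ 2)%:E.
Proof.
rewrite /cplx2_integral.
rewrite (@tonelli_swap _ _ _ _ _ sigma plane_measure
  (fun q p => cplx_integral (Psi q (cplx_of p)))); last 2 first.
- apply: (@measurable_tonelli_l _ _ _ _ _ plane_measure
     (fun qp p' => Psi qp.1 (cplx_of qp.2) (cplx_of p'))) => //.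
  apply: mPsi.
  - exact: measurableT_comp measurable_fst measurable_fst.
  - exact: (cmeas_cplx (measurableT_comp measurable_snd measurable_fst)).
  - exact: (cmeas_cplx measurable_snd).
- by move=> q p; exact: cplx_integral_ge0.
have I0 : 0 <= \int[sigma]_q phi (hopf q) by exact: integral_ge0.
transitivity (cplx_integral (fun z => cplx_integral (fun w => \int[sigma]_q Psi q z w))).
  apply: eq_integral => p _.
  rewrite /cplx_integral (@tonelli_swap _ _ _ _ _ sigma plane_measure
    (fun q p' => Psi q (cplx_of p) (cplx_of p')))//.
  by apply: mPsi => //; [exact: cmeas_cst|exact: (cmeas_cplx measurable_snd)].
have mGc : cmeas2 (fun z w => \int[sigma]_q phi (hopf q) * G z w).
  apply: emeasurable_funM; first exact: measurable_cst.
  by apply: mG; [exact: cmeas_fst|exact: cmeas_snd].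
have mPc : cmeas2 (fun z w => \int[sigma]_q Psi q z w).
  apply: (@measurable_tonelli_l _ _ _ _ _ sigma
     (fun pp q => Psi q (cplx_of pp.1) (cplx_of pp.2))) => //.
  apply: mPsi => //.
  - exact: (cmeas_cplx (measurableT_comp measurable_fst measurable_fst)).
  - exact: (cmeas_cplx (measurableT_comp measurable_snd measurable_fst)).
rewrite (@cplx_integral_ae _ 0%R _
  (fun z => cplx_integral (fun w => \int[sigma]_q phi (hopf q) * G z w))).
- transitivity (cplx_integral (fun z => (\int[sigma]_q phi (hopf q) * pi%:E) * (expR (- abs2 z))%:E)).
    apply: eq_cplx_integral => z; rewrite -cplx_integral_gauss -muleA.
    rewrite -(cplx_integralZr (f := fun w : C => (expR (- abs2 w))%:E))//;
      last exact: cmeas1_gauss.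
    rewrite /cplx_integral -ge0_integralZl//.
    + apply: eq_integral => w _; congr (_ * _); rewrite /G -EFinM; congr _%:E.
      by rewrite -expRD; congr expR; ring.
    + by apply: emeasurable_funM => //; exact: cmeas1_gauss.
  rewrite {1}/cplx_integral ge0_integralZl//.
  + by rewrite -[X in _ * X]/(cplx_integral (fun z => (expR (- abs2 z))%:E))
      cplx_integral_gauss -muleA -EFinM -expr2.
  + exact: cmeas1_gauss.
  + by rewrite mule_ge0// lee_fin pi_ge0.
- by apply: cmeas1_integral => // z w; exact: integral_ge0.
- by apply: cmeas1_integral => // z w; rewrite mule_ge0.
- by move=> z; apply: cplx_integral_ge0 => w; exact: integral_ge0.
- by move=> z; apply: cplx_integral_ge0 => w; rewrite mule_ge0.
- by move=> z z0; apply: eq_cplx_integral => w; exact: average_fiber.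
Qed.

(** The substitution z = w a in the inner integral brings a factor |w|^2. The integral in w of |w|^2
    exp(-|w|^2 (1 + |a|^2)) is pi (1 + |a|^2)^-2, that is, pi^2 times the Fubini-Study density. *)
Let ratio_law : cplx2_integral Phi =
  cplx_integral (fun a => phi (Some a) * (fubini_study_density (pair_of a))%:E) *
  (pi ^+ 2)%:E.
Proof.
pose H (w a : C) := phi (Some a) * (abs2 w * expR (- (abs2 w * (1 + abs2 a))))%:E.
have H0 w a : 0 <= H w a.
  by rewrite mule_ge0// lee_fin mulr_ge0 ?abs2_ge0 ?expR_ge0.
have mSome d (T : measurableType d) (a : T -> C) : cmeas a ->
    measurable_fun setT (fun t => phi (Some (a t))).
  by move=> ma; exact: measurableT_comp mphi (measurable_Some ma).
have mH : cmeas2 H.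
  apply: emeasurable_funM; first by apply: mSome; exact: cmeas_snd.
  apply/measurable_EFinP; apply: measurable_funM.
    by apply: measurable_abs2; exact: cmeas_fst.
  apply: (measurableT_comp (f := @expR R)) => //; apply: measurable_funN.
  apply: measurable_funM; first by apply: measurable_abs2; exact: cmeas_fst.
  by apply: measurable_funD => //; apply: measurable_abs2; exact: cmeas_snd.
have mswap (f : C -> C -> \bar R) : cmeas2 f -> cmeas2 (fun z w => f w z).
  by move=> mf; apply: (cmeas2_comp mf); [exact: cmeas_snd|exact: cmeas_fst].
rewrite /cplx2_integral (cplx_integral_swap mPhi Phi0).
transitivity (cplx_integral (fun w => cplx_integral (H w))).
  apply: (@cplx_integral_ae _ 0%R).
  - by apply: (cmeas1_integral (f := fun w z => Phi z w)) => //; exact: mswap.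
  - exact: cmeas1_integral.
  - by move=> w; exact: cplx_integral_ge0.
  - by move=> w; exact: cplx_integral_ge0.
  move=> w w0.
  rewrite -(cplx_integral_mul w0 (f := fun z => Phi z w)); [|exact: cmeas2_r|by []].
  have mPw : cmeas1 (fun a => Phi (w * a)%R w).
    apply: (cmeas2_comp mPhi (h := fun=> w)); last exact: cmeas_cst.
    by apply: cmeasM; [exact: cmeas_cst|exact: cmeas_cplx_of].
  rewrite -cplx_integralZl ?abs2_ge0 //; apply: eq_cplx_integral => a.
  rewrite /Phi /H /G of_homog_col2 (negbTE w0) muleCA; congr (phi (Some _) * _).
    by rewrite mulrAC divff ?mul1r.
  by rewrite -EFinM; congr (_ * expR _)%:E; rewrite abs2M; ring.
rewrite (cplx_integral_swap mH H0).
rewrite -cplx_integralZr; last first.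
- by move=> a; rewrite mule_ge0// lee_fin fubini_study_density_ge0.
- apply: emeasurable_funM; first by apply: mSome; exact: cmeas_cplx_of.
  apply: (eq_measurable_fun (EFin \o @fubini_study_density R)).
    by move=> p _; rewrite /= cplx_ofK.
  by apply/measurable_EFinP; exact: measurable_fubini_study_density.
- by rewrite lee_fin exprn_ge0 ?pi_ge0.
apply: eq_cplx_integral => a.
have a1 : (0 < 1 + abs2 a)%R by rewrite (lt_le_trans ltr01)// lerDl abs2_ge0.
have mg : cmeas1 (fun w : C => (abs2 w * expR (- (abs2 w * (1 + abs2 a))))%:E).
  apply: cmeas1P; apply: measurable_funM; first exact: measurable_abs2_cplx.
  apply: (measurableT_comp (f := @expR R)) => //; apply: measurable_funN.
  by apply: measurable_funM => //; exact: measurable_abs2_cplx.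
have g0 (w : C) : 0 <= (abs2 w * expR (- (abs2 w * (1 + abs2 a))))%:E.
  by rewrite lee_fin mulr_ge0 ?abs2_ge0 ?expR_ge0.
rewrite (cplx_integral_eZl (phi0 _) mg g0).
rewrite cplx_integral_abs2_gaussM//.
have -> : fubini_study_density (pair_of a) = (pi^-1 * (1 + abs2 a) ^- 2)%R.
  by case: (a).
rewrite -muleA -EFinM; congr (_ * _%:E).
by rewrite mulrAC expr2 mulrA mulVf ?mul1r// gt_eqF// pi_gt0.
Qed.

Lemma integral_hopf : \int[sigma]_q phi (hopf q) =
  cplx_integral (fun a => phi (Some a) * (fubini_study_density (pair_of a))%:E).
Proof.
have pi2 : (0 < pi ^+ 2 :> R)%R by rewrite exprn_gt0// pi_gt0.
by apply: (mule_EFin_inj pi2); rewrite -double_average rotate_average ratio_law.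
Qed.

End hopf_pushforward.

Section fubini_study_hopf.
Context {R : realType} (sigma : probability 'rV[R]_4 R).
Hypothesis sigma_rot : rotation_invariant_on_sphere sigma.
Local Open Scope ereal_scope.

Lemma fubini_study_hopf (A : set (riemann_sphere R)) : measurable A ->
  fubini_study A = sigma (hopf @^-1` A).
Proof.
move=> mA.
have mA1 : measurable_fun setT (fun P : riemann_sphere R => (\1_A P : R)%:E).
  by apply/measurable_EFinP; exact: measurable_indic.
have mhA : measurable (hopf @^-1` A).
  by rewrite -[X in measurable X]setTI; exact: measurable_hopf.
rewrite -[RHS]mul1e -[1]/(1%:E) -integral_cst// integral_mkcond.
transitivity (\int[sigma]_q (\1_A (hopf q))%:E); last first.
  apply: eq_integral => q _; rewrite patchE indicE.
  have [qA|qA] := boolP (q \in hopf @^-1` A).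
    by rewrite mem_set//; move: qA; rewrite inE.
  by rewrite memNset//; move: qA; rewrite notin_setE.
rewrite (integral_hopf sigma_rot mA1) => [|P]; last by rewrite lee_fin.
rewrite /fubini_study integral_mkcond; apply: eq_integral => p _.
rewrite patchE indicE -[Some (cplx_of p)]/(finite_point p).
have [pA|pA] := boolP (p \in @finite_point R @^-1` A).
  by rewrite mem_set ?mul1e ?cplx_ofK//; move: pA; rewrite inE.
by rewrite memNset ?mul0e//; move: pA; rewrite notin_setE.
Qed.

End fubini_study_hopf.

(** * Measurable selection of roots *)

Section root_selection.
Context {R : realType}.
Local Notation C := R[i].

Definition cabs (z : C) : R := Num.sqrt (abs2 z).

Lemma cabs_ge0 z : 0 <= cabs z. Proof. exact: sqrtr_ge0. Qed.

Lemma sqr_cabs z : cabs z ^+ 2 = abs2 z.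
Proof. by rewrite sqr_sqrtr// abs2_ge0. Qed.

Lemma cabsE z : `|z| = (cabs z)%:C.
Proof. by case: z. Qed.

Lemma cabsD x y : cabs (x + y) <= cabs x + cabs y.
Proof.
have := ler_normD x y; rewrite !cabsE -rmorphD/= lecR.
exact.
Qed.

Lemma cabsN x : cabs (- x) = cabs x.
Proof. by rewrite /cabs abs2N. Qed.

Lemma cabs_eq0 x : (cabs x == 0) = (x == 0).
Proof. by rewrite sqrtr_eq0 le_eqVlt ltNge abs2_ge0/= orbF abs2_eq0. Qed.

Lemma cabs_dist_le (x y z : C) : cabs (x - z) <= cabs (x - y) + cabs (y - z).
Proof. by rewrite -[x - z](subrKA y); exact: cabsD. Qed.

Lemma cabs_distC (x y : C) : cabs (x - y) = cabs (y - x).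
Proof. by rewrite -cabsN opprB. Qed.

Lemma Re_le_cabs z : `|complex.Re z| <= cabs z.
Proof. by rewrite -sqrtr_sqr ler_wsqrtr// lerDl sqr_ge0. Qed.

Lemma Im_le_cabs z : `|complex.Im z| <= cabs z.
Proof. by rewrite -sqrtr_sqr ler_wsqrtr// lerDr sqr_ge0. Qed.

Lemma cabs_le_ReIm z : cabs z <= `|complex.Re z| + `|complex.Im z|.
Proof.
rewrite -[leRHS]ger0_norm ?addr_ge0// -sqrtr_sqr ler_wsqrtr// sqrrD !real_normK ?num_real//.
by rewrite /abs2 -addrA lerD2l lerDr mulrn_wge0// mulr_ge0.
Qed.

Definition rat_cplx (k : nat) : C :=
  if unpickle k is Some (a, b) then ratr (a : rat) +i* ratr (b : rat) else 0.

Lemma rat_cplx_dense (z : C) (e : R) : 0 < e -> exists k, cabs (rat_cplx k - z) < e.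
Proof.
move=> e0; have e2 : 0 < e / 2 by rewrite divr_gt0.
have dense (x : R) : exists q : rat, `|ratr q - x| < e / 2.
  have xlt : x - e / 2 < x + e / 2 by rewrite ltrBlDr -addrA ltrDl addr_gt0.
  have [q] := rat_in_itvoo xlt.
  rewrite in_itv/= => /andP[q1 q2]; exists q.
  by rewrite ltr_distl q1 q2.
have [a ha] := dense (complex.Re z); have [b hb] := dense (complex.Im z).
exists (pickle (a, b)); rewrite /rat_cplx pickleK.
apply: (le_lt_trans (cabs_le_ReIm _)); rewrite cReD cImD cReN cImN/=.
by rewrite (splitr e) ltrD.
Qed.

Definition least (P : pred nat) : nat :=
  if pselect (exists j, P j) is left e then ex_minn e else 0.

Lemma leastP (P : pred nat) : (exists j, P j) ->
  P (least P) /\ forall j, (j < least P)%N -> ~~ P j.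
Proof.
move=> exP; rewrite /least; case: pselect => // e.
case: ex_minnP => m Pm mP; split=> // j jm; apply/negP => /mP.
by rewrite leqNgt jm.
Qed.

Lemma least_eqP (P : pred nat) j : (exists j, P j) ->
  (least P = j) <-> P j /\ forall i, (i < j)%N -> ~~ P i.
Proof.
move=> /leastP[Pl lP]; split=> [<-//|[Pj jP]].
have [h|h|//] := ltngtP (least P) j; first by have := jP _ h; rewrite Pl.
by have := lP _ h; rewrite Pj.
Qed.

Section measurable.
Context d (T : measurableType d).

Definition nat_meas (N : T -> nat) := forall j, measurable [set t | N t = j].

Lemma nat_meas_least (P : T -> pred nat) :
  (forall t, exists j, P t j) -> (forall j, measurable [set t | P t j]) ->
  nat_meas (fun t => least (P t)).
Proof.
move=> exP mP j.
rewrite (_ : [set t | _] = [set t | P t j] `&`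
    \bigcap_(i in [set i | (i < j)%N]) ~` [set t | P t i]); last first.
  apply/seteqP; split=> t /=.
    move=> /(least_eqP _ (exP t))[Pj jP]; split=> // i /= ij.
    exact/negP/jP.
  by move=> [Pj jP]; apply/(least_eqP _ (exP t)); split=> // i /jP/negP.
apply: measurableI => //; apply: bigcap_measurableType => i _.
by apply: measurableC.
Qed.

Lemma nat_meas_bind (N : T -> nat) (Q : T -> nat -> bool) : nat_meas N ->
  (forall i, measurable [set t | Q t i]) -> measurable [set t | Q t (N t)].
Proof.
move=> mN mQ.
rewrite (_ : [set t | _] = \bigcup_i ([set t | N t = i] `&` [set t | Q t i])).
  by apply: bigcupT_measurable => i; apply: measurableI.
apply/seteqP; split=> t /= => [QN|[i _ [<-]]//].
by exists (N t).
Qed.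

Lemma measurable_comp_nat (N : T -> nat) d' (T' : measurableType d') (g : nat -> T') :
  nat_meas N -> measurable_fun setT (fun t => g (N t)).
Proof.
move=> mN _ Y mY; rewrite setTI.
rewrite (_ : _ @^-1` _ = \bigcup_(j in [set j | Y (g j)]) [set t | N t = j]).
  exact: bigcup_measurable.
by apply/seteqP; split=> t /= => [YN|[j /= Yj ->//]]; exists (N t).
Qed.

(** The number 4 * 2^-m is the sum of the increments allowed from rank m on. Subtracting or adding
    it makes the sequence monotone, which gives convergence, measurability of the limit and the
    error bound together. *)
Lemma measurable_geometric_limit (x : nat -> T -> R) :
  (forall m, measurable_fun setT (x m)) ->
  (forall m t, `|x m.+1 t - x m t| <= 2 * 2^-1 ^+ m) ->
  exists L : T -> R, measurable_fun setT L /\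
    forall m t, `|L t - x m t| <= 4 * 2^-1 ^+ m.
Proof.
move=> mx dx.
pose r m : R := 4 * 2^-1 ^+ m.
have r0 m : 0 <= r m by rewrite mulr_ge0// exprn_ge0// invr_ge0.
have rS m : r m - r m.+1 = 2 * 2^-1 ^+ m by rewrite /r exprS; field.
pose a m t := x m t - r m; pose b m t := x m t + r m.
have aS m t : a m t <= a m.+1 t.
  by have := dx m t; rewrite ler_norml /a -rS; lra.
have bS m t : b m.+1 t <= b m t.
  by have := dx m t; rewrite ler_norml /b -rS; lra.
have anon t : nondecreasing_seq (a ^~ t) by apply/nondecreasing_seqP.
have bnon t : nonincreasing_seq (b ^~ t) by apply/nonincreasing_seqP.
have ab k m t : a k t <= b m t.
  have [km|/ltnW mk] := leqP k m.
    by apply: (le_trans (anon t _ _ km)); rewrite /a /b; have := r0 m; lra.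
  by apply: le_trans (bnon t _ _ mk); rewrite /a /b; have := r0 k; lra.
have acvg t : a ^~ t @ \oo --> limn (a ^~ t).
  apply: nondecreasing_is_cvgn => //; exists (b 0 t) => _ [k _ <-]; exact: ab.
exists (fun t => limn (a ^~ t)); split.
  apply: (measurable_fun_cvg (h := a)) => [m|t _]; last exact: acvg.
  by apply: measurable_funB.
move=> m t; have la : a m t <= limn (a ^~ t).
  by apply: nondecreasing_cvgn_le => //; exact: acvg.
have lb : limn (a ^~ t) <= b m t.
  by apply: limr_le; [exact: acvg|near=> k; exact: ab].
rewrite -/(r m) ler_norml; move: la lb; rewrite /a /b; lra.
Unshelve. all: by end_near. Qed.

End measurable.
End root_selection.

Section measurable_roots.
Context {R : realType}.
Local Notation C := R[i].

Lemma cabsM (x y : C) : cabs (x * y) = cabs x * cabs y.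
Proof. by rewrite /cabs abs2M sqrtrM// abs2_ge0. Qed.

Lemma monic_prod_roots (p : {poly C}) : p \is monic ->
  {rs : seq C | p = \prod_(z <- rs) ('X - z%:P) & size p = (size rs).+1}.
Proof.
move=> pm; have [rs prs] := closed_field_poly_normal p.
rewrite (monicP pm) scale1r in prs.
by exists rs => //; rewrite prs size_prod_XsubC.
Qed.

Lemma abs2_horner_prod (rs : seq C) (x : C) :
  abs2 (\prod_(z <- rs) ('X - z%:P)).[x] = \prod_(z <- rs) abs2 (x - z).
Proof.
by rewrite horner_prod abs2_prod; apply: eq_bigr => z _; rewrite hornerXsubC.
Qed.

(** If every root were at distance at least e from x, the product formula would give |p(x)|^2 >=
    e^(2 n). *)
Lemma near_root n (p : {poly C}) (x : C) (e : R) : p \is monic ->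
  size p = n.+1 -> 0 < e -> abs2 p.[x] < (e ^+ 2) ^+ n ->
  exists2 z, root p z & cabs (x - z) < e.
Proof.
move=> pm sp e0; have [rs prs srs] := monic_prod_roots pm.
move: sp; rewrite srs => -[<-] {srs n}.
rewrite {1}prs abs2_horner_prod => px.
have [/hasP[z zrs ze]|/hasPn far] := boolP (has (fun z => cabs (x - z) < e) rs).
  by exists z => //; rewrite prs root_prod_XsubC.
move: px; rewrite ltNge => /negP[].
rewrite (_ : _ ^+ size rs = \prod_(z <- rs) e ^+ 2); last first.
  by rewrite big_const_seq count_predT iter_mulr_1.
rewrite big_seq [leRHS]big_seq; apply: ler_prod => z /far.
rewrite -leNgt sqr_ge0 => ez.
by rewrite -sqr_cabs ler_pXn2r ?nnegrE ?cabs_ge0 ?(ltW e0).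
Qed.

Lemma poly_bounded (p : {poly C}) (z : C) : exists2 M : R, 0 < M &
  forall x, cabs (x - z) <= 1 -> cabs p.[x] <= M.
Proof.
elim/poly_ind: p => [|p c [M M0 pM]].
  by exists 1 => // x _; rewrite horner0 /cabs abs20 sqrtr0 ler01.
exists (M * (cabs z + 1) + cabs c + 1) => [|x xz].
  by rewrite ltr_wpDl// addr_ge0 ?cabs_ge0// mulr_ge0 ?addr_ge0 ?cabs_ge0 ?ltW.
rewrite hornerMXaddC; apply: (le_trans (cabsD _ _)); rewrite -addrA.
apply: lerD; last by rewrite lerDl ler01.
rewrite cabsM ler_pM ?cabs_ge0 ?pM// -[x](subrK z).
by rewrite (le_trans (cabsD _ _))// addrC lerD2l.
Qed.

Lemma root_approx (p : {poly C}) (z : C) (e del : R) : root p z -> 0 < e ->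
  0 < del -> exists k, cabs (rat_cplx k - z) < e /\ abs2 p.[rat_cplx k] < del.
Proof.
move=> /factor_theorem[g ->] e0 del0.
have [M M0 gM] := poly_bounded g z.
have s0 : 0 < Num.sqrt del / M by rewrite divr_gt0 ?sqrtr_gt0.
have m0 : 0 < Num.min e (Num.min 1 (Num.sqrt del / M)) by rewrite !lt_min e0 ltr01.
have [k] := rat_cplx_dense z m0; rewrite !lt_min => /and3P[ke k1 kd].
exists k; split=> //; rewrite -sqr_cabs hornerM hornerXsubC cabsM.
rewrite -[ltRHS]sqr_sqrtr ?ltW// ltr_pXn2r ?nnegrE ?mulr_ge0 ?cabs_ge0 ?sqrtr_ge0//.
apply: (@le_lt_trans _ _ (M * cabs (rat_cplx k - z))).
  by rewrite ler_wpM2r ?cabs_ge0 ?gM ?ltW.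
by rewrite mulrC -ltr_pdivlMr.
Qed.

Section family.
Context d (T : measurableType d).

Lemma cmeas_horner n (p : T -> {poly C}) (z : T -> C) :
  (forall t, size (p t) <= n)%N -> (forall k, cmeas (fun t => (p t)`_k)) ->
  cmeas z -> cmeas (fun t => (p t).[z t]).
Proof.
move=> sp mp mz; under eq_fun do rewrite (horner_coef_wide _ (sp _)).
apply: (@cmeas_sum _ _ _ 'I_n (index_enum 'I_n) (fun i t => (p t)`_i * z t ^+ i)) => i.
apply: cmeasM => //; elim: (val i) => [|k IH].
  by under eq_fun do rewrite expr0; exact: cmeas_cst.
by under eq_fun do rewrite exprS; exact: cmeasM.
Qed.

(** Bisection over a countable dense set. [N m t] is the least index of a rational point at which p
    is so small that a root lies within 2^-m, and which is within 2 * 2^-m of the preceding point.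
    Least indices depend measurably on t, and so does the limit, which is a root. *)
Lemma measurable_root n (p : T -> {poly C}) : (forall t, p t \is monic) ->
  (forall t, size (p t) = n.+2) -> (forall k, cmeas (fun t => (p t)`_k)) ->
  exists2 rho : T -> C, cmeas rho & forall t, root (p t) (rho t).
Proof.
move=> pm sp mp.
pose r m : R := 2^-1 ^+ m.
have r0 m : 0 < r m by rewrite exprn_gt0// invr_gt0.
pose q := @rat_cplx R.
pose A m t j := abs2 (p t).[q j] < (r m ^+ 2) ^+ n.+1.
pose B m i j := cabs (q j - q i) < 2 * r m.
pose fix N (m : nat) (t : T) {struct m} : nat := if m is m'.+1
  then least (fun j => A m t j && B m' (N m' t) j) else least (A 0%N t).
have mA m j : measurable [set t | A m t j].
  rewrite -[X in measurable X]setTI.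
  apply: (measurable_fun_ltr (f := fun t => abs2 (p t).[q j])) => //.
  apply: measurable_abs2; apply: (@cmeas_horner n.+2) => // [t|].
    by rewrite sp.
  exact: cmeas_cst.
have NA m : (forall t, A m t (N m t)) /\ nat_meas (N m).
  elim: m => [|m [IHA IHm]].
    have ex0 t : exists j, A 0%N t j.
      have [z pz] : exists z, root (p t) z.
        by apply/closed_rootP; rewrite sp.
      have [k [_ kd]] := root_approx pz (r0 0%N) (exprn_gt0 n.+1 (exprn_gt0 2 (r0 0%N))).
      by exists k.
    by split; [move=> t; have [] := leastP (ex0 t)|exact: nat_meas_least].
  have exS t : exists j, A m.+1 t j && B m (N m t) j.
    (* A root z lies within [r m] of the current point. A rational point close enough to z passes
       the next test and is within 2 [r m] of the current point. *)
    have [z pz zN] := near_root (pm t) (sp t) (r0 m) (IHA t).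
    have [k [kz kd]] := root_approx pz (r0 m) (exprn_gt0 n.+1 (exprn_gt0 2 (r0 m.+1))).
    exists k; apply/andP; split=> //; rewrite /B.
    apply: (le_lt_trans (cabs_dist_le _ z _)); rewrite mulr2n mulrDl mul1r ltrD//.
    by rewrite cabs_distC.
  split=> [t|]; first by have [/andP[]] := leastP (exS t).
  apply: nat_meas_least => // j.
  apply: (nat_meas_bind (Q := fun t i => A m.+1 t j && B m i j)) => // i.
  have [Bij|Bij] := boolP (B m i j).
    rewrite (_ : [set t | _] = [set t | A m.+1 t j])//.
    by apply/seteqP; split=> t /=; rewrite andbT.
  rewrite (_ : [set t | _] = set0)//.
  by apply/seteqP; split=> t //=; rewrite andbF.
have NB m t : cabs (q (N m.+1 t) - q (N m t)) < 2 * r m.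
  have exS : exists j, A m.+1 t j && B m (N m t) j.
    have [z pz zN] := near_root (pm t) (sp t) (r0 m) ((NA m).1 t).
    have [k [kz kd]] := root_approx pz (r0 m) (exprn_gt0 n.+1 (exprn_gt0 2 (r0 m.+1))).
    exists k; apply/andP; split=> //; rewrite /B.
    apply: (le_lt_trans (cabs_dist_le _ z _)); rewrite mulr2n mulrDl mul1r ltrD//.
    by rewrite cabs_distC.
  by have [/andP[]] := leastP exS.
have part (f : C -> R) : {morph f : x y / x + y} -> {morph f : x / - x} ->
    (forall z, `|f z| <= cabs z) -> exists L : T -> R, measurable_fun setT L /\
    forall m t, `|L t - f (q (N m t))| <= 4 * 2^-1 ^+ m.
  move=> fD fN fc; apply: measurable_geometric_limit => m.
    exact: (measurable_comp_nat (fun j => f (q j)) (NA m).2).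
  by move=> t; rewrite -fN -fD (le_trans (fc _))// ltW// NB.
have [L1 [mL1 L1N]] := part _ cReD cReN Re_le_cabs.
have [L2 [mL2 L2N]] := part _ cImD cImN Im_le_cabs.
exists (fun t => L1 t +i* L2 t); first by apply/cmeasP; split.
move=> t; have [rs prs srs] := monic_prod_roots (pm t).
rewrite prs root_prod_XsubC; apply: contrapT => /negP Lrs.
(* If the limit were not a root, it would keep a positive distance e from all the roots. *)
have [e e0 ers] : exists2 e : R, 0 < e & forall z, z \in rs -> e <= cabs (L1 t +i* L2 t - z).
  elim: {prs srs} rs Lrs => [_|z rs IH]; first by exists 1.
  rewrite inE negb_or => /andP[Lz /IH[e e0 ers]].
  exists (Num.min (cabs (L1 t +i* L2 t - z)) e).
    by rewrite lt_min e0 andbT lt_def cabs_ge0 cabs_eq0 subr_eq0 Lz.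
  move=> z'; rewrite inE => /predU1P[->|/ers ez]; first by rewrite ge_min lexx.
  by rewrite ge_min ez orbT.
(* 9 = 1 + 8: one [r m] from a root to the m-th point, and 4 [r m] for each of the real and
   imaginary parts from there to the limit. *)
have [m m9] : exists m, 9 * r m < e.
  have e9 : 0 < e / 9 by rewrite divr_gt0.
  have r_cvg : (fun m => 2^-1 ^+ m : R) @ \oo --> 0.
    by apply: cvg_expr; rewrite ger0_norm ?invr_ge0// invf_lt1// ltr1n.
  have /cvgrPdist_lt/(_ _ e9)[m _ /(_ m (leqnn m))/=] := r_cvg.
  rewrite sub0r normrN ger0_norm ?ltW ?r0// => rm.
  by exists m; rewrite mulrC -ltr_pdivlMr.
have [z pz zN] := near_root (pm t) (sp t) (r0 m) ((NA m).1 t).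
have zrs : z \in rs by move: pz; rewrite prs root_prod_XsubC.
have := ers z zrs; rewrite leNgt => /negP; apply.
apply: le_lt_trans m9; apply: (le_trans (cabs_dist_le _ (q (N m t)) _)).
have LN : cabs (L1 t +i* L2 t - q (N m t)) <= 8 * r m.
  apply: (le_trans (cabs_le_ReIm _)); rewrite cReD cImD cReN cImN/=.
  by have := L1N m t; have := L2N m t; rewrite -/(r m); lra.
by move: LN zN; lra.
Qed.

Lemma measurable_roots n (p : T -> {poly C}) : (forall t, p t \is monic) ->
  (forall t, size (p t) = n.+1) -> (forall k, cmeas (fun t => (p t)`_k)) ->
  exists2 rho : nat -> T -> C, (forall i, cmeas (rho i)) &
    forall t, p t = \prod_(i < n) ('X - (rho i t)%:P).
Proof.
elim: n p => [|n IH] p pm sp mp.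
  exists (fun _ _ => 0) => [i|t]; first exact: cmeas_cst.
  rewrite big_ord0; have /eqP := sp t.
  by rewrite size_poly_eq1 eqp_monic ?monic1// => /eqP.
have [rho mrho prho] := measurable_root pm sp mp.
pose g t := p t %/ ('X - (rho t)%:P).
have pg t : p t = g t * ('X - (rho t)%:P).
  by rewrite divpK// dvdp_XsubCl.
have gm t : g t \is monic by rewrite -(monicMr _ (monicXsubC (rho t))) -pg.
have sg t : size (g t) = n.+1.
  have := sp t; rewrite pg size_Mmonic ?monicXsubC ?monic_neq0//.
  by rewrite size_XsubC addn2 => -[].
(* Synthetic division: the coefficients of the quotient are obtained from the top one downwards, so
   the induction is on the distance j to the top degree. *)
have mg k : cmeas (fun t => (g t)`_k).
  have [j nk] : exists j, (n.+1 <= k + j)%N by exists n.+1; rewrite leq_addl.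
  elim: j k nk => [|j IHj] k nk.
    apply: (eq_measurable_fun (pair_of \o (fun=> 0))); last exact: cmeas_cst.
    by move=> t _ /=; rewrite nth_default// sg -(addn0 k).
  have gk t : (g t)`_k = (p t)`_k.+1 + rho t * (g t)`_k.+1.
    by rewrite pg mulrBr coefB coefMX coefMC/= mulrC subrK.
  under eq_fun do rewrite gk.
  by apply: cmeasD => //; apply: cmeasM => //; apply: IHj; rewrite addSnnS.
have [rhos mrhos grhos] := IH g gm sg mg.
exists (fun i => if i is i'.+1 then rhos i' else rho) => [[]//|t].
by rewrite big_ord_recl/= mulrC pg grhos.
Qed.

End family.
End measurable_roots.

(** * Binary forms and lifts of rational maps *)

Section binary_forms.
Context {R : realType}.
Local Notation C := R[i].
Local Notation P1 := (riemann_sphere R).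
Local Notation form := (mpoly 2 C).

Definition pt2 (S : Type) (x y : S) (i : 'I_2) : S := if i == ord0 then x else y.

Definition is_form (d : nat) (G : form) : bool := G \is @ishomog1 _ _ d mdeg.

(** Dehomogenization at second coordinate 1. A form of known degree is determined by it, so
    identities between forms are checked on univariate polynomials. *)
Definition affine_part (G : form) : {poly C} := mmap (@polyC C) (pt2 'X 1) G.

Lemma mmap1_pt2 (S : comNzRingType) (x y : S) m :
  mmap1 (pt2 x y) m = x ^+ m ord0 * y ^+ m ord_max.
Proof.
rewrite /mmap1 !big_ord_recl big_ord0 mulr1; congr (_ * _ ^+ m _).
exact/val_inj.
Qed.

Lemma mdeg2 (m : multinom 2) : mdeg m = (m ord0 + m ord_max)%N.
Proof.
rewrite mdegE !big_ord_recl big_ord0 addn0; congr (_ + m _)%N.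
exact/val_inj.
Qed.

Lemma coef_affine_part (G : form) k :
  (affine_part G)`_k = \sum_(m <- msupp G) mcoeff m G * (k == m ord0)%:R.
Proof.
rewrite /affine_part /mmap coef_sum; apply: eq_bigr => m _.
by rewrite mmap1_pt2 expr1n mulr1 coefCM coefXn.
Qed.

(** The coefficient morphism is arbitrary because the formula serves several times: with [mpolyC] it
    rebuilds the form from its affine part, with the identity it computes values. *)
Lemma mmap_form (S : comNzRingType) (f : {rmorphism C -> S}) (x y : S) d G :
  is_form d G -> mmap f (pt2 x y) G =
    \sum_(k < d.+1) f (affine_part G)`_k * x ^+ k * y ^+ (d - k).
Proof.
move=> /dhomogP homG.
under eq_bigr do rewrite coef_affine_part rmorph_sum !big_distrl/=.
rewrite exchange_big/= {1}/mmap big_seq [RHS]big_seq; apply: eq_bigr => m mG.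
have dm : (m ord0 + m ord_max)%N = d by rewrite -mdeg2; exact: homG.
have m0d : (m ord0 < d.+1)%N by rewrite ltnS -dm leq_addr.
rewrite (bigD1 (Ordinal m0d))//= eqxx mulr1 big1 ?addr0 => [|k km].
  by rewrite mmap1_pt2 mulrA -dm addKn.
suff -> : (k == m ord0 :> nat) = false by rewrite mulr0 rmorph0 !mul0r.
by apply/negbTE; apply: contraNneq km => km; apply/eqP/val_inj.
Qed.

Lemma size_affine_part d (G : form) : is_form d G -> (size (affine_part G) <= d.+1)%N.
Proof.
move=> /dhomogP homG; apply/leq_sizeP => k dk; rewrite coef_affine_part.
rewrite big_seq big1// => m mG; have dm : (m ord0 + m ord_max)%N = d by rewrite -mdeg2; exact: homG.
suff -> : (k == m ord0) = false by rewrite mulr0.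
by apply/negbTE; rewrite neq_ltn orbC (leq_trans _ dk)// ltnS -dm leq_addr.
Qed.

Lemma mmap_mpolyC_id (G : form) : mmap (@mpolyC 2 C)
  (pt2 (mpolyX C (mnm1 ord0)) (mpolyX C (mnm1 ord_max))) G = G.
Proof.
rewrite [RHS]mpolyE /mmap; apply: eq_bigr => m _.
rewrite -mul_mpolyC; congr (_ * _).
rewrite -[RHS]mmap1_id; congr mmap1; apply/funext => i; rewrite /pt2.
by case: ifPn => [/eqP->//|]; case: i => -[|[|//]] // ? _; congr (mpolyX _ (mnm1 _)); exact/val_inj.
Qed.

Lemma affine_part_inj d (G H : form) : is_form d G -> is_form d H ->
  affine_part G = affine_part H -> G = H.
Proof.
move=> hG hH GH; rewrite -[G]mmap_mpolyC_id -[H]mmap_mpolyC_id.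
rewrite (@mmap_form _ (@mpolyC 2 C : {rmorphism C -> form}) _ _ d G)//.
by rewrite (@mmap_form _ (@mpolyC 2 C : {rmorphism C -> form}) _ _ d H)// GH.
Qed.

Definition eval2 (x y : C) (G : form) : C := meval (pt2 x y) G.

Lemma eval2_form d (G : form) (x y : C) : is_form d G ->
  eval2 x y G = \sum_(k < d.+1) (affine_part G)`_k * x ^+ k * y ^+ (d - k).
Proof. by move=> hG; rewrite /eval2 /meval (mmap_form _ _ _ hG). Qed.

Lemma eval2_affine d (G : form) (z : C) : is_form d G ->
  eval2 z 1 G = (affine_part G).[z].
Proof.
move=> hG; rewrite (eval2_form _ _ hG) (horner_coef_wide _ (size_affine_part hG)).
by apply: eq_bigr => k _; rewrite expr1n mulr1.
Qed.

Lemma eval2_inf d (G : form) : is_form d G -> eval2 1 0 G = (affine_part G)`_d.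
Proof.
move=> hG; rewrite (eval2_form _ _ hG) big_ord_recr/= subnn expr0 expr1n !mulr1.
rewrite big1 ?add0r// => k _; rewrite expr0n subn_eq0 leqNgt ltn_ord mulr0//.
Qed.

Lemma eval2_scale d (G : form) (k x y : C) : is_form d G ->
  eval2 (k * x) (k * y) G = k ^+ d * eval2 x y G.
Proof.
move=> hG; rewrite !(eval2_form _ _ hG) mulr_sumr; apply: eq_bigr => j _.
have jd : (j <= d)%N by rewrite -ltnS ltn_ord.
by rewrite !exprMn -[in k ^+ d](subnKC jd) exprD; ring.
Qed.

Definition h0 (P : P1) : C := homog_coord P ord0 ord0.
Definition h1 (P : P1) : C := homog_coord P ord_max ord0.

Lemma h0E (P : P1) : h0 P = if P is Some z then z else 1.
Proof. by case: P => [z|]; rewrite /h0 mxE. Qed.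
Lemma h1E (P : P1) : h1 P = if P is Some z then 1 else 0.
Proof. by case: P => [z|]; rewrite /h1 mxE. Qed.

Lemma homog_coordE (P : P1) : homog_coord P = col2 (h0 P) (h1 P).
Proof. exact: col2_eta. Qed.

Definition lin_form (P : P1) : form :=
  h1 P *: mpolyX C (mnm1 ord0) - h0 P *: mpolyX C (mnm1 ord_max).

Lemma is_form_lin P : is_form 1 (lin_form P).
Proof.
by rewrite /is_form /lin_form rpredB// rpredZ// dhomogX; apply/eqP; exact: mdeg1.
Qed.

Lemma mmap_lin_form (S : comNzRingType) (f : {rmorphism C -> S}) (x y : S) P :
  mmap f (pt2 x y) (lin_form P) = f (h1 P) * x - f (h0 P) * y.
Proof.
by rewrite /lin_form mmapB !mmapZ !mmapX !mmap1U.
Qed.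

Lemma eval2_lin x y P : eval2 x y (lin_form P) = h1 P * x - h0 P * y.
Proof. by rewrite /eval2 /meval mmap_lin_form. Qed.

Lemma affine_part_lin P : affine_part (lin_form P) =
  if P is Some z then 'X - z%:P else -1.
Proof.
rewrite /affine_part mmap_lin_form h0E h1E.
by case: P => [z|]; rewrite ?mul1r ?mulr1 ?mul0r ?sub0r.
Qed.

Lemma affine_partZ (c : C) (H : form) : affine_part (c *: H) = c *: affine_part H.
Proof. by rewrite /affine_part mmapZ mul_polyC. Qed.
Lemma affine_part_prod I (r : seq I) (F : I -> form) :
  affine_part (\prod_(i <- r) F i) = \prod_(i <- r) affine_part (F i).
Proof. by rewrite /affine_part rmorph_prod. Qed.

Lemma is_form_prod_lin (ps : seq P1) : is_form (size ps) (\prod_(P <- ps) lin_form P).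
Proof.
elim: ps => [|P ps IH]; first by rewrite big_nil; exact: dhomog1.
by rewrite big_cons; apply: (dhomogM (d := 1%N)) => //; exact: is_form_lin.
Qed.

(** The affine part splits over C, and the degree that it lacks is the multiplicity of the root at
    infinity. *)
Lemma form_factor d (G : form) : is_form d G -> G != 0 ->
  exists c : C, exists2 ps : seq P1, size ps = d &
    c != 0 /\ G = c *: \prod_(P <- ps) lin_form P.
Proof.
move=> hG G0; set g := affine_part G.
have g0 : g != 0.
  apply: contra_neq G0 => g0; apply: (affine_part_inj hG); first exact: rpred0.
  by rewrite -/g g0 /affine_part raddf0.
have [rs grs] := closed_field_poly_normal g.
have srs : (size rs <= d)%N.
  have := size_affine_part hG; rewrite -/g grs size_scale ?lead_coef_eq0//.
  by rewrite size_prod_XsubC.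
pose k := (d - size rs)%N.
(* [lin_form None] is minus the second variable, so its affine part is -1; the sign compensates for
   k such factors. *)
exists (lead_coef g * (-1) ^+ k), (map Some rs ++ nseq k None).
  by rewrite size_cat size_map size_nseq subnKC.
split; first by rewrite mulf_neq0 ?lead_coef_eq0// signr_eq0.
apply: (affine_part_inj hG).
  have := is_form_prod_lin (map Some rs ++ nseq k None).
  rewrite size_cat size_map size_nseq subnKC// => h.
  by rewrite /is_form rpredZ.
rewrite affine_partZ affine_part_prod big_cat big_map/=.
under eq_bigr do rewrite affine_part_lin.
rewrite [X in _ *: (_ * X)](_ : _ = (-1) ^+ k); last first.
  rewrite big_nseq; elim: k => [|k IH]; first by rewrite expr0.
  by rewrite /= IH affine_part_lin exprS.
have -> : (-1) ^+ k = ((-1) ^+ k)%:P :> {poly C} by rewrite rmorphXn/= rmorphN1.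
by rewrite [_ * _%:P]mulrC mul_polyC scalerA -mulrA -expr2 sqrr_sign mulr1 -/g {1}grs.
Qed.

Lemma lin_form_root x y P : eval2 x y (lin_form P) = 0 ->
  (x != 0) || (y != 0) -> P = of_homog_coord (col2 x y).
Proof.
rewrite eval2_lin of_homog_col2 h0E h1E => /eqP; rewrite subr_eq0.
case: P => [z|]; last first.
  by rewrite mul0r mul1r eq_sym => /eqP ->; rewrite eqxx.
rewrite mul1r => /eqP ->; have [->|y0] := eqVneq y 0.
  by rewrite mulr0 eqxx.
by move=> _; rewrite mulfK.
Qed.

Lemma of_homog_h P : of_homog_coord (col2 (h0 P) (h1 P)) = P.
Proof.
rewrite of_homog_col2 h0E h1E; case: P => [z|]; last by rewrite eqxx.
by rewrite oner_eq0 divr1.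
Qed.

Lemma h_neq0 P : (h0 P != 0) || (h1 P != 0).
Proof. by rewrite h0E h1E; case: P => [z|]; rewrite oner_eq0 ?orbT. Qed.

Lemma eval2Z x y c (G : form) : eval2 x y (c *: G) = c * eval2 x y G.
Proof. by rewrite /eval2 mevalZ. Qed.
Lemma eval2M x y (G H : form) : eval2 x y (G * H) = eval2 x y G * eval2 x y H.
Proof. by rewrite /eval2 mevalM. Qed.
Lemma eval2_prod x y I (r : seq I) (F : I -> form) :
  eval2 x y (\prod_(i <- r) F i) = \prod_(i <- r) eval2 x y (F i).
Proof. by rewrite /eval2 rmorph_prod. Qed.

Lemma form_dvd d (G : form) P : is_form d G -> eval2 (h0 P) (h1 P) G = 0 ->
  exists G', G = lin_form P * G'.
Proof.
move=> hG GP; have [->|G0] := eqVneq G 0; first by exists 0; rewrite mulr0.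
have [c [ps _ [c0 EG]]] := form_factor hG G0.
have /hasP[Q Qps /eqP QP] : has (fun Q => eval2 (h0 P) (h1 P) (lin_form Q) == 0) ps.
  apply: contra_eqT GP => /hasPn nz; rewrite EG eval2Z eval2_prod mulf_neq0//.
  by rewrite prodf_seq_neq0; apply/allP => Q Qps; rewrite nz.
rewrite -(of_homog_h P) -(lin_form_root QP (h_neq0 P)) EG (big_rem Q)//=.
by exists (c *: \prod_(y <- rem Q ps) lin_form y); rewrite scalerAr.
Qed.

End binary_forms.

(** * Lifts, their uniqueness and local degrees *)

Section homogeneous_lifts.
Context {R : realType}.
Local Notation C := R[i].
Local Notation P1 := (riemann_sphere R).
Local Notation form := (mpoly 2 C).

Lemma poly_eq_fun (p q : {poly C}) : (forall z, p.[z] = q.[z]) -> p = q.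
Proof.
move=> pq; apply/eqP; rewrite -subr_eq0; apply/eqP.
apply: (@roots_geq_poly_eq0 _ _ [seq (n%:R : C) | n <- iota 0 (size (p - q))]).
- by apply/allP => x _; rewrite rootE hornerD hornerN pq subrr.
- rewrite map_inj_uniq ?iota_uniq// => m n mn.
  by apply/eqP; rewrite -(eqr_nat C) mn.
- by rewrite size_map size_iota.
Qed.

(** With u a + v b = 1, the multiplier is u a' + v b'. A root of it would be a common root of a' and
    b', hence it is a non-zero constant. *)
Lemma proportional_poly (a b a' b' : {poly C}) :
  (forall z, (a.[z] != 0) || (b.[z] != 0)) ->
  (forall z, (a'.[z] != 0) || (b'.[z] != 0)) ->
  (forall z, a.[z] * b'.[z] = a'.[z] * b.[z]) ->
  exists2 k : C, k != 0 & a' = k *: a /\ b' = k *: b.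
Proof.
move=> ab ab' cross.
have abE : a * b' = a' * b by apply: poly_eq_fun => z; rewrite !hornerM cross.
have : coprimep a b.
  apply: Pdiv.ClosedField.root_coprimep => z /eqP az.
  by have := ab z; rewrite az eqxx.
move=> /Bezout_eq1_coprimepP[[u v] /= uv].
pose k := u * a' + v * b'.
have ka : a' = k * a.
  by rewrite -[LHS]mulr1 -uv /k mulrDl mulrDr -[v * b' * a]mulrA [b' * a]mulrC abE; ring.
have kb : b' = k * b.
  by rewrite -[LHS]mulr1 -uv /k mulrDl mulrDr -[u * a' * b]mulrA -abE; ring.
have k1 : size k == 1%N.
  apply/negbNE/negP => /closed_rootP[z /eqP kz].
  by have := ab' z; rewrite ka kb !hornerM kz !mul0r eqxx.
have /size_poly1P[c c0 kc] := k1.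
by exists c => //; rewrite -!mul_polyC -kc.
Qed.

Lemma homog_scale (x y : C) : (x != 0) || (y != 0) ->
  exists2 k : C, k != 0 & x = k * h0 (of_homog_coord (col2 x y)) /\
    y = k * h1 (of_homog_coord (col2 x y)).
Proof.
rewrite of_homog_col2; have [->|y0] := eqVneq y 0.
  by rewrite orbF => x0; exists x => //; rewrite h0E h1E mulr1 mulr0.
by move=> _; exists y => //; rewrite h0E h1E mulr1 mulrC divfK.
Qed.

Lemma lin_form_of_homog (x y : C) :
  eval2 x y (lin_form (of_homog_coord (col2 x y))) = 0.
Proof.
rewrite eval2_lin of_homog_col2; have [->|y0] := eqVneq y 0.
  by rewrite h0E h1E mul0r mulr0 subrr.
by rewrite h0E h1E divfK// mul1r subrr.
Qed.

Lemma mup_scale (c z : C) (p : {poly C}) : c != 0 -> mup z (c *: p) = mup z p.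
Proof. by move=> c0; rewrite -mul_polyC mupMr// rootC. Qed.

Lemma form_mult_affine (G : form) z : form_mult G (Some z) = mup z (affine_part G).
Proof. by []. Qed.

Lemma form_multZ c (G : form) P : c != 0 -> form_mult (c *: G) P = form_mult G P.
Proof. by move=> c0; case: P => [z|]; rewrite /form_mult mmapZ/= mul_polyC mup_scale. Qed.

Lemma form_mult_prod_lin (ps : seq P1) P :
  form_mult (\prod_(Q <- ps) lin_form Q) P = count_mem P ps.
Proof.
have lin0 Q : affine_part (lin_form Q) != 0.
  rewrite affine_part_lin; case: Q => [z|]; first by rewrite polyXsubC_eq0.
  by rewrite oppr_eq0 oner_eq0.
pose inf_part (G : form) : {poly C} := mmap (@polyC C) (pt2 1 'X) G.
have inf_lin Q : inf_part (lin_form Q) = if Q is Some z then 1 - z *: 'X else - 'X.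
  rewrite /inf_part mmap_lin_form h0E h1E; case: Q => [z|].
    by rewrite mulr1 mul_polyC.
  by rewrite mul0r sub0r mul1r.
have lin0' Q : inf_part (lin_form Q) != 0.
  rewrite inf_lin; case: Q => [z|]; last by rewrite oppr_eq0 polyX_eq0.
  by apply/eqP => /(congr1 (horner^~ 0)); rewrite !hornerE ?mulr0 ?subr0 => /eqP; rewrite oner_eq0.
case: P => [z|].
  rewrite form_mult_affine affine_part_prod.
  elim: ps => [|Q ps IH]; first by rewrite big_nil mupNroot// root1.
  rewrite big_cons mupM; [|exact: lin0|by rewrite prodf_seq_neq0; apply/allP => Q' _; rewrite lin0].
  rewrite IH/=; congr (_ + _)%N; rewrite affine_part_lin.
  case: Q => [z'|]; last by rewrite mupNroot// rootE !hornerE oppr_eq0 oner_eq0.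
  by rewrite (mup_XsubCX 1) [RHS]/(nat_of_bool (Some z' == Some z)); case: eqP => [->|ne];
    [rewrite eqxx|case: eqP => // -[/ne]].
rewrite -[form_mult _ _]/(mup 0 (inf_part _)) /inf_part rmorph_prod.
elim: ps => [|Q ps IH]; first by rewrite big_nil mupNroot// root1.
rewrite big_cons mupM; [|exact: lin0'|by rewrite prodf_seq_neq0; apply/allP => Q' _; rewrite lin0'].
rewrite IH/=; congr (_ + _)%N; rewrite -/(inf_part _) inf_lin.
case: Q => [z'|]; first by rewrite mupNroot// rootE !hornerE ?mulr0 ?subr0 oner_eq0.
rewrite -scaleN1r mup_scale ?oppr_eq0 ?oner_eq0//.
by rewrite (_ : 'X = ('X - 0%:P) ^+ 1) ?mup_XsubCX ?eqxx// expr1 polyC0 subr0.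
Qed.

Lemma form_nonunit d (G : form) : (0 < d)%N -> is_form d G -> G \isn't a GRing.unit.
Proof.
move=> d0 hG; have [->|G0] := eqVneq G 0; first by rewrite unitr0.
have [c [[|P ps] sps [c0 EG]]] := form_factor hG G0; first by rewrite -sps in d0.
apply/negP => Gu.
have : eval2 (h0 P) (h1 P) G \is a GRing.unit.
  exact: (rmorph_unit (meval (pt2 (h0 P) (h1 P)))).
by rewrite EG eval2Z big_cons eval2M eval2_lin [h1 P * _]mulrC subrr mul0r mulr0 unitr0.
Qed.

Section one_lift.
Variables (d : nat) (F : 'I_2 -> form) (f : P1 -> P1).
Hypothesis liftF : homogeneous_lift d F f.

Lemma lift_form i : is_form d (F i).
Proof. by case: liftF => h _ _; exact: h. Qed.

Lemma poly_mapE (v : 'cV[C]_2) : poly_map F v =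
  col2 (eval2 (v ord0 ord0) (v ord_max ord0) (F ord0))
       (eval2 (v ord0 ord0) (v ord_max ord0) (F ord_max)).
Proof.
rewrite [LHS]col2_eta !mxE /eval2.
have -> // : (fun j => v j ord0) = pt2 (v ord0 ord0) (v ord_max ord0).
apply/funext => j; rewrite /pt2; case: eqP => [->//|].
case: j => -[|[|//]] /= ij ne; last by congr (v _ _); exact/val_inj.
by case: ne; exact/val_inj.
Qed.

Let F_root P : ~ (eval2 (h0 P) (h1 P) (F ord0) = 0 /\ eval2 (h0 P) (h1 P) (F ord_max) = 0).
Proof.
move=> [e0 e1]; case: liftF => _ cop _.
have [G0 EG0] := form_dvd (lift_form _) e0.
have [G1 EG1] := form_dvd (lift_form _) e1.
have := cop _ _ _ EG0 EG1.
by apply/negP; exact: form_nonunit (is_form_lin P).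
Qed.

Lemma lift_neq0 (x y : C) : (x != 0) || (y != 0) ->
  (eval2 x y (F ord0) != 0) || (eval2 x y (F ord_max) != 0).
Proof.
move=> /homog_scale; set P := of_homog_coord _ => -[k k0 [-> ->]].
rewrite !(eval2_scale _ _ _ (lift_form _)) !mulf_eq0 expf_eq0 (negbTE k0) andbF/=.
by rewrite -negb_and; apply/negP => /andP[/eqP e0 /eqP e1]; exact: (@F_root P).
Qed.

Lemma liftE P : f P =
  of_homog_coord (col2 (eval2 (h0 P) (h1 P) (F ord0)) (eval2 (h0 P) (h1 P) (F ord_max))).
Proof. by case: liftF => _ _ ->; rewrite poly_mapE. Qed.

Lemma fiber_formE w : fiber_form F w = h1 w *: F ord0 - h0 w *: F ord_max.
Proof. by []. Qed.

Lemma is_form_fiber w : is_form d (fiber_form F w).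
Proof. by rewrite /is_form fiber_formE rpredB// rpredZ//; exact: lift_form. Qed.

Lemma eval2_fiber w x y : eval2 x y (fiber_form F w) =
  h1 w * eval2 x y (F ord0) - h0 w * eval2 x y (F ord_max).
Proof. by rewrite fiber_formE /eval2 mevalB !mevalZ. Qed.

Lemma fiberP w P : (eval2 (h0 P) (h1 P) (fiber_form F w) = 0) <-> f P = w.
Proof.
rewrite eval2_fiber -eval2_lin liftE; split=> [|<-]; last exact: lin_form_of_homog.
by move=> /lin_form_root -> //; exact: lift_neq0 (h_neq0 P).
Qed.

Lemma fiber_form_neq0 w : (0 < d)%N -> fiber_form F w != 0.
Proof.
move=> d0; apply/eqP; rewrite fiber_formE => /eqP; rewrite subr_eq0 => /eqP.
case: liftF => _ cop _; rewrite h0E h1E; case: w => [z|] E.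
  have := form_nonunit d0 (lift_form ord_max); rewrite (cop _ (z%:A) 1) ?mulr1//.
  by rewrite -scalerAr mulr1 -E scale1r.
have := form_nonunit d0 (lift_form ord0); rewrite (cop _ 1 0) ?mulr1//.
by rewrite mulr0 -[RHS](scale0r (F ord0)) E scale1r.
Qed.

End one_lift.

(** Two lifts of f have equal cross products at every finite point, which makes their affine parts
    proportional. It remains to see that the degrees agree. *)
Lemma lift_unique d d' F F' f : homogeneous_lift d F f -> homogeneous_lift d' F' f ->
  exists2 k : C, k != 0 & forall i, F' i = k *: F i.
Proof.
move=> lF lF'.
have E0 z : 1 = h1 (Some z : P1) by rewrite h1E.
have E1 z : z = h0 (Some z : P1) by rewrite h0E.
have nz d1 F1 (l1 : homogeneous_lift d1 F1 f) z :
    ((affine_part (F1 ord0)).[z] != 0) || ((affine_part (F1 ord_max)).[z] != 0).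
  rewrite -!(eval2_affine z (lift_form l1 _)).
  by apply: (lift_neq0 l1); rewrite oner_eq0 orbT.
have [k k0 [Ea Eb]] : exists2 k : C, k != 0 &
    affine_part (F' ord0) = k *: affine_part (F ord0) /\
    affine_part (F' ord_max) = k *: affine_part (F ord_max).
  apply: proportional_poly => [||z]; [exact: nz lF|exact: nz lF'|].
  have := liftE lF (Some z); rewrite (liftE lF') h0E h1E => fz.
  rewrite -!(eval2_affine z (lift_form lF _)) -!(eval2_affine z (lift_form lF' _)).
  have := lin_form_of_homog (eval2 z 1 (F ord0)) (eval2 z 1 (F ord_max)).
  rewrite -fz => /eqP.
  have [k k0 [Ea Eb]] := homog_scale (nz _ _ lF' z).
  rewrite -!(eval2_affine z (lift_form lF' _)) in Ea Eb.
  rewrite eval2_lin subr_eq0 => /eqP; move: Ea Eb.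
  set h := h0 _; set h' := h1 _ => -> -> E.
  by rewrite mulrC -mulrA E; ring.
(* At infinity one of the two components does not vanish, so its affine part has full degree: the
   degree of a lift can be read on the affine parts. *)
have dd' : d = d'.
  have sd d1 F1 (l1 : homogeneous_lift d1 F1 f) :
      maxn (size (affine_part (F1 ord0))) (size (affine_part (F1 ord_max))) = d1.+1.
    apply/eqP; rewrite eqn_leq geq_max !(size_affine_part (lift_form l1 _))/=.
    have := @lift_neq0 _ _ _ l1 1 0; rewrite oner_eq0 => /(_ isT).
    rewrite !(eval2_inf (lift_form l1 _)) leq_max.
    by move=> /orP[|] h; apply/orP; [left|right]; rewrite ltnNge; apply: contra_neqN h => /leq_sizeP/(_ _ (leqnn _)).
  apply/eq_add_S; rewrite -(sd _ _ lF) -(sd _ _ lF') Ea Eb !size_scale//.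
rewrite -{}dd' in lF'; exists k => // i.
apply: (affine_part_inj (lift_form lF' i)).
  by rewrite /is_form rpredZ//; exact: lift_form lF i.
by rewrite affine_partZ; have [->|->] : i = ord0 \/ i = ord_max;
  [by case: i => -[|[|//]] ?; [left|right]; exact/val_inj|rewrite Ea|rewrite Eb].
Qed.

Lemma local_degreeE d (F : 'I_2 -> form) (f : P1 -> P1) (P : P1) : homogeneous_lift d F f ->
  local_degree f P = form_mult (fiber_form F (f P)) P.
Proof.
move=> lF; rewrite /local_degree; apply: xget_subset1; first by exists d, F.
move=> m n [d1 [F1 [l1 ->]]] [d2 [F2 [l2 ->]]].
have [k k0 Ek] := lift_unique l1 l2.
have -> : fiber_form F2 (f P) = k *: fiber_form F1 (f P).
  by rewrite !fiber_formE !Ek scalerBr !scalerA ![k * _]mulrC.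
by rewrite form_multZ.
Qed.

End homogeneous_lifts.

(** * Measurable enumeration of the fibres *)

Section fiber_points.
Context {R : realType}.
Local Notation C := R[i].
Local Notation P1 := (riemann_sphere R).
Local Notation form := (mpoly 2 C).

Section one_lift.
Variables (d : nat) (F : 'I_2 -> form) (f : P1 -> P1).
Hypothesis d_gt0 : (0 < d)%N.
Hypothesis liftF : homogeneous_lift d F f.

Let a := affine_part (F ord0).
Let b := affine_part (F ord_max).
Let lead (w : C) := a`_d - w * b`_d.

Let affine_fiber w : affine_part (fiber_form F (Some w)) = a - w *: b.
Proof.
rewrite fiber_formE h0E h1E scale1r /affine_part mmapB mmapZ mul_polyC.
by [].
Qed.

Let lead_eq0 w : lead w = 0 -> w = a`_d / b`_d.
Proof.
move=> /eqP; rewrite subr_eq0 => /eqP ad.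
have b0 : b`_d != 0.
  have := @lift_neq0 _ _ _ _ liftF 1 0; rewrite oner_eq0 => /(_ isT).
  rewrite !(eval2_inf (lift_form liftF _)) -/a -/b ad mulf_eq0.
  by case: (b`_d == 0); rewrite // orbT.
by rewrite ad mulfK.
Qed.

(** The fibre over w as a monic polynomial of constant degree d. Where the leading coefficient
    vanishes, the fibre contains infinity; this happens for at most one finite w, and 'X^d is only a
    placeholder there. *)
Let p (t : R * R) : {poly C} := if lead (cplx_of t) == 0 then 'X^d
  else (lead (cplx_of t))^-1 *: (a - cplx_of t *: b).

Let size_ab w : (size (a - w *: b)%R <= d.+1)%N.
Proof. by rewrite -affine_fiber; apply: size_affine_part; exact: is_form_fiber liftF _. Qed.

Let coef_ab w k : (a - w *: b)`_k = a`_k - w * b`_k.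
Proof. by rewrite coefB coefZ. Qed.

Let size_p t : size (p t) = d.+1.
Proof.
rewrite /p; case: ifPn => [_|l0]; first by rewrite size_polyXn.
rewrite size_scale ?invr_eq0//; apply/eqP; rewrite eqn_leq size_ab/=.
by rewrite ltnNge; apply: contra l0 => /leq_sizeP/(_ _ (leqnn _))/eqP; rewrite coef_ab.
Qed.

Let monic_p t : p t \is monic.
Proof.
rewrite monicE lead_coefE size_p/= /p; case: ifPn => [_|l0].
  by rewrite coefXn eqxx.
by rewrite coefZ coef_ab -/(lead _) mulVf.
Qed.

Let cmeas_lead : cmeas (fun t => lead (cplx_of t)).
Proof.
apply: cmeasB; first exact: cmeas_cst.
by apply: cmeasM; [exact: cmeas_cplx_of|exact: cmeas_cst].
Qed.

Let cmeas_p k : cmeas (fun t => (p t)`_k).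
Proof.
apply: (eq_measurable_fun (fun t => if lead (cplx_of t) == 0
   then pair_of ((k == d)%:R : C)
   else pair_of ((lead (cplx_of t))^-1 * (a`_k - cplx_of t * b`_k)))).
  by move=> t _ /=; rewrite /p; case: ifPn => _; rewrite ?coefXn ?coefZ ?coef_ab.
apply: measurable_fun_ifT => //; first exact: measurable_neq0.
apply: (cmeasM (cmeasV cmeas_lead)); apply: cmeasB; first exact: cmeas_cst.
by apply: cmeasM; [exact: cmeas_cplx_of|exact: cmeas_cst].
Qed.

Lemma measurable_fiber_points : exists2 r : nat -> P1 -> P1,
  forall n, measurable_fun setT (r n) &
  forall Q, exists2 c : C, c != 0 &
    fiber_form F Q = c *: \prod_(P <- [seq r i Q | i <- iota 0 d]) lin_form P.
Proof.
have [rho mrho prho] := measurable_roots monic_p size_p cmeas_p.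
have list Q : exists ps : seq P1, size ps = d /\ exists2 c : C, c != 0 &
    fiber_form F Q = c *: \prod_(P <- ps) lin_form P.
  have [c [ps sps [c0 E]]] := form_factor (is_form_fiber liftF Q) (fiber_form_neq0 liftF Q d_gt0).
  by exists ps; split => //; exists c.
(* The fibres over the only possible exceptional finite value and over infinity are enumerated by
   fixed lists, which does not affect measurability. *)
have [psw [sw Ew]] := list (Some (a`_d / b`_d)).
have [psn [sn En]] := list None.
have list_nth (ps : seq P1) : size ps = d -> [seq nth None ps i | i <- iota 0 d] = ps.
  by move=> <-; exact: mkseq_nth.
exists (fun n Q => if Q is Some w then
    if lead w == 0 then nth None psw n else Some (rho n (pair_of w))
  else nth None psn n) => [n|[w|]].
- apply: measurable_P1.
  apply: (eq_measurable_fun (fun t : R * R => (if lead (cplx_of t) == 0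
     then nth None psw n else Some (rho n t)) : P1)).
    by move=> t _ /=; rewrite -[t.1 +i* t.2]/(cplx_of t) cplx_ofK.
  apply: measurable_fun_ifT => //; first exact: measurable_neq0.
  exact: measurable_Some.
- have [l0|l0] := eqVneq (lead w) 0.
    by rewrite list_nth// (lead_eq0 l0).
  exists (lead w) => //.
  apply: (affine_part_inj (is_form_fiber liftF _)).
    have := is_form_prod_lin [seq (Some (rho i (pair_of w)) : P1) | i <- iota 0 d].
    by rewrite size_map size_iota => h; rewrite /is_form rpredZ.
  rewrite affine_partZ affine_part_prod affine_fiber big_map.
  have := prho (pair_of w); rewrite /p pair_ofK (negbTE l0).
  move/(congr1 (fun q => lead w *: q)); rewrite scalerA divff// scale1r => ->.
  rewrite -(big_mkord xpredT (fun i => 'X - (rho i (pair_of w))%:P)) /index_iota subn0.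
  by congr (_ *: _); apply: eq_bigr => i _; rewrite affine_part_lin.
- by rewrite list_nth.
Qed.

End one_lift.

Section pullback.
Variables (d : nat) (F : 'I_2 -> form) (f : P1 -> P1) (r : nat -> P1 -> P1).
Hypothesis liftF : homogeneous_lift d F f.
Hypothesis fiber_r : forall Q, exists2 c : C, c != 0 &
    fiber_form F Q = c *: \prod_(P <- [seq r i Q | i <- iota 0 d]) lin_form P.

Lemma fiber_points_mem P Q : (P \in [seq r i Q | i <- iota 0 d]) <-> f P = Q.
Proof.
have [c c0 E] := fiber_r Q.
rewrite -(fiberP liftF) E eval2Z eval2_prod; split=> [Pr|/eqP].
  by rewrite (big_rem P)//= eval2_lin [h1 P * _]mulrC subrr mul0r mulr0.
rewrite mulf_eq0 (negbTE c0)/= prodf_seq_eq0 => /hasP[P' P'r /eqP /= e].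
by rewrite -(of_homog_h P) -(lin_form_root e (h_neq0 P)).
Qed.

Lemma local_degree_count P Q : f P = Q ->
  local_degree f P = count_mem P [seq r i Q | i <- iota 0 d].
Proof.
move=> fP; have [c c0 E] := fiber_r Q.
by rewrite (local_degreeE _ liftF) fP E form_multZ// form_mult_prod_lin.
Qed.

Local Open Scope ereal_scope.

(** The local degree at P is the number of occurrences of P among the enumerated points [r i Q], so
    the weighted sum over the fibre becomes a sum over i. *)
Lemma esum_local_degree (A : set P1) Q :
  \esum_(P in A `&` f @^-1` [set Q]) (local_degree f P)%:R%:E =
  \sum_(i < d) (\1_A (r i Q))%:E :> \bar R.
Proof.
transitivity (\esum_(P in A `&` f @^-1` [set Q])
    \sum_(i <- iota 0 d) ((r i Q == P)%:R%:E : \bar R)).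
  apply: eq_esum => P [_ fP]; rewrite (local_degree_count fP) sumEFin; congr _%:E.
  by rewrite count_map -sum1_count natr_sum big_mkcond; apply: eq_bigr => i _ /=; case: eqP.
rewrite esum_sum; last by move=> P i _ _; rewrite lee_fin.
rewrite -(big_mkord xpredT (fun i => (\1_A (r i Q))%:E)) /index_iota subn0.
rewrite big_seq [RHS]big_seq; apply: eq_bigr => i id.
have fr : f (r i Q) = Q by apply/fiber_points_mem/map_f.
have [rA|rA] := pselect (A (r i Q)).
  rewrite indicE mem_set// -[RHS](@esum_set1 R _ (r i Q) (fun=> 1))//.
  rewrite [RHS]esum_mkcond esum_mkcond; apply: eq_esum => P _.
  have [<-|ne] := eqVneq (r i Q) P; first by rewrite !mem_set.
  rewrite [in RHS]memNset => [|/= e]; last by rewrite e eqxx in ne.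
  by case: ifP.
rewrite indicE memNset// esum1// => P [AP _].
by have [e|//] := eqVneq (r i Q) P; rewrite e in rA.
Qed.

Lemma pullback_measureE (mu : {measure set P1 -> \bar R}) (A : set P1) :
  (forall n, measurable_fun setT (r n)) -> measurable A ->
  pullback_measure f mu A = \sum_(i < d) mu (r i @^-1` A).
Proof.
move=> mr mA; rewrite /pullback_measure.
under eq_integral do rewrite esum_local_degree.
rewrite ge0_integral_sum//.
- apply: eq_bigr => i _.
  have mrA : measurable (r i @^-1` A) by rewrite -[X in measurable X]setTI; exact: mr.
  by rewrite -[X in _ = mu X]setIT -(integral_indic mu measurableT mrA).
- move=> i; apply/measurable_EFinP.
  have mI : measurable_fun setT (\1_A : P1 -> R) by exact: measurable_indic.
  exact: measurableT_comp mI (mr i).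
Qed.

End pullback.
End fiber_points.

(** * The measure omega_f on the sphere *)

Section sphere_coordinates.
Context {R : realType}.
Local Notation C := R[i].
Local Notation P1 := (riemann_sphere R).

Lemma row3_0 (x y z : R) : row3 x y z ord0 ord0 = x. Proof. by rewrite mxE. Qed.
Lemma row3_1 (x y z : R) : row3 x y z ord0 1 = y. Proof. by rewrite mxE. Qed.
Lemma row3_2 (x y z : R) : row3 x y z ord0 ord_max = z. Proof. by rewrite mxE. Qed.

Lemma row3_eqP (u v : 'rV[R]_3) : u ord0 ord0 = v ord0 ord0 ->
  u ord0 1 = v ord0 1 -> u ord0 ord_max = v ord0 ord_max -> u = v.
Proof.
move=> e0 e1 e2; apply/rowP => i.
have [->|->|->] : [\/ i = ord0, i = 1 | i = ord_max]; rewrite ?e0 ?e1 ?e2//.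
by case: i => -[|[|[|//]]] ?; [constructor 1|constructor 2|constructor 3]; exact/val_inj.
Qed.

Lemma sum3 (F : 'I_3 -> R) : \sum_i F i = F ord0 + F 1 + F ord_max.
Proof.
rewrite !big_ord_recl big_ord0 addr0 !addrA.
by congr (_ + F _ + F _); exact/val_inj.
Qed.

Lemma sqnorm3 (x : 'rV[R]_3) :
  sqnorm x = x ord0 ord0 ^+ 2 + x ord0 1 ^+ 2 + x ord0 ord_max ^+ 2.
Proof. exact: sum3. Qed.

(** The inverse of the stereographic projection in homogeneous coordinates, that is, the Hopf map in
    real form. *)
Definition zvec (x y : C) : 'rV[R]_3 :=
  let n := abs2 x + abs2 y in let w := x * y^* in
  row3 (2 * complex.Re w / n) (2 * complex.Im w / n) ((abs2 x - abs2 y) / n).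

Lemma abs2D_gt0 (x y : C) : (x != 0) || (y != 0) -> 0 < abs2 x + abs2 y.
Proof.
move=> xy0; rewrite lt_def addr_ge0 ?abs2_ge0// andbT.
by rewrite paddr_eq0 ?abs2_ge0// !abs2_eq0 negb_and.
Qed.

Lemma mul_real_complex (w : C) (r : R) :
  w * r%:C = (complex.Re w * r) +i* (complex.Im w * r).
Proof.
by apply/eqP; rewrite eq_complex cReM cImM/= !mulr0 subr0 add0r !eqxx.
Qed.

Lemma zvec_scale (k x y : C) : k != 0 -> zvec (k * x) (k * y) = zvec x y.
Proof.
move=> k0; have k2 : abs2 k != 0 by rewrite abs2_eq0.
have [/eqP|n0] := eqVneq (abs2 x + abs2 y) 0.
  rewrite paddr_eq0 ?abs2_ge0// !abs2_eq0 => /andP[/eqP -> /eqP ->].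
  by rewrite !mulr0.
have wE : k * x * (k * y)^* = (abs2 k)%:C * (x * y^*).
  by rewrite -mulcJ rmorphM/=; ring.
rewrite /zvec wE !abs2M.
rewrite cReM cImM/= !mul0r subr0 addr0.
by congr row3; field; rewrite -mulrDr mulf_neq0 ?n0.
Qed.

Lemma sqnorm_zvec (x y : C) : (x != 0) || (y != 0) -> sqnorm (zvec x y) = 1.
Proof.
move=> xy0; have n0 := abs2D_gt0 xy0.
rewrite sqnorm3 row3_0 row3_1 row3_2.
have wE : complex.Re (x * y^*) ^+ 2 + complex.Im (x * y^*) ^+ 2 = abs2 x * abs2 y.
  by rewrite -[LHS]/(abs2 (x * y^*)) abs2M abs2_conj.
transitivity ((4 * (complex.Re (x * y^*) ^+ 2 + complex.Im (x * y^*) ^+ 2) +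
   (abs2 x - abs2 y) ^+ 2) / (abs2 x + abs2 y) ^+ 2).
  by field; rewrite gt_eqF.
by rewrite wE; field; rewrite gt_eqF.
Qed.

Lemma stereographic_zvec (x y : C) : (x != 0) || (y != 0) ->
  stereographic (zvec x y) = of_homog_coord (col2 x y).
Proof.
move=> xy0; have n0 := abs2D_gt0 xy0.
rewrite /stereographic row3_0 row3_1 row3_2 of_homog_col2.
have E3 : 1 - (abs2 x - abs2 y) / (abs2 x + abs2 y) = 2 * abs2 y / (abs2 x + abs2 y).
  by field; rewrite gt_eqF.
have -> : ((abs2 x - abs2 y) / (abs2 x + abs2 y) == 1) = (y == 0).
  rewrite eq_sym -subr_eq0 E3 !mulf_eq0 pnatr_eq0/= invr_eq0 (gt_eqF n0) orbF.
  exact: abs2_eq0.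
case: ifPn => // y0; congr Some; rewrite E3.
have y2 : abs2 y != 0 by rewrite abs2_eq0.
set w := x * y^*; set n := abs2 x + abs2 y in n0 *.
have -> : (2 * complex.Re w / n) +i* (2 * complex.Im w / n) = w * (2 / n)%:C.
  by rewrite mul_real_complex; congr (_ +i* _); ring.
rewrite [y^-1]invcE [x * _]mulrA -/w -mulrA -fmorphV -rmorphM/=; congr (_ * _%:C).
by field; rewrite y2 gt_eqF.
Qed.

Definition zeta (P : P1) : 'rV[R]_3 := zvec (h0 P) (h1 P).

Lemma zeta_of_homog (x y : C) : (x != 0) || (y != 0) ->
  zeta (of_homog_coord (col2 x y)) = zvec x y.
Proof.
move=> /homog_scale[k k0 [Ex Ey]].
by rewrite /zeta -(zvec_scale (h0 _) (h1 _) k0) -Ex -Ey.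
Qed.

Lemma zeta_sphere P : unit_sphere 3 (zeta P).
Proof. exact: sqnorm_zvec (h_neq0 P). Qed.

Lemma stereographic_zeta P : stereographic (zeta P) = P.
Proof. by rewrite stereographic_zvec ?h_neq0// of_homog_h. Qed.

Lemma zeta_stereographic x : unit_sphere 3 x -> zeta (stereographic x) = x.
Proof.
rewrite /unit_sphere/= sqnorm3 /stereographic => x1.
have [x3|x3] := eqVneq (x ord0 ord_max) 1.
  move: x1; rewrite x3 expr1n => /eqP; rewrite -subr_eq0 addrK paddr_eq0 ?sqr_ge0//.
  rewrite !sqrf_eq0 => /andP[/eqP e0 /eqP e1].
  rewrite /zeta h0E h1E /zvec cReM cImM abs20 abs21/= oppr0 !mulr0 addr0 !subr0 !divr1.
  rewrite mulr0; apply: row3_eqP; rewrite ?row3_0 ?row3_1 ?row3_2 ?e0 ?e1 ?x3//.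
  by rewrite addr0 mulr0.
set z := _ / _.
have u0 : 1 - x ord0 ord_max != 0 by rewrite subr_eq0 eq_sym.
have zE : z = (x ord0 ord0 / (1 - x ord0 ord_max)) +i* (x ord0 1 / (1 - x ord0 ord_max)).
  by rewrite /z -fmorphV/= mul_real_complex.
have v0 : 1 + x ord0 ord_max != 0 -> 1 + x ord0 ord_max != 0 by [].
have z2 : abs2 z = (1 + x ord0 ord_max) / (1 - x ord0 ord_max).
  rewrite zE /abs2/= !expr_div_n -mulrDl.
  have -> : x ord0 ord0 ^+ 2 + x ord0 1 ^+ 2 = (1 + x ord0 ord_max) * (1 - x ord0 ord_max).
    transitivity (1 - x ord0 ord_max ^+ 2); last by ring.
    by rewrite -[X in X - _]x1; ring.
  by field.
have n2 : abs2 z + 1 = 2 / (1 - x ord0 ord_max) by rewrite z2; field.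
rewrite /zeta h0E h1E /zvec abs21 n2 rmorph1 mulr1.
apply: row3_eqP; rewrite ?row3_0 ?row3_1 ?row3_2.
- by rewrite zE/=; field.
- by rewrite zE/=; field.
- by rewrite z2; field.
Qed.

Lemma sphere_transportE (mu : set P1 -> \bar R) (A : set 'rV[R]_3) :
  sphere_transport mu A = mu (zeta @^-1` A).
Proof.
rewrite /sphere_transport; congr (mu _); apply/seteqP; split=> [P [x [Ax Sx] <-]|P AP].
  by rewrite /= zeta_stereographic.
by exists (zeta P); [split => //; exact: zeta_sphere|exact: stereographic_zeta].
Qed.

Lemma measurable_zvec d (T : measurableType d) (a b : T -> C) :
  cmeas a -> cmeas b -> measurable_fun setT (fun t => zvec (a t) (b t)).
Proof.
move=> ma mb; have mn : measurable_fun setT (fun t => (abs2 (a t) + abs2 (b t))^-1).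
  apply: measurable_invr_nneg => [t|]; first by rewrite addr_ge0 ?abs2_ge0.
  by apply: measurable_funD; exact: measurable_abs2.
have /cmeasP[mw1 mw2] : cmeas (fun t => a t * (b t)^*).
  by apply: cmeasM => //; exact: cmeas_conj.
apply/measurable_fun_rVP => i.
have [->|->|->] : [\/ i = ord0, i = 1 | i = ord_max].
- by case: i => -[|[|[|//]]] ?; [constructor 1|constructor 2|constructor 3]; exact/val_inj.
- under eq_fun do rewrite row3_0; apply: measurable_funM => //.
  exact: measurable_funM.
- under eq_fun do rewrite row3_1; apply: measurable_funM => //.
  exact: measurable_funM.
- under eq_fun do rewrite row3_2; apply: measurable_funM => //.
  by apply: measurable_funB; exact: measurable_abs2.
Qed.

Lemma measurable_zeta : measurable_fun setT zeta.
Proof.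
apply: measurable_P1.
apply: (eq_measurable_fun (fun t => zvec (cplx_of t) 1)).
  by move=> t _; rewrite /= /zeta h0E h1E.
by apply: measurable_zvec; [exact: cmeas_cplx_of|exact: cmeas_cst].
Qed.

Lemma cmeas_eval2 d n (T : measurableType d) (G : mpoly 2 C) (a b : T -> C) :
  is_form n G -> cmeas a -> cmeas b -> cmeas (fun t => eval2 (a t) (b t) G).
Proof.
move=> hG ma mb; under eq_fun do rewrite (eval2_form _ _ hG).
have mX (g : T -> C) k : cmeas g -> cmeas (fun t => g t ^+ k).
  move=> mg; elim: k => [|k IH]; first by under eq_fun do rewrite expr0; exact: cmeas_cst.
  by under eq_fun do rewrite exprS; exact: cmeasM.
apply: (@cmeas_sum _ _ _ 'I_n.+1 (index_enum 'I_n.+1)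
  (fun k t => (affine_part G)`_k * a t ^+ k * b t ^+ (n - k))) => k.
apply: cmeasM; last exact: mX.
by apply: cmeasM; [exact: cmeas_cst|exact: mX].
Qed.

Lemma measurable_lift d (F : 'I_2 -> mpoly 2 C) (f : P1 -> P1) :
  homogeneous_lift d F f -> measurable_fun setT f.
Proof.
move=> lF; apply: measurable_P1.
apply: (eq_measurable_fun (fun t => of_homog_coord
  (col2 (eval2 (cplx_of t) 1 (F ord0)) (eval2 (cplx_of t) 1 (F ord_max))) : P1)).
  by move=> t _; rewrite /= (liftE lF) h0E h1E.
apply: measurable_of_homog; apply: (cmeas_eval2 (lift_form lF _));
  by [exact: cmeas_cplx_of|exact: cmeas_cst].
Qed.

End sphere_coordinates.

Section eq_setfun_integral.
Local Open Scope ereal_scope.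
Import HBNNSimple.

(** [omega f] and its transport are bare set functions. The integral only evaluates them on
    measurable sets, so it can be computed with a genuine measure that agrees with them there. *)
Lemma eq_setfun_integral d (T : measurableType d) (R : realType)
    (m1 m2 : set T -> \bar R) (D : set T) (f : T -> \bar R) :
  (forall A, measurable A -> m1 A = m2 A) ->
  \int[m1]_(x in D) f x = \int[m2]_(x in D) f x.
Proof.
move=> m12; rewrite /integral.
by congr (ereal_sup _ - ereal_sup _); apply: eq_imagel => h _;
  apply: eq_fsbigr => r _; rewrite m12.
Qed.

End eq_setfun_integral.

Section transported_omega.
Context {R : realType} (sigma : probability 'rV[R]_4 R).
Hypothesis sigma_rot : rotation_invariant_on_sphere sigma.
Local Notation C := R[i].
Local Notation P1 := (riemann_sphere R).
Variables (d : nat) (F : 'I_2 -> mpoly 2 C) (f : P1 -> P1) (r : nat -> P1 -> P1).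
Hypothesis d_gt0 : (0 < d)%N.
Hypothesis liftF : homogeneous_lift d F f.
Hypothesis mr : forall n, measurable_fun setT (r n).
Hypothesis fiber_r : forall Q, exists2 c : C, c != 0 &
    fiber_form F Q = c *: \prod_(P <- [seq r i Q | i <- iota 0 d]) lin_form P.
Local Open Scope ereal_scope.

(** The d fibre selections followed by f itself: the transport of omega_f is the sum of the images
    of [sigma] under these d + 1 maps. *)
Definition branch (n : nat) (q : 'rV[R]_4) : 'rV[R]_3 :=
  zeta ((if (n < d)%N then r n else f) (hopf q)).

Lemma measurable_branch n : measurable_fun setT (branch n).
Proof.
apply: measurableT_comp measurable_zeta _; apply: measurableT_comp measurable_hopf.
by case: ifP => _ //; exact: measurable_lift liftF.
Qed.

Lemma branch_sphere n q : unit_sphere 3 (branch n q).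
Proof. exact: zeta_sphere. Qed.

Definition branch_sum := msum (fun n => pushforward_pack sigma (measurable_branch n)) d.+1.

Lemma transport_omegaE A : measurable A ->
  sphere_transport (omega f) A = branch_sum A.
Proof.
move=> mA; rewrite sphere_transportE /omega.
have mzA : measurable (zeta @^-1` A).
  by rewrite -[X in measurable X]setTI; exact: measurable_zeta.
have mgA (g : P1 -> P1) : measurable_fun setT g -> measurable (g @^-1` (zeta @^-1` A)).
  by move=> mg; rewrite -[X in measurable X]setTI; exact: mg.
have mf := measurable_lift liftF.
rewrite (pullback_measureE liftF fiber_r) //.
rewrite /branch_sum/= /msum big_ord_recr/=; congr (_ + _).
  apply: eq_bigr => i _; rewrite (fubini_study_hopf sigma_rot); last exact: mgA.
  by transitivity (sigma (branch i @^-1` A)); first by rewrite /branch ltn_ord.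
rewrite /pushforward (fubini_study_hopf sigma_rot); last exact: mgA.
by transitivity (sigma (branch d @^-1` A)); first by rewrite /branch ltnn.
Qed.

Lemma ge0_integral_transport (h : 'rV[R]_3 -> \bar R) :
  measurable_fun setT h -> (forall x, 0 <= h x) ->
  \int[sphere_transport (omega f)]_(x in unit_sphere 3) h x =
  \sum_(n < d.+1) \int[sigma]_q h (branch n q).
Proof.
move=> mh h0; rewrite (eq_setfun_integral _ _ transport_omegaE).
have mS := @measurable_unit_sphere R 3.
rewrite ge0_integral_measure_sum//; last exact: measurable_funS mh.
apply: eq_bigr => n _.
rewrite ge0_integral_pushforward//; last exact: measurable_funS mh.
- rewrite (_ : branch n @^-1` _ = setT)//.
  by apply/seteqP; split=> // q _; exact: branch_sphere.
- exact: measurable_branch.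
Qed.

Lemma integrable_branch (h : 'rV[R]_3 -> R) (M : R) n :
  measurable_fun setT h -> (forall x, unit_sphere 3 x -> `|h x| <= M)%R ->
  sigma.-integrable setT (EFin \o (h \o branch n)).
Proof.
move=> mh hM; apply: measurable_bounded_integrable => //.
- by rewrite (@le_lt_trans _ _ 1)// ?ltry// probability_le1.
- exact: measurableT_comp mh (measurable_branch n).
- exists M; split; first exact: num_real.
  by move=> x Mx q _ /=; rewrite (le_trans (hM _ _)) ?ltW//; exact: branch_sphere.
Qed.

Lemma integral_transport (h : 'rV[R]_3 -> R) (M : R) :
  measurable_fun setT h -> (forall x, unit_sphere 3 x -> `|h x| <= M)%R ->
  \int[sphere_transport (omega f)]_(x in unit_sphere 3) (h x)%:E =
  (\sum_(n < d.+1) \int[sigma]_q h (branch n q))%R%:E.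
Proof.
move=> mh hM.
have mhE : measurable_fun setT (EFin \o h) by exact/measurable_EFinP.
rewrite (eq_setfun_integral _ _ transport_omegaE) integralE.
rewrite -!(eq_setfun_integral _ _ transport_omegaE).
rewrite ge0_integral_transport//; last exact: measurable_funepos.
rewrite ge0_integral_transport//; last exact: measurable_funeneg.
pose a n := \int[sigma]_q ((EFin \o (h \o branch n))^\+ q).
pose b n := \int[sigma]_q ((EFin \o (h \o branch n))^\- q).
have afin n : a n \is a fin_num.
  exact: (integrable_pos_fin_num measurableT (integrable_branch n mh hM)).
have bfin n : b n \is a fin_num.
  exact: (integrable_neg_fin_num measurableT (integrable_branch n mh hM)).
rewrite [X in X - _](_ : _ = \sum_(n < d.+1) a n); last first.
  by apply: eq_bigr => n _; apply: eq_integral => q _; rewrite !funeposE.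
rewrite [X in _ - X](_ : _ = \sum_(n < d.+1) b n); last first.
  by apply: eq_bigr => n _; apply: eq_integral => q _; rewrite !funenegE.
have -> : \sum_(n < d.+1) a n = (\sum_(n < d.+1) fine (a n))%R%:E.
  by rewrite -sumEFin; apply: eq_bigr => n _; rewrite fineK.
have -> : \sum_(n < d.+1) b n = (\sum_(n < d.+1) fine (b n))%R%:E.
  by rewrite -sumEFin; apply: eq_bigr => n _; rewrite fineK.
rewrite -EFinB -sumrB; congr _%:E; apply: eq_bigr => n _.
rewrite -(fineB (afin n) (bfin n)); congr fine; apply/esym.
exact: (integralE sigma setT (EFin \o (h \o branch n))).
Qed.

Lemma transport_sphere : sphere_transport (omega f) (unit_sphere 3) = d.+1%:R%:E.
Proof.
have mS := @measurable_unit_sphere R 3.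
transitivity (\int[sphere_transport (omega f)]_(x in unit_sphere 3) cst 1 x).
  rewrite (eq_setfun_integral _ _ transport_omegaE) (transport_omegaE mS).
  by rewrite integral_cst// mul1e.
rewrite (ge0_integral_transport (measurable_cst _) (fun _ => lee01)).
rewrite (eq_bigr (fun=> 1%:E)) => [|n _].
  by rewrite sumEFin sumr_const card_ord.
rewrite (integral_cst sigma measurableT 1%E) [X in _ * X](_ : _ = 1) ?mule1//.
exact: probability_setT.
Qed.

Lemma fubini_study_set1 (P : P1) : fubini_study [set P] = 0 /\ measurable [set P].
Proof.
have finP : @finite_point R @^-1` [set P] =
    if P is Some w then [set pair_of w] else set0.
  apply/seteqP; split=> t; case: P => [w|]//=.
    by move=> [<-]; rewrite -[_ +i* _]/(cplx_of t) cplx_ofK.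
  by move=> ->; rewrite /finite_point -[(pair_of w).1 +i* _]/(cplx_of (pair_of w)) pair_ofK.
have mP : measurable (@finite_point R @^-1` [set P]).
  by rewrite finP; case: P {finP} => [w|]; [exact: measurable_plane_set1|exact: measurable0].
split=> //; rewrite /fubini_study.
have mD : measurable_fun setT (EFin \o @fubini_study_density R).
  by apply/measurable_EFinP; exact: measurable_fubini_study_density.
rewrite -[X in integral X]/(@plane_measure R : set (R * R) -> \bar R).
apply: null_set_integral => //; first exact: measurable_funS mD.
rewrite finP; case: P {finP mP} => [w|]; last exact: measure0.
exact: plane_measure_set1.
Qed.

(** The Fubini-Study measure has no atoms. The preimage of P under each [r i] lies in the single
    point f(P), and the preimage of P under f is a finite fibre. *)
Lemma transport_set1 (x : 'rV[R]_3) : unit_sphere 3 x ->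
  sphere_transport (omega f) [set x] = 0.
Proof.
move=> Sx; rewrite sphere_transportE.
have -> : zeta @^-1` [set x] = [set stereographic x].
  apply/seteqP; split=> P /= => [<-|->]; last exact: zeta_stereographic.
  by rewrite stereographic_zeta.
set P := stereographic x.
have [mu0 mP] := fubini_study_set1 P.
have mgP (g : P1 -> P1) : measurable_fun setT g -> measurable (g @^-1` [set P]).
  by move=> mg; rewrite -[X in measurable X]setTI; exact: mg.
have fs0 (A : set P1) Q : measurable A -> A `<=` [set Q] -> fubini_study A = 0.
  move=> mA AQ; have [Q0 mQ] := fubini_study_set1 Q.
  by apply: subset_measure0 Q0.
have count0 : pullback_measure f fubini_study [set P] = 0.
  rewrite (pullback_measureE liftF fiber_r)//.
  rewrite big1// => i _; apply: (fs0 _ (f P)); first exact: mgP.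
  by move=> Q <-; apply/esym/(fiber_points_mem liftF fiber_r); apply: map_f; rewrite mem_iota/=.
rewrite /omega count0 add0e /pushforward.
have mfP := mgP _ (measurable_lift liftF).
have [ps Eps] : exists ps : seq P1, f @^-1` [set P] = [set` ps].
  exists [seq r i P | i <- iota 0 d]; apply/seteqP; split=> Q /=.
    by move/(fiber_points_mem liftF fiber_r).
  by move/(fiber_points_mem liftF fiber_r).
rewrite Eps; move: ps {Eps}; elim=> [|Q ps IH].
  by rewrite set_nil measure0.
have [Q0 mQ] := fubini_study_set1 Q.
have -> : [set` Q :: ps] = [set Q] `|` [set` ps].
  apply/seteqP; split=> x' /=; rewrite inE; first by case/orP => [/eqP->|]; [left|right].
  by case=> [->|->]; rewrite ?eqxx ?orbT.
have mps : measurable [set` ps].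
  apply: countable_measurable => [Q'|]; first exact: (fubini_study_set1 Q').2.
  by apply: finite_set_countable; exact: finite_seq.
apply/eqP; rewrite eq_le measure_ge0 andbT.
apply: (le_trans (measureU2 _ mQ mps)).
by rewrite [X in X + _](_ : _ = 0) ?[X in _ + X](_ : _ = 0) ?adde0//; exact: IH.
Qed.

End transported_omega.

(** * The logarithmic energy *)

Section log_distance.
Context {R : realType}.
Local Notation C := R[i].

Definition norm2 (x y : C) : R := abs2 x + abs2 y.

Lemma norm2_ge0 x y : 0 <= norm2 x y.
Proof. by rewrite addr_ge0 ?abs2_ge0. Qed.

Lemma norm2_eq0 x y : (norm2 x y == 0) = (x == 0) && (y == 0).
Proof. by rewrite paddr_eq0 ?abs2_ge0// !abs2_eq0. Qed.

Lemma norm2_gt0 x y : (0 < norm2 x y) = (x != 0) || (y != 0).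
Proof. by rewrite lt0r norm2_ge0 andbT norm2_eq0 negb_and. Qed.

Lemma norm2Z k x y : norm2 (k * x) (k * y) = abs2 k * norm2 x y.
Proof. by rewrite /norm2 !abs2M -mulrDr. Qed.

Lemma lagrange_identity (x y a b : C) : norm2 x y * norm2 a b =
  abs2 (x * b - y * a) + abs2 (x * a^* + y * b^*).
Proof.
case: x y a b => [x x'] [y y'] [a a'] [b b'].
by rewrite /norm2 /abs2 /=; ring.
Qed.

Lemma norm2_quat (p r u v : C) :
  norm2 (p * u - r^* * v) (r * u + p^* * v) = norm2 p r * norm2 u v.
Proof.
case: p r u v => [p p'] [r r'] [u u'] [v v'].
by rewrite /norm2 /abs2 /=; ring.
Qed.

Lemma abs2_wedge_le (x y a b : C) : abs2 (x * b - y * a) <= norm2 x y * norm2 a b.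
Proof. by rewrite lagrange_identity lerDl abs2_ge0. Qed.

(* Minus the logarithm of the squared chordal distance (normalized to have
   maximum 1) between the points of P^1(C) with homogeneous coordinates (x : y)
   and (a : b). *)
Definition log_distance (x y a b : C) : \bar R :=
  if x * b - y * a == 0 then +oo%E
  else (ln (norm2 x y * norm2 a b / abs2 (x * b - y * a)))%:E.

Lemma log_distance_ge0 x y a b : (0 <= log_distance x y a b)%E.
Proof.
rewrite /log_distance; case: eqP => // /eqP n0; rewrite lee_fin ln_ge0//.
by rewrite ler_pdivlMr ?abs2_gt0// mul1r abs2_wedge_le.
Qed.

Lemma log_distanceC x y a b : log_distance x y a b = log_distance a b x y.
Proof.
rewrite /log_distance (_ : x * b - y * a = - (a * y - b * x)); last by ring.
by rewrite oppr_eq0 abs2N [norm2 a b * _]mulrC.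
Qed.

Lemma log_distanceZ k x y a b : k != 0 ->
  log_distance (k * x) (k * y) a b = log_distance x y a b.
Proof.
move=> k0; rewrite /log_distance (_ : k * x * b - k * y * a = k * (x * b - y * a)); last by ring.
rewrite mulf_eq0 (negbTE k0)/=; case: eqP => // /eqP n0.
congr (ln _)%:E; rewrite norm2Z abs2M; field.
by rewrite !abs2_eq0 k0 n0.
Qed.

Lemma measurable_log_distance d (T : measurableType d) (x y a b : T -> C) :
  cmeas x -> cmeas y -> cmeas a -> cmeas b ->
  measurable_fun setT (fun t => log_distance (x t) (y t) (a t) (b t)).
Proof.
move=> mx my ma mb.
have mw : cmeas (fun t => x t * b t - y t * a t) by apply: cmeasB; exact: cmeasM.
apply: measurable_fun_if => //=; first exact: measurable_neq0.
apply: measurable_funTS; apply/measurable_EFinP; apply: measurableT_comp => //.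
apply: measurable_funM; first by apply: measurable_funM;
  apply: measurable_funD; exact: measurable_abs2.
by apply: measurable_invr_nneg => [t|]; [exact: abs2_ge0|exact: measurable_abs2].
Qed.

(** Apply ln y <= y - 1 to the square root of s. The exponent -3/2 is what remains of s^-2 after
    s^(1/2) is spent on the logarithm. *)
Lemma ln_div_sqr_le (s : R) : 1 <= s -> ln s * s ^- 2 <= 2 * s `^ (- (3 / 2)).
Proof.
move=> s1; have s0 : 0 < s by rewrite (lt_le_trans ltr01).
have -> : s ^- 2 = s `^ (- 2) by rewrite powR_invn ?ltW.
have -> : s `^ (- (3 / 2)) = s `^ 2^-1 * s `^ (- 2).
  have -> : - (3 / 2) = 2^-1 - 2 :> R by field.
  by rewrite powRD// (gt_eqF s0) implybT.
rewrite mulrA ler_pM2r ?powR_gt0//.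
have : ln (s `^ 2^-1) <= s `^ 2^-1 - 1.
  have := @ln_sublinear R (s `^ 2^-1) (powR_gt0 _ s0).
  have := @le_ln1Dx R (s `^ 2^-1 - 1).
  by rewrite addrCA subrr addr0 => H _; apply: H; rewrite ltrBrDl subrr powR_gt0.
rewrite ln_powR => H; have := powR_gt0 2^-1 s0; lra.
Qed.

Lemma ge0_cplx_integral_le (f g : C -> \bar R) : cmeas1 f -> cmeas1 g ->
  (forall z, 0 <= f z)%E -> (forall z, f z <= g z)%E ->
  (cplx_integral f <= cplx_integral g)%E.
Proof.
by move=> mf mg f0 fg; apply: ge0_le_integral => //= p _; exact: fg.
Qed.

Lemma cplx_integral_decay_lty (K : R) : 0 <= K ->
  (cplx_integral (fun z : C => (K * ((1 + `|complex.Re z|) `^ (- (3 / 2)) *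
     (1 + `|complex.Im z|) `^ (- (3 / 2))))%:E) < +oo)%E.
Proof.
move=> K0; pose g (x : R) : R := (1 + `|x|) `^ (- (3 / 2)).
have g0 x : 0 <= g x by exact: powR_ge0.
have mg : measurable_fun setT g.
  apply: (measurableT_comp (measurable_powR _)).
  by apply: measurable_funD => //; exact: measurable_normr.
have mgE : measurable_fun setT (EFin \o g) by exact/measurable_EFinP.
have cg : continuous g.
  move=> x; rewrite -[g]/((fun y : R => y `^ (- (3/2))) \o (fun x : R => 1 + `|x|)).
  apply: continuous_comp.
    by apply: continuousD; [exact: cst_continuous|exact: norm_continuous].
  apply: differentiable_continuous; apply/derivable1_diffP.
  have y0 : 0 < 1 + `|x| by rewrite (lt_le_trans ltr01)// lerDl.
  by have [] := @is_derive1_powR R (- (3/2)) _ y0.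
have Ig : (\int[@lebesgue_measure R]_x (g x)%:E = 4%:E)%E.
  rewrite ge0_symfun_integralT//; last by move=> x; rewrite /g/= normrN.
  rewrite (_ : [set x | 0 <= x] = `[0, +oo[%classic); last first.
    by apply/seteqP; split=> x /=; rewrite in_itv/= andbT.
  rewrite [X in (_ * X)%E](_ : _ = \int[@lebesgue_measure R]_(x in `[0%R, +oo[)
      ((1 + x) `^ (- (3 / 2)))%:E)%E; last first.
    by apply: eq_integral=> x; rewrite inE/= in_itv/= andbT /g => x0; rewrite ger0_norm.
  rewrite integral_1D_powR; last lra.
  by rewrite -EFinM; congr _%:E; field.
have m2 : measurable_fun setT (fun p : R * R => (g p.1 * g p.2)%:E).
  by apply/measurable_EFinP; apply: measurable_funM; exact: measurableT_comp mg _.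
under eq_cplx_integral do rewrite EFinM.
rewrite (cplx_integralZl K0 m2); last by move=> z; rewrite lee_fin mulr_ge0 ?powR_ge0.
suff -> : cplx_integral (fun z : C => ((1 + `|complex.Re z|) `^ (- (3 / 2)) *
    (1 + `|complex.Im z|) `^ (- (3 / 2)))%:E) = 16%:E by rewrite -EFinM ltry.
rewrite /cplx_integral (integral_plane (f := fun x y => (g x * g y)%:E))//; last first.
  by move=> x y; rewrite lee_fin mulr_ge0.
have Ik (k : R) : 0 <= k -> (\int[@lebesgue_measure R]_y (k * g y)%:E = (k * 4)%:E)%E.
  move=> k0; rewrite EFinM -Ig -ge0_integralZl//; last by move=> y _; rewrite lee_fin.
under eq_integral => x _ do rewrite (Ik _ (g0 x)) mulrC.
by rewrite Ik//; congr _%:E; ring.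
Qed.

End log_distance.

Section mean_log_distance.
Context {R : realType} (sigma : probability 'rV[R]_4 R).
Hypothesis sigma_rot : rotation_invariant_on_sphere sigma.
Local Notation C := R[i].
Local Open Scope ereal_scope.

Definition mean_log_distance : \bar R := \int[sigma]_q log_distance 1%R 0%R (z1 q) (z2 q).

Lemma integral_log_distance (x y : C) : (x != 0)%R || (y != 0)%R ->
  \int[sigma]_q log_distance x y (z1 q) (z2 q) = mean_log_distance.
Proof.
move=> xy.
have n0 : (0 < norm2 x y)%R by rewrite norm2_gt0.
pose s := (Num.sqrt (norm2 x y))%:C%R.
have s2 : abs2 s = norm2 x y by rewrite /abs2/= expr0n addr0 sqr_sqrtr// ltW.
have s0 : s != 0%R by rewrite -abs2_gt0 s2.
pose p := (s^-1 * x)%R; pose r := (s^-1 * y)%R.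
have pr1 : (norm2 p r = 1)%R by rewrite norm2Z abs2V s2 mulVf// gt_eqF.
have -> : \int[sigma]_q log_distance x y (z1 q) (z2 q) =
    \int[sigma]_q log_distance p r (z1 q) (z2 q).
  by apply: eq_integral => q _; rewrite log_distanceZ// invr_neq0.
have mf : measurable_fun setT (fun q => log_distance p r (z1 q) (z2 q)).
  by apply: measurable_log_distance;
    [exact: cmeas_cst|exact: cmeas_cst|exact: cmeas_z1|exact: cmeas_z2].
rewrite -(integral_lquat sigma_rot pr1 mf); last by move=> q; exact: log_distance_ge0.
apply: eq_integral => q _; have [-> ->] := z_lquat p r q.
rewrite /log_distance.
(* The matrix of [lquat p r] has determinant 1, so it preserves the wedge product, and its first
   column (p, r) is the image of (1, 0). *)
have -> : (p * (r * z1 q + conjc p * z2 q) - r * (p * z1 q - conjc r * z2 q) =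
    1 * z2 q - 0 * z1 q)%R.
  rewrite (_ : _ - _ = (p * conjc p + r * conjc r) * z2 q)%R; last by ring.
  by rewrite !mulcJ -rmorphD/= -[(_ + _)%R]/(norm2 p r) pr1 mul0r subr0.
case: ifP => // _; congr (ln (_ / _))%:E.
rewrite pr1 {2}/norm2 abs21 abs20 addr0; congr (_ * _)%R.
by rewrite norm2_quat pr1 mul1r /norm2 addrC.
Qed.

Lemma mean_log_distance_ge0 : 0 <= mean_log_distance.
Proof. by apply: integral_ge0 => q _; exact: log_distance_ge0. Qed.

(** In the affine chart the integrand is ln s / (pi s^2) with s = 1 + |a|^2, at most a multiple of
    s^(-3/2). As s dominates half of (1 + |x|)(1 + |y|), this is bounded by a product of two
    integrable functions of one real variable. *)
Lemma mean_log_distance_lty : mean_log_distance < +oo.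
Proof.
pose phi (P : riemann_sphere R) : \bar R :=
  if P is Some a then (ln (1 + abs2 a))%:E else +oo.
have ma : measurable_fun setT (fun p : R * R => ln (1 + abs2 (cplx_of p)))%R.
  apply: measurableT_comp => //; apply: measurable_funD => //.
  exact: measurable_abs2_cplx.
have mphi : measurable_fun setT phi.
  by apply: measurable_P1; exact/measurable_EFinP.
have phi0 P : 0 <= phi P.
  case: P => [a|]; last exact: leey.
  by rewrite lee_fin ln_ge0// lerDl abs2_ge0.
have -> : mean_log_distance = \int[sigma]_q phi (hopf q).
  apply: eq_integral => q _; rewrite /hopf to_C2E of_homog_col2 /log_distance.
  rewrite mul1r mul0r subr0; case: eqP => //= /eqP z0; congr (ln _)%:E.
  rewrite /norm2 abs21 abs20 addr0 mul1r mulrDl divff ?abs2_eq0// abs2M abs2V.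
  by rewrite addrC.
rewrite integral_hopf//.
pose K := (2 * 2^-1 `^ (- (3 / 2)) / pi : R)%R.
have K0 : (0 <= K)%R by rewrite !mulr_ge0 ?powR_ge0 ?invr_ge0 ?pi_ge0.
apply: le_lt_trans (cplx_integral_decay_lty K0).
have mRe : measurable_fun setT (fun p : R * R => (1 + `|p.1|) `^ (- (3 / 2)))%R.
  apply: (measurableT_comp (measurable_powR _)).
  by apply: measurable_funD => //; exact: measurableT_comp.
have mIm : measurable_fun setT (fun p : R * R => (1 + `|p.2|) `^ (- (3 / 2)))%R.
  apply: (measurableT_comp (measurable_powR _)).
  by apply: measurable_funD => //; exact: measurableT_comp.
apply: ge0_cplx_integral_le.
- apply: cmeas1P; apply: measurable_funM => //.
  exact: measurable_fubini_study_density.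
- by apply: cmeas1P; apply: measurable_funM => //; exact: measurable_funM.
- by move=> a; apply: mule_ge0; [exact: phi0|rewrite lee_fin fubini_study_density_ge0].
move=> [x y]; rewrite -EFinM lee_fin /fubini_study_density/=.
pose s := (1 + (x ^+ 2 + y ^+ 2))%R; rewrite -[abs2 _]/(x ^+ 2 + y ^+ 2)%R -/s.
have s1 : (1 <= s)%R by rewrite lerDl addr_ge0 ?sqr_ge0.
pose a := (1 + `|x|)%R; pose b := (1 + `|y|)%R; rewrite -/a -/b.
have a0 : (0 < a)%R by rewrite ltr_wpDr.
have b0 : (0 < b)%R by rewrite ltr_wpDr.
have sab : (a * b * 2^-1 <= s)%R.
  rewrite /s -(real_normK (num_real x)) -(real_normK (num_real y)) /a /b.
  by have := sqr_ge0 (1 - `|x|)%R; have := sqr_ge0 (1 - `|y|)%R;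
     have := sqr_ge0 (`|x| - `|y|)%R; nra.
have H := ln_div_sqr_le s1.
have H' : (s `^ (- (3 / 2)) <= (a * b * 2^-1) `^ (- (3 / 2)))%R.
  rewrite !powRN lef_pV2 ?posrE ?powR_gt0 ?mulr_gt0//; last exact: lt_le_trans s1.
  by apply: ge0_ler_powR => //; rewrite ?nnegrE ?mulr_ge0 ?(ltW a0) ?(ltW b0)//;
    exact: le_trans s1.
have E : ((a * b * 2^-1) `^ (- (3 / 2)) =
   a `^ (- (3 / 2)) * b `^ (- (3 / 2)) * 2^-1 `^ (- (3 / 2)))%R.
  by rewrite !powRM ?mulr_ge0 ?(ltW a0) ?(ltW b0).
rewrite E in H'.
rewrite mulrCA [leRHS](_ : _ =
  pi^-1 * (2 * (a `^ (- (3 / 2)) * b `^ (- (3 / 2)) * 2^-1 `^ (- (3 / 2)))))%R; last first.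
  by rewrite /K; ring.
rewrite ler_wpM2l ?invr_ge0 ?pi_ge0// (le_trans H)// ler_pM2l//.
Qed.

End mean_log_distance.

(** * Growth and Lipschitz bounds for lifts *)

Section form_bounds.
Context {R : realType}.
Local Notation C := R[i].
Local Notation form := (mpoly 2 C).

(** A Bezout relation u p + v q = 1 with u and v bounded on the unit disc gives an explicit lower
    bound and takes the place of a compactness argument. *)
Lemma coprime_bounded_below (p q : {poly C}) :
  (forall z, (p.[z] != 0) || (q.[z] != 0)) ->
  exists2 c : R, 0 < c & forall z, cabs z <= 1 -> c <= norm2 p.[z] q.[z].
Proof.
move=> pq; have cpq : coprimep p q.
  apply/Pdiv.ClosedField.coprimepP => z; rewrite !rootE => /eqP pz.
  by have := pq z; rewrite pz eqxx.
have [[u v] /= uv1] := Bezout_eq1_coprimepP p q cpq.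
have [M M0 uM] := poly_bounded u 0; have [N N0 vN] := poly_bounded v 0.
exists ((2 * (M + N) ^+ 2)^-1); first by rewrite invr_gt0 mulr_gt0// exprn_gt0// addr_gt0.
move=> z z1; have {z1}z1 : cabs (z - 0) <= 1 by rewrite subr0.
have H : 1 <= (M + N) * (cabs p.[z] + cabs q.[z]).
  have : cabs (u * p + v * q).[z] = 1 by rewrite uv1 hornerC /cabs abs21 sqrtr1.
  rewrite hornerD !hornerM => <-; rewrite (le_trans (cabsD _ _))// !cabsM.
  have := uM _ z1; have := vN _ z1.
  have := cabs_ge0 p.[z]; have := cabs_ge0 q.[z].
  have := cabs_ge0 u.[z]; have := cabs_ge0 v.[z].
  by move: (cabs _) (cabs _) (cabs _) (cabs _) => a b s t; nra.
rewrite -div1r ler_pdivrMr ?mulr_gt0 ?exprn_gt0 ?addr_gt0// /norm2 -!sqr_cabs.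
have : 1 <= ((M + N) * (cabs p.[z] + cabs q.[z])) ^+ 2 by rewrite exprn_ege1.
have := sqr_ge0 ((M + N) * (cabs p.[z] - cabs q.[z])).
by move: (cabs _) (cabs _) (M + N) => a b K; nra.
Qed.

(** The squared radius 4 leaves room for the images of the unit sphere under the matrices considered
    later. One constant bounds both the values and the increments, which makes the class stable
    under products. *)
Definition lipschitz_on_ball (g : C -> C -> C) : Prop :=
  exists2 M : R, 0 <= M & forall x y, norm2 x y <= 4 ->
    cabs (g x y) <= M /\
    forall x' y', norm2 x' y' <= 4 ->
      cabs (g x y - g x' y') <= M * (cabs (x - x') + cabs (y - y')).

Lemma lipschitz_cst c : lipschitz_on_ball (fun _ _ => c).
Proof.
exists (cabs c); first exact: cabs_ge0.
move=> x y _; split=> // x' y' _; rewrite subrr {1}/cabs abs20 sqrtr0.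
by rewrite mulr_ge0 ?addr_ge0 ?cabs_ge0.
Qed.

Lemma lipschitzD g h : lipschitz_on_ball g -> lipschitz_on_ball h ->
  lipschitz_on_ball (fun x y => g x y + h x y).
Proof.
move=> [M M0 gM] [N N0 hN]; exists (M + N); first exact: addr_ge0.
move=> x y xy; have [g1 g2] := gM x y xy; have [h1 h2] := hN x y xy.
split; first by rewrite (le_trans (cabsD _ _))// lerD.
move=> x' y' xy'; rewrite opprD addrACA (le_trans (cabsD _ _))// mulrDl lerD//.
  exact: g2.
exact: h2.
Qed.

Lemma lipschitzM g h : lipschitz_on_ball g -> lipschitz_on_ball h ->
  lipschitz_on_ball (fun x y => g x y * h x y).
Proof.
move=> [M M0 gM] [N N0 hN]; exists (2 * (M * N) + M * N).
  by rewrite addr_ge0 ?mulr_ge0.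
move=> x y xy; have [g1 g2] := gM x y xy; have [h1 h2] := hN x y xy.
split.
  rewrite cabsM (le_trans (ler_pM (cabs_ge0 _) (cabs_ge0 _) g1 h1))//.
  by rewrite lerDr ?mulr_ge0.
move=> x' y' xy'; have [g1' _] := gM x' y' xy'.
have {}g2 := g2 _ _ xy'; have {}h2 := h2 _ _ xy'.
rewrite (_ : _ - _ = (g x y - g x' y') * h x y + g x' y' * (h x y - h x' y')); last by ring.
rewrite (le_trans (cabsD _ _))// !cabsM.
have A := ler_pM (cabs_ge0 _) (cabs_ge0 _) g2 h1.
have B := ler_pM (cabs_ge0 _) (cabs_ge0 _) g1' h2.
have := addr_ge0 (cabs_ge0 (x - x')) (cabs_ge0 (y - y')).
have := mulr_ge0 M0 N0.
by move: A B; move: (_ + _) => t; move: (cabs _) (cabs _) (cabs _) (cabs _) => *; nra.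
Qed.

Lemma cabs_le2 (x y : C) : norm2 x y <= 4 -> cabs x <= 2 /\ cabs y <= 2.
Proof.
have two : (2 : R) = Num.sqrt 4.
  by rewrite (_ : 4 = 2 ^+ 2); [rewrite sqrtr_sqr ger0_norm|ring].
move=> xy; rewrite two /cabs; split; apply: ler_wsqrtr; apply: le_trans xy.
  by rewrite lerDl abs2_ge0.
by rewrite lerDr abs2_ge0.
Qed.

Lemma lipschitz_fst : lipschitz_on_ball (fun x _ => x).
Proof.
exists 2 => // x y /cabs_le2[x2 y2]; split=> // x' y' _.
have := cabs_ge0 (x - x'); have := cabs_ge0 (y - y'); lra.
Qed.

Lemma lipschitz_snd : lipschitz_on_ball (fun _ y => y).
Proof.
exists 2 => // x y /cabs_le2[x2 y2]; split=> // x' y' _.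
have := cabs_ge0 (x - x'); have := cabs_ge0 (y - y'); lra.
Qed.

Lemma lipschitzX g n : lipschitz_on_ball g -> lipschitz_on_ball (fun x y => g x y ^+ n).
Proof.
move=> lg; elim: n => [|n IH]; first exact: (lipschitz_cst 1).
by under eq_fun => x do under eq_fun => y do rewrite exprS; exact: lipschitzM.
Qed.

Lemma lipschitz_sum I (r : seq I) (g : I -> C -> C -> C) :
  (forall i, lipschitz_on_ball (g i)) ->
  lipschitz_on_ball (fun x y => \sum_(i <- r) g i x y).
Proof.
move=> lg; elim: r => [|i r IH].
  by under eq_fun => x do under eq_fun => y do rewrite big_nil; exact: lipschitz_cst.
by under eq_fun => x do under eq_fun => y do rewrite big_cons; exact: lipschitzD.
Qed.

Lemma lipschitz_eval2 d (G : form) : is_form d G ->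
  lipschitz_on_ball (fun x y => eval2 x y G).
Proof.
move=> fG; under eq_fun => x do under eq_fun => y do rewrite (eval2_form _ _ fG).
apply: lipschitz_sum => k; apply: lipschitzM; last exact: lipschitzX lipschitz_snd.
by apply: lipschitzM; [exact: lipschitz_cst|exact: lipschitzX lipschitz_fst].
Qed.

End form_bounds.

Section lift_bounds.
Context {R : realType}.
Local Notation C := R[i].
Local Notation P1 := (riemann_sphere R).
Variables (d : nat) (F : 'I_2 -> mpoly 2 C) (f : P1 -> P1).
Hypothesis d_gt0 : (0 < d)%N.
Hypothesis liftF : homogeneous_lift d F f.

Definition lift_norm2 (x y : C) : R :=
  norm2 (eval2 x y (F ord0)) (eval2 x y (F ord_max)).

Lemma lift_norm2Z k x y : lift_norm2 (k * x) (k * y) = abs2 k ^+ d * lift_norm2 x y.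
Proof.
by rewrite /lift_norm2 !(eval2_scale _ _ _ (lift_form liftF _)) norm2Z abs2X.
Qed.

Lemma lift_norm2_gt0 x y : (x != 0) || (y != 0) -> 0 < lift_norm2 x y.
Proof. by move=> xy; rewrite norm2_gt0; exact: lift_neq0 liftF _ _ xy. Qed.

(** By homogeneity the larger coordinate is scaled to 1, and the preceding bound applies in one of
    the two charts. The loss 2^d comes from comparing |x|^2 + |y|^2 with the larger of its two
    terms. *)
Lemma lift_norm2_ge : exists2 c : R, 0 < c &
  forall x y, c * norm2 x y ^+ d <= lift_norm2 x y.
Proof.
pose p i := affine_part (F i).
pose q i := \poly_(k < d.+1) (p i)`_(d - k).
have pE i z : eval2 z 1 (F i) = (p i).[z] by exact: eval2_affine (lift_form liftF i).
have qE i z : eval2 1 z (F i) = (q i).[z].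
  rewrite (eval2_form _ _ (lift_form liftF i)) horner_poly (reindex_inj rev_ord_inj)/=.
  apply: eq_bigr => k _; rewrite expr1n mulr1 subSS subKn//; exact: ltn_ord k.
have [|a a0 pa] := @coprime_bounded_below R (p ord0) (p ord_max).
  by move=> z; rewrite -!pE; apply: (lift_neq0 liftF); rewrite oner_eq0 orbT.
have [|b b0 qb] := @coprime_bounded_below R (q ord0) (q ord_max).
  by move=> z; rewrite -!qE; apply: (lift_neq0 liftF); rewrite oner_eq0.
pose c := Num.min a b.
have c0 : 0 < c by rewrite lt_min a0.
(* Here s and t stand for the smaller and the larger of |x|^2 and |y|^2, and m for the value of
   [lift_norm2] in the chart. *)
have half (s t m : R) : 0 <= s -> s <= t -> c <= m ->
    c / 2 ^+ d * (s + t) ^+ d <= t ^+ d * m.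
  move=> s0 st cm; have t0 : 0 <= t by exact: le_trans st.
  apply: (@le_trans _ _ (c / 2 ^+ d * (2 * t) ^+ d)).
    rewrite ler_pM2l ?divr_gt0 ?exprn_gt0//.
    by apply: lerXn2r; rewrite ?nnegrE ?addr_ge0 ?mulr_ge0//; lra.
  by rewrite exprMn mulrA divfK ?expf_neq0// mulrC ler_wpM2l ?exprn_ge0.
have ratio (u v : C) : abs2 u <= abs2 v -> v != 0 -> cabs (u / v) <= 1.
  move=> uv v0; rewrite -[leRHS]sqrtr1 ler_wsqrtr// abs2M abs2V.
  by rewrite ler_pdivrMr ?mul1r// abs2_gt0.
exists (c / 2 ^+ d); first by rewrite divr_gt0 ?exprn_gt0.
move=> x y; have [xy|/ltW yx] := leP (abs2 x) (abs2 y).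
  have [y0|y0] := eqVneq y 0.
    move: xy; rewrite y0 abs20 => x0.
    rewrite (_ : norm2 x 0 = 0) ?expr0n ?gtn_eqF// ?mulr0 ?norm2_ge0//.
    by apply/eqP; rewrite /norm2 abs20 addr0 eq_le x0 abs2_ge0.
  have -> : lift_norm2 x y = abs2 y ^+ d * lift_norm2 (x / y) 1.
    by rewrite -lift_norm2Z mulr1 mulrCA mulfV// mulr1.
  apply: half => //; first exact: abs2_ge0.
  by rewrite /lift_norm2 !pE (le_trans _ (pa _ (ratio _ _ xy y0)))// ge_min lexx.
have [x0|x0] := eqVneq x 0.
  move: yx; rewrite x0 abs20 => y0.
  rewrite (_ : norm2 0 y = 0) ?expr0n ?gtn_eqF// ?mulr0 ?norm2_ge0//.
  by apply/eqP; rewrite /norm2 abs20 add0r eq_le y0 abs2_ge0.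
have -> : lift_norm2 x y = abs2 x ^+ d * lift_norm2 1 (y / x).
  by rewrite -lift_norm2Z mulr1 mulrCA mulfV// mulr1.
rewrite [norm2 x y]addrC; apply: half => //; first exact: abs2_ge0.
by rewrite /lift_norm2 !qE (le_trans _ (qb _ (ratio _ _ yx x0)))// ge_min lexx orbT.
Qed.

Lemma lift_norm2_le : exists2 M : R, 0 < M &
  forall x y, norm2 x y <= 4 -> lift_norm2 x y <= M.
Proof.
have [M M0 FM] := lipschitz_eval2 (lift_form liftF ord0).
have [N N0 FN] := lipschitz_eval2 (lift_form liftF ord_max).
exists (1 + (M ^+ 2 + N ^+ 2)); first by rewrite ltr_pwDl// addr_ge0 ?sqr_ge0.
move=> x y xy; have [a _] := FM _ _ xy; have [b _] := FN _ _ xy.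
rewrite /lift_norm2 /norm2 -!sqr_cabs.
have := cabs_ge0 (eval2 x y (F ord0)); have := cabs_ge0 (eval2 x y (F ord_max)).
nra.
Qed.

Lemma lift_norm2_lipschitz : exists2 L : R, 0 < L &
  forall x y x' y', norm2 x y <= 4 -> norm2 x' y' <= 4 ->
  norm2 (eval2 x y (F ord0) - eval2 x' y' (F ord0))
        (eval2 x y (F ord_max) - eval2 x' y' (F ord_max)) <= L * norm2 (x - x') (y - y').
Proof.
have [M M0 FM] := lipschitz_eval2 (lift_form liftF ord0).
have [N N0 FN] := lipschitz_eval2 (lift_form liftF ord_max).
exists (1 + 2 * (M ^+ 2 + N ^+ 2)).
  by rewrite ltr_pwDl// mulr_ge0// addr_ge0 ?sqr_ge0.
move=> x y x' y' xy xy'.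
have [_ /(_ _ _ xy')] := FM _ _ xy; have [_ /(_ _ _ xy')] := FN _ _ xy.
rewrite /norm2 -!sqr_cabs.
have b0 := cabs_ge0 (eval2 x y (F ord_max) - eval2 x' y' (F ord_max)).
have a0 := cabs_ge0 (eval2 x y (F ord0) - eval2 x' y' (F ord0)).
have s0 := cabs_ge0 (x - x'); have t0 := cabs_ge0 (y - y').
set a := cabs (eval2 x y (F ord0) - _) in a0 *.
set b := cabs (eval2 x y (F ord_max) - _) in b0 *.
set s := cabs (x - x') in s0 *; set t := cabs (y - y') in t0 *.
move=> B A.
have A2 : a ^+ 2 <= (M * (s + t)) ^+ 2 by apply: lerXn2r => //; exact: le_trans A.
have B2 : b ^+ 2 <= (N * (s + t)) ^+ 2 by apply: lerXn2r => //; exact: le_trans B.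
have S2 : (s + t) ^+ 2 <= 2 * (s ^+ 2 + t ^+ 2) by have := sqr_ge0 (s - t); nra.
rewrite (le_trans (lerD A2 B2))// !exprMn -mulrDl.
rewrite (le_trans (ler_wpM2l (addr_ge0 (sqr_ge0 M) (sqr_ge0 N)) S2))//.
have := sqr_ge0 s; have := sqr_ge0 t; lra.
Qed.

End lift_bounds.

(** * Product formula and double integral of the log distance *)

Section neg_log.
Context {R : realType}.
Local Notation C := R[i].
Local Open Scope ereal_scope.

(** The value +oo at 0 makes it turn products into sums without exception, since -oo never
    occurs. *)
Definition neg_log (w : C) : \bar R :=
  if w == 0%R then +oo else (- ln (abs2 w))%:E.

Lemma neg_logM u v : neg_log (u * v)%R = neg_log u + neg_log v.
Proof.
rewrite /neg_log mulf_eq0; case: eqP => [_|/eqP u0] /=; case: eqP => [_|/eqP v0] //=.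
by rewrite abs2M lnM ?posrE ?abs2_gt0// opprD EFinD.
Qed.

Lemma neg_log1 : neg_log 1%R = 0.
Proof. by rewrite /neg_log oner_eq0 abs21 ln1 oppr0. Qed.

Lemma neg_log_prod I (r : seq I) (w : I -> C) :
  neg_log (\prod_(i <- r) w i)%R = \sum_(i <- r) neg_log (w i).
Proof. exact: (big_morph _ neg_logM neg_log1). Qed.

Lemma log_distanceE x y a b : (x != 0)%R || (y != 0)%R -> (a != 0)%R || (b != 0)%R ->
  log_distance x y a b =
    (ln (norm2 x y) + ln (norm2 a b))%:E + neg_log (x * b - y * a)%R.
Proof.
rewrite -!norm2_gt0 => xy ab; rewrite /log_distance /neg_log; case: eqP => // /eqP w0.
rewrite -EFinD; congr _%:E.
by rewrite ln_div ?posrE ?mulr_gt0 ?abs2_gt0// lnM ?posrE.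
Qed.

End neg_log.

Lemma bounded_integrable d (T : measurableType d) (R : realType)
    (P : probability T R) (D : set T) (g : T -> R) (M : R) :
  measurable D -> measurable_fun D g -> (forall x, D x -> `|g x| <= M) ->
  P.-integrable D (EFin \o g).
Proof.
move=> mD mg gM; apply: measurable_bounded_integrable => //.
- by rewrite (le_lt_trans (probability_le1 P mD))// ltry.
- exists M; split; first exact: num_real.
  by move=> x Mx q Dq /=; rewrite (le_trans (gM _ Dq)) ?ltW.
Qed.

Lemma ln_abs_le (R : realType) (a x : R) : 1 <= a -> a^-1 <= x <= a -> `|ln x| <= ln a.
Proof.
move=> a1 /andP[ax xa]; have a0 : 0 < a by rewrite (lt_le_trans ltr01).
have x0 : 0 < x by rewrite (lt_le_trans _ ax)// invr_gt0.
by rewrite ler_norml -lnV ?posrE// !ler_ln ?posrE ?invr_gt0// ax.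
Qed.

Section energy.
Context {R : realType} (sigma : probability 'rV[R]_4 R).
Hypothesis sigma_rot : rotation_invariant_on_sphere sigma.
Local Notation C := R[i].
Local Notation P1 := (riemann_sphere R).
Local Notation S3 := (@unit_sphere R 4).
Variables (d : nat) (F : 'I_2 -> mpoly 2 C) (f : P1 -> P1) (r : nat -> P1 -> P1).
Hypothesis d_gt0 : (0 < d)%N.
Hypothesis liftF : homogeneous_lift d F f.
Hypothesis mr : forall n, measurable_fun setT (r n).
Hypothesis fiber_r : forall Q, exists2 c : C, c != 0 &
    fiber_form F Q = c *: \prod_(P <- [seq r i Q | i <- iota 0 d]) lin_form P.

Let mS3 : measurable S3. Proof. exact: measurable_unit_sphere. Qed.

Let S3_neq0 q : S3 q -> (z1 q != 0) || (z2 q != 0).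
Proof. by move=> q1; rewrite -norm2_gt0 /norm2 -sqnorm4E q1. Qed.

Section one_matrix.
(* The matrix [[a, b], [c, e]], of determinant 1. *)
Variables (a b c e : C).
Hypothesis det1 : a * e - b * c = 1.
Hypothesis quasi_isometry : forall x y, norm2 x y / 4 <= norm2 (a * x + b * y) (c * x + e * y) <=
  4 * norm2 x y.

Definition image_log_norm (q : 'rV[R]_4) : R :=
  ln (lift_norm2 F (a * z1 q + b * z2 q) (c * z1 q + e * z2 q)).

(** For the matrix h with entries a, b, c, e this is |h^-1 P|^2 / |P|^2; its logarithm is the
    function J. *)
Definition inverse_distortion (P : P1) : R :=
  norm2 (e * h0 P - b * h1 P) (a * h1 P - c * h0 P) / norm2 (h0 P) (h1 P).

Lemma matrix_neq0 x y : (x != 0) || (y != 0) ->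
  (a * x + b * y != 0) || (c * x + e * y != 0).
Proof.
rewrite -!norm2_gt0 => xy; have /andP[+ _] := quasi_isometry x y.
by apply: lt_le_trans; rewrite divr_gt0.
Qed.

Lemma inverse_distortion_bounds P : 4^-1 <= inverse_distortion P <= 4.
Proof.
have P0 : 0 < norm2 (h0 P) (h1 P) by rewrite norm2_gt0 h_neq0.
have := quasi_isometry (e * h0 P - b * h1 P) (a * h1 P - c * h0 P).
rewrite (_ : a * _ + b * _ = (a * e - b * c) * h0 P); last by ring.
rewrite (_ : c * _ + e * _ = (a * e - b * c) * h1 P); last by ring.
rewrite det1 !mul1r /inverse_distortion => /andP[A B].
by apply/andP; split; [rewrite ler_pdivlMr//|rewrite ler_pdivrMr//]; lra.
Qed.

Let inverse_neq0 P : (e * h0 P - b * h1 P != 0) || (a * h1 P - c * h0 P != 0).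
Proof.
have P0 : 0 < norm2 (h0 P) (h1 P) by rewrite norm2_gt0 h_neq0.
rewrite -norm2_gt0; have /andP[+ _] := inverse_distortion_bounds P.
rewrite ler_pdivlMr// => /(lt_le_trans _); apply.
by rewrite mulr_gt0// invr_gt0.
Qed.

Lemma measurable_inverse_distortion d' (T : measurableType d') (g : T -> P1) :
  measurable_fun setT g -> measurable_fun setT (fun t => ln (inverse_distortion (g t))).
Proof.
move=> mg; apply: (@measurableT_comp _ _ _ _ _ _ (fun P => ln (inverse_distortion P))) => //.
have mh : cmeas (fun p : R * R => h0 (finite_point p)).
  by under eq_fun do rewrite h0E; apply: cmeas_cplx; exact: measurable_id.
have mk : cmeas (fun p : R * R => h1 (finite_point p)).
  by under eq_fun do rewrite h1E; exact: cmeas_cst.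
apply: measurable_P1; rewrite -[X in measurable_fun _ X]/(fun p => ln (inverse_distortion (finite_point p))).
apply: measurableT_comp => //.
have m2 (u v : R * R -> C) : cmeas u -> cmeas v ->
    measurable_fun setT (fun p => norm2 (u p) (v p)).
  by move=> mu mv; apply: measurable_funD; exact: measurable_abs2.
rewrite -[X in measurable_fun _ X]/(fun p => inverse_distortion (finite_point p)).
apply: measurable_funM.
  by apply: m2; apply: cmeasB; apply: cmeasM => //; exact: cmeas_cst.
by apply: measurable_invr_nneg => [t|]; [exact: norm2_ge0|exact: m2].
Qed.

Lemma image_log_norm_bounded : exists M, forall q, S3 q -> `|image_log_norm q| <= M.
Proof.
have [k k0 kF] := lift_norm2_ge d_gt0 liftF.
have [M M0 FM] := lift_norm2_le liftF.
pose K := Num.max (Num.max 1 M) (4 ^+ d / k).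
exists (ln K) => q Sq; apply: ln_abs_le; first by rewrite !le_max lexx.
have q1 : norm2 (z1 q) (z2 q) = 1 by rewrite /norm2 -sqnorm4E.
have /andP[] := quasi_isometry (z1 q) (z2 q); rewrite q1 mulr1 mul1r => A B.
apply/andP; split; last by rewrite (le_trans (FM _ _ B))// !le_max lexx orbT.
apply: le_trans (kF _ _).
apply: (@le_trans _ _ (k / 4 ^+ d)).
  rewrite -[leRHS]invrK invf_div lef_pV2 ?posrE ?divr_gt0 ?exprn_gt0//.
    by rewrite le_max lexx orbT.
  by rewrite !lt_max ltr01.
by rewrite ler_pM2l// -exprVn; apply: lerXn2r; rewrite ?nnegrE ?norm2_ge0.
Qed.

Lemma cmeas_image0 : cmeas (fun q : 'rV[R]_4 => a * z1 q + b * z2 q).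
Proof.
by apply: cmeasD; apply: cmeasM;
  [exact: cmeas_cst|exact: cmeas_z1|exact: cmeas_cst|exact: cmeas_z2].
Qed.

Lemma cmeas_image1 : cmeas (fun q : 'rV[R]_4 => c * z1 q + e * z2 q).
Proof.
by apply: cmeasD; apply: cmeasM;
  [exact: cmeas_cst|exact: cmeas_z1|exact: cmeas_cst|exact: cmeas_z2].
Qed.

Lemma cmeas_lift_image i :
  cmeas (fun q : 'rV[R]_4 => eval2 (a * z1 q + b * z2 q) (c * z1 q + e * z2 q) (F i)).
Proof. exact: cmeas_eval2 (lift_form liftF i) cmeas_image0 cmeas_image1. Qed.

Lemma measurable_image_log_norm : measurable_fun setT image_log_norm.
Proof.
apply: measurableT_comp => //; apply: measurable_funD;
  by apply: measurable_abs2; exact: cmeas_lift_image.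
Qed.

Lemma integrable_image_log_norm : sigma.-integrable S3 (EFin \o image_log_norm).
Proof.
have [M LM] := image_log_norm_bounded; apply: bounded_integrable LM => //.
exact: measurable_funTS measurable_image_log_norm.
Qed.

Local Open Scope ereal_scope.

Let U (q q' : 'rV[R]_4) : \bar R :=
  log_distance (eval2 (a * z1 q + b * z2 q) (c * z1 q + e * z2 q) (F ord0))%R
    (eval2 (a * z1 q + b * z2 q) (c * z1 q + e * z2 q) (F ord_max))%R (z1 q') (z2 q').

Let mU : measurable_fun setT (fun p : 'rV[R]_4 * 'rV[R]_4 => U p.1 p.2).
Proof.
apply: measurable_log_distance.
- exact: (cmeas_comp measurable_fst (cmeas_lift_image ord0)).
- exact: (cmeas_comp measurable_fst (cmeas_lift_image ord_max)).
- exact: (cmeas_comp measurable_snd cmeas_z1).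
- exact: (cmeas_comp measurable_snd cmeas_z2).
Qed.

Let U0 q q' : 0 <= U q q'. Proof. exact: log_distance_ge0. Qed.

Let mUl : measurable_fun setT (fun q => \int[sigma]_q' U q q').
Proof. exact: measurable_tonelli_l. Qed.

Let mUr : measurable_fun setT (fun q' => \int[sigma]_q U q q').
Proof.
apply: (@measurable_tonelli_l _ _ _ _ _ sigma (fun q' q => U q q')) => //.
exact: (measurableT_comp mU (measurable_fun_pair measurable_snd measurable_fst)).
Qed.

Let double_integral_U : \int[sigma]_q' \int[sigma]_q U q q' = mean_log_distance sigma.
Proof.
rewrite -tonelli_swap//.
transitivity (\int[sigma]_q cst (mean_log_distance sigma) q).
  apply: (eq_integral_sphereT sigma_rot mUl _ (measurable_cst _)) => [q|q|q Sq].
  - exact: integral_ge0.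
  - exact: mean_log_distance_ge0.
  - by apply: (integral_log_distance sigma_rot); exact: lift_neq0 liftF _ _ (matrix_neq0 (S3_neq0 Sq)).
rewrite (integral_cst sigma measurableT) [X in _ * X](_ : _ = 1) ?mule1//.
exact: probability_setT.
Qed.

Let L := Rintegral sigma S3 image_log_norm.
Let C0 := fine (mean_log_distance sigma).

Let C0E : mean_log_distance sigma = C0%:E.
Proof.
by rewrite fineK// ge0_fin_numE ?mean_log_distance_ge0// mean_log_distance_lty.
Qed.

Variable k : P1 -> C.
Hypothesis k0 : forall Q, k Q != 0%R.
Hypothesis kE : forall Q,
  fiber_form F Q = k Q *: (\prod_(P <- [seq r i Q | i <- iota 0 d]) lin_form P)%R.

(** The integral of [U] in its first variable, once the product formula over the fibre of Q is
    expanded. The constant [C0] occurs once for each of the d factors. *)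
Definition fiber_energy (Q : P1) : R :=
  (L + (ln (norm2 (h0 Q) (h1 Q)) - ln (abs2 (k Q)) -
   \sum_(i < d) ln (norm2 (e * h0 (r i Q) - b * h1 (r i Q))
                          (a * h1 (r i Q) - c * h0 (r i Q)))) + d%:R * C0)%R.

Let UE q q' : S3 q -> S3 q' -> let Q := hopf q' in
  U q q' = (image_log_norm q + (ln (norm2 (h0 Q) (h1 Q)) - ln (abs2 (k Q)) -
   \sum_(i < d) ln (norm2 (e * h0 (r i Q) - b * h1 (r i Q))
                          (a * h1 (r i Q) - c * h0 (r i Q)))))%:E +
   \sum_(i < d) log_distance (e * h0 (r i Q) - b * h1 (r i Q))%R
                             (a * h1 (r i Q) - c * h0 (r i Q))%R (z1 q) (z2 q).
Proof.
move=> Sq Sq' Q.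
set x := (a * z1 q + b * z2 q)%R; set y := (c * z1 q + e * z2 q)%R.
have Fxy := lift_neq0 liftF (matrix_neq0 (S3_neq0 Sq)).
have [t t0 [q1 q2]] : exists2 t : C, t != 0%R &
    z1 q' = (t * h0 Q)%R /\ z2 q' = (t * h1 Q)%R := homog_scale (S3_neq0 Sq').
have -> : U q q' = log_distance (eval2 x y (F ord0)) (eval2 x y (F ord_max)) (h0 Q) (h1 Q).
  rewrite /U log_distanceC q1 q2 -/x -/y.
  by rewrite log_distanceZ// log_distanceC.
rewrite log_distanceE ?h_neq0//.
have -> : (eval2 x y (F ord0) * h1 Q - eval2 x y (F ord_max) * h0 Q =
    eval2 x y (fiber_form F Q))%R.
  by rewrite (eval2_fiber F); ring.
rewrite kE eval2Z eval2_prod neg_logM neg_log_prod big_map.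
rewrite (_ : iota 0 d = index_iota 0 d) ?big_mkord; last by rewrite /index_iota subn0.
have q11 : norm2 (z1 q) (z2 q) = 1%R by rewrite /norm2 -sqnorm4E.
(* As h has determinant 1, the wedge product of h v with P is that of v with h^-1 P. Each factor
   thus becomes a log distance from v to a fixed point. *)
have term (i : 'I_d) : log_distance (e * h0 (r i Q) - b * h1 (r i Q))%R
    (a * h1 (r i Q) - c * h0 (r i Q))%R (z1 q) (z2 q) =
  (ln (norm2 (e * h0 (r i Q) - b * h1 (r i Q)) (a * h1 (r i Q) - c * h0 (r i Q))))%:E +
  neg_log (eval2 x y (lin_form (r i Q))).
  rewrite log_distanceC log_distanceE ?inverse_neq0 ?S3_neq0// q11 ln1 add0r.
  by congr (_ + neg_log _); rewrite eval2_lin /x /y; ring.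
rewrite (eq_bigr _ (fun i _ => term i)) big_split/= sumEFin.
rewrite [neg_log (k Q)]/neg_log (negbTE (k0 Q)) !addeA -!EFinD; congr (_%:E + _).
by rewrite -/(lift_norm2 F x y) -/(image_log_norm q); ring.
Qed.

Let mean_U q' : S3 q' -> \int[sigma]_q U q q' = (fiber_energy (hopf q'))%:E.
Proof.
move=> Sq'; set Q := hopf q'.
have mUq : measurable_fun setT (U ^~ q') by exact: (measurableT_comp mU (measurable_pair2 q')).
rewrite -(ge0_integral_sphereT sigma_rot)//.
pose g i (q : 'rV[R]_4) := log_distance (e * h0 (r i Q) - b * h1 (r i Q))%R
    (a * h1 (r i Q) - c * h0 (r i Q))%R (z1 q) (z2 q).
have mg i : measurable_fun setT (g i).
  by apply: measurable_log_distance;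
    [exact: cmeas_cst|exact: cmeas_cst|exact: cmeas_z1|exact: cmeas_z2].
have g0 i q : 0 <= g i q by exact: log_distance_ge0.
have mgS i : measurable_fun S3 (g i) by exact: measurable_funTS.
have Ig i : \int[sigma]_(q in S3) g i q = C0%:E.
  rewrite (ge0_integral_sphereT sigma_rot (mg i) (g0 i)) -C0E.
  by apply: (integral_log_distance sigma_rot); exact: inverse_neq0.
pose kq := (ln (norm2 (h0 Q) (h1 Q)) - ln (abs2 (k Q)) -
   \sum_(i < d) ln (norm2 (e * h0 (r i Q) - b * h1 (r i Q))
                          (a * h1 (r i Q) - c * h0 (r i Q))))%R.
rewrite (@eq_integral _ _ _ _ _ (fun q => (image_log_norm q + kq)%:E +
    \sum_(i < d) g i q)); last by move=> q; rewrite inE => Sq; exact: UE.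
have Ik : sigma.-integrable S3 (EFin \o cst kq).
  by apply: (@bounded_integrable _ _ _ _ _ _ `|kq|%R).
have Igi i : sigma.-integrable S3 (g i).
  apply/integrableP; split=> //.
  rewrite (@eq_integral _ _ _ _ _ (g i)) ?Ig ?ltry// => q _.
  by rewrite gee0_abs.
have ILk : sigma.-integrable S3 (fun q => (image_log_norm q + kq)%:E).
  under eq_fun do rewrite EFinD.
  by apply: integrableD => //; exact: integrable_image_log_norm.
rewrite integralD//; last exact: integrable_sum.
under eq_integral do rewrite EFinD.
rewrite integralD//; last exact: integrable_image_log_norm.
rewrite integral_cst// ge0_integral_sum//.
rewrite (eq_bigr (fun=> C0%:E)); last by move=> i _; exact: Ig.
rewrite [X in _ + _ * X + _](_ : _ = 1); last exact: sigma_rot.1.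
rewrite mule1 sumEFin sumr_const card_ord /fiber_energy -/Q -/kq.
have LE : \int[sigma]_(x in S3) (image_log_norm x)%:E = L%:E.
  by rewrite /L /Rintegral fineK//; exact: (integrable_fin_num mS3 integrable_image_log_norm).
by rewrite LE -!EFinD mulr_natl.
Qed.

Lemma integral_fiber_energy :
  sigma.-integrable S3 (EFin \o (fiber_energy \o hopf)) /\
  Rintegral sigma S3 (fiber_energy \o hopf) = C0.
Proof.
have E q : S3 q -> (fiber_energy (hopf q))%:E = \int[sigma]_q' U q' q.
  by move=> Sq; rewrite mean_U.
have pos q : 0 <= \int[sigma]_q' U q' q by exact: integral_ge0.
have I : \int[sigma]_(q in S3) (fiber_energy (hopf q))%:E = C0%:E.
  rewrite (@eq_integral _ _ _ _ _ (fun q => \int[sigma]_q' U q' q)); last first.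
    by move=> q; rewrite inE; exact: E.
  by rewrite (ge0_integral_sphereT sigma_rot)// double_integral_U.
split; last by rewrite /Rintegral I.
(* The constants [k Q] are chosen pointwise, so measurability is not read from the formula: on the
   sphere the function coincides with an inner integral of [U], measurable by Tonelli. *)
apply/integrableP; split.
  by apply: eq_measurable_fun (measurable_funTS mUr) => q; rewrite inE => Sq /=; rewrite E.
rewrite (@eq_integral _ _ _ _ _ (fun q => (fiber_energy (hopf q))%:E)) ?I ?ltry//.
by move=> q; rewrite inE => Sq; rewrite -[LHS]/(`|(fiber_energy (hopf q))%:E|) gee0_abs// E.
Qed.

End one_matrix.

Theorem image_log_norm_diff (a b c e : C) : a * e - b * c = 1 ->
  (forall x y, norm2 x y / 4 <= norm2 (a * x + b * y) (c * x + e * y) <= 4 * norm2 x y) ->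
  Rintegral sigma S3 (image_log_norm a b c e) =
  Rintegral sigma S3 (image_log_norm 1 0 0 1) +
  \sum_(i < d) Rintegral sigma S3 (fun q => ln (inverse_distortion a b c e (r i (hopf q)))).
Proof.
move=> det1 qi.
have det11 : (1 * 1 - 0 * 0 = 1 :> C) by rewrite mulr1 mulr0 subr0.
have qi1 (x y : C) : norm2 x y / 4 <= norm2 (1 * x + 0 * y) (0 * x + 1 * y) <= 4 * norm2 x y.
  by rewrite !mul1r !mul0r addr0 add0r; have := norm2_ge0 x y; lra.
(* The same k is used for the given matrix and for the identity, so that its logarithm cancels when
   the two fibre energies are subtracted. *)
have [k kP] := choice (fun Q => let: ex_intro2 c' c0 cE := fiber_r Q in
  ex_intro (fun c => c != 0 /\ fiber_form F Q = c *: _) c' (conj c0 cE)).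
have k0 Q := (kP Q).1; have kE Q := (kP Q).2.
have [I E] := integral_fiber_energy det1 qi k0 kE.
have [I1 E1] := integral_fiber_energy det11 qi1 k0 kE.
pose J i q := ln (inverse_distortion a b c e (r i (hopf q))).
have IJ i : sigma.-integrable S3 (EFin \o J i).
  apply: (@bounded_integrable _ _ _ _ _ _ (ln 4)) => //.
    apply: measurable_funTS; apply: measurable_inverse_distortion.
    exact: measurableT_comp (mr i) measurable_hopf.
  move=> q _; apply: ln_abs_le; first lra.
  exact: inverse_distortion_bounds.
have := E; rewrite -E1 => /eqP; rewrite -subr_eq0 -RintegralB// => /eqP.
pose A := Rintegral sigma S3 (image_log_norm a b c e).
pose A1 := Rintegral sigma S3 (image_log_norm 1 0 0 1).
rewrite (@eq_Rintegral _ _ _ _ _ (fun q => (A - A1) - \sum_(i < d) J i q)); last first.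
  move=> q _ /=; rewrite /fiber_energy -/A -/A1.
  rewrite (_ : forall s t s' t' u v : R, s + (u - t) + v - (s' + (u - t') + v) = s - s' - (t - t')); last first.
    by move=> *; ring.
  congr (_ - _); rewrite -sumrB; apply: eq_bigr => i _.
  set P := r i (hopf q).
  have P0 : 0 < norm2 (h0 P) (h1 P) by rewrite norm2_gt0 h_neq0.
  have D := inverse_distortion_bounds det1 qi P.
  have N0 : 0 < norm2 (e * h0 P - b * h1 P) (a * h1 P - c * h0 P).
    have /andP[+ _] := D; rewrite /inverse_distortion ler_pdivlMr// => /(lt_le_trans _); apply.
    by rewrite mulr_gt0// invr_gt0.
  rewrite /J /inverse_distortion ln_div ?posrE// -/P.
  by rewrite !mul1r !mul0r !subr0.
have IS : sigma.-integrable S3 (EFin \o (fun q => \sum_(i < d) J i q)).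
  rewrite (_ : EFin \o _ = fun q => (\sum_(i < d) (J i q)%:E)%E); last first.
    by apply/funext => q /=; rewrite sumEFin.
  by apply: (integrable_sum mS3) => i _; exact: IJ.
have IC : sigma.-integrable S3 (EFin \o cst (A - A1)).
  by apply: (@bounded_integrable _ _ _ _ _ _ `|A - A1|).
rewrite RintegralB// Rintegral_cst// [X in _ * fine X](_ : _ = 1%E); last exact: sigma_rot.1.
rewrite mulr1 => /eqP; rewrite subr_eq0 subr_eq => /eqP AE; rewrite -/A -/A1 AE addrC; congr (_ + _).
have -> : Rintegral sigma S3 (fun q => \sum_(i < d) J i q) =
    fine (\int[sigma]_(q in S3) \sum_(i < d) (J i q)%:E)%E.
  by congr fine; apply: eq_integral => q _; rewrite sumEFin.
rewrite integral_sum//; last by move=> i; exact: IJ.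
rewrite (eq_bigr (fun i : 'I_d => (Rintegral sigma S3 (J i))%:E)) ?sumEFin// => i _.
by rewrite /Rintegral fineK//; exact: (integrable_fin_num mS3 (IJ i)).
Qed.

End energy.

Lemma integrable_EFinD d (T : measurableType d) (R : realType)
    (mu : {measure set T -> \bar R}) (D : set T) (g h : T -> R) : measurable D ->
  mu.-integrable D (EFin \o g) -> mu.-integrable D (EFin \o h) ->
  mu.-integrable D (EFin \o (fun x => g x + h x)).
Proof. by move=> mD ig ih; have := integrableD mD ig ih. Qed.

Lemma integrable_EFinZ d (T : measurableType d) (R : realType)
    (mu : {measure set T -> \bar R}) (D : set T) (k : R) (g : T -> R) : measurable D ->
  mu.-integrable D (EFin \o g) -> mu.-integrable D (EFin \o (fun x => k * g x)).
Proof. by move=> mD; exact: integrableZl. Qed.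

(** * Positive hermitian matrices attached to points of the ball *)

Section ball_matrices.
Context {R : realType}.
Local Notation C := R[i].

Definition dot3 (x y : 'rV[R]_3) : R :=
  x ord0 ord0 * y ord0 ord0 + x ord0 1 * y ord0 1 + x ord0 ord_max * y ord0 ord_max.

Lemma dot3_sqr_le x y : dot3 x y ^+ 2 <= sqnorm x * sqnorm y.
Proof.
rewrite !sqnorm3 /dot3.
move: (x ord0 ord0) (x ord0 1) (x ord0 ord_max) (y ord0 ord0) (y ord0 1) (y ord0 ord_max).
move=> a b c a' b' c'.
have := sqr_ge0 (a * b' - b * a'); have := sqr_ge0 (a * c' - c * a').
have := sqr_ge0 (b * c' - c * b'); lra.
Qed.

Lemma dot3B x y z : dot3 x (y - z) = dot3 x y - dot3 x z.
Proof. by rewrite /dot3 !mxE; ring. Qed.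

Lemma dot3N x y : dot3 (- x) y = - dot3 x y.
Proof. by rewrite /dot3 !mxE; ring. Qed.

Lemma dot30 y : dot3 0 y = 0.
Proof. by rewrite /dot3 !mxE !mul0r !addr0. Qed.

Lemma sqnormN n (x : 'rV[R]_n) : sqnorm (- x) = sqnorm x.
Proof. by apply: eq_bigr => i _; rewrite mxE sqrrN. Qed.

Lemma sqnorm_ge0 n (x : 'rV[R]_n) : 0 <= sqnorm x.
Proof. by apply: sumr_ge0 => i _; exact: sqr_ge0. Qed.

Lemma sqnorm00 n : sqnorm (0 : 'rV[R]_n) = 0.
Proof. by rewrite /sqnorm big1// => i _; rewrite mxE expr0n. Qed.

Definition ball_scale (x : 'rV[R]_3) : R := (Num.sqrt (1 - sqnorm x))^-1.

Lemma ball_scale_sqr x : sqnorm x < 1 -> ball_scale x ^+ 2 = (1 - sqnorm x)^-1.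
Proof. by move=> x1; rewrite exprVn sqr_sqrtr// subr_ge0 ltW. Qed.

Lemma ball_scale_neq0 x : sqnorm x < 1 -> ball_scale x != 0.
Proof. by move=> x1; rewrite invr_neq0// gt_eqF// sqrtr_gt0 subr_gt0. Qed.

Definition entry_a (x : 'rV[R]_3) : C := (1 + x ord0 ord_max)%:C.
Definition entry_b (x : 'rV[R]_3) : C := x ord0 ord0 +i* x ord0 1.
Definition entry_c (x : 'rV[R]_3) : C := x ord0 ord0 -i* x ord0 1.
Definition entry_e (x : 'rV[R]_3) : C := (1 - x ord0 ord_max)%:C.

(** The chordal distance in homogeneous coordinates: for unit vectors it is 2 minus twice the scalar
    product, and [E] below expresses that product through the wedge. *)
Lemma sqnorm_zvecB (w w' s s' : C) : (w != 0) || (w' != 0) -> (s != 0) || (s' != 0) ->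
  sqnorm (zvec w w' - zvec s s') =
  4 * abs2 (w * s' - w' * s) / (norm2 w w' * norm2 s s').
Proof.
move=> w0 s0; have W := sqnorm_zvec w0; have S := sqnorm_zvec s0.
transitivity (2 - 2 * dot3 (zvec w w') (zvec s s')).
  move: (zvec w w') (zvec s s') W S => u v U V.
  have -> : sqnorm (u - v) = sqnorm u + sqnorm v - 2 * dot3 u v.
    by rewrite !sqnorm3 /dot3 !mxE; ring.
  by rewrite U V.
have := abs2D_gt0 w0; have := abs2D_gt0 s0; rewrite -/(norm2 w w') -/(norm2 s s').
rewrite /dot3 /zvec !row3_0 !row3_1 !row3_2 -/(norm2 w w') -/(norm2 s s') => m0 n0.
have E : norm2 w w' * norm2 s s' = 2 * abs2 (w * s' - w' * s) +
   (2 * complex.Re (w * w'^*) * (2 * complex.Re (s * s'^*)) +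
    2 * complex.Im (w * w'^*) * (2 * complex.Im (s * s'^*)) +
    (abs2 w - abs2 w') * (abs2 s - abs2 s')).
  case: w w' s s' {w0 s0 W S m0 n0} => [w1 w2] [v1 v2] [s1 s2] [t1 t2].
  by rewrite /norm2 /abs2 /=; ring.
have nm0 : norm2 w w' * norm2 s s' != 0 by rewrite mulf_neq0// gt_eqF.
rewrite [RHS](_ : _ = 2 * (2 * abs2 (w * s' - w' * s)) / (norm2 w w' * norm2 s s')); last by ring.
rewrite (_ : 2 * abs2 _ = norm2 w w' * norm2 s s' -
   (2 * complex.Re (w * w'^*) * (2 * complex.Re (s * s'^*)) +
    2 * complex.Im (w * w'^*) * (2 * complex.Im (s * s'^*)) +
    (abs2 w - abs2 w') * (abs2 s - abs2 s'))); last by rewrite E addrK.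
move: (norm2 w w') (norm2 s s') (abs2 w - _) (abs2 s - _) m0 n0 {E nm0} => n m u v m0 n0.
by field; rewrite !gt_eqF.
Qed.

Lemma norm2_entries x (u v : C) : (u != 0) || (v != 0) ->
  norm2 (entry_a x * u + entry_b x * v) (entry_c x * u + entry_e x * v) =
  norm2 u v * (1 + sqnorm x + 2 * dot3 x (zvec u v)).
Proof.
move=> uv; have n0 := abs2D_gt0 uv; rewrite /dot3 !row3_0 !row3_1 !row3_2 sqnorm3.
rewrite /norm2 in n0 *; set n := abs2 u + abs2 v in n0 *.
have nn : n != 0 by rewrite gt_eqF.
transitivity (n * (1 + (x ord0 ord0 ^+ 2 + x ord0 1 ^+ 2 + x ord0 ord_max ^+ 2)) +
  2 * (x ord0 ord0 * (2 * complex.Re (u * v^*)) + x ord0 1 * (2 * complex.Im (u * v^*)) +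
  x ord0 ord_max * (abs2 u - abs2 v))); last by field.
rewrite /n /entry_a /entry_b /entry_c /entry_e; case: u v {uv n0 n nn} => [u u'] [v v'].
by rewrite /abs2 /=; ring.
Qed.

(** The identity plus a hermitian trace-free matrix X with X^2 = |x|^2, normalized to determinant 1.
    It carries the origin of the ball to x, and its inverse is attached to -x. *)
Definition ball_rep (x : 'rV[R]_3) : 'M[C]_2 := \matrix_(i, j)
  ((ball_scale x)%:C * (if i == ord0 then if j == ord0 then entry_a x else entry_b x
                        else if j == ord0 then entry_c x else entry_e x)).

Lemma det2 (g : 'M[C]_2) : \det g =
  g ord0 ord0 * g ord_max ord_max - g ord0 ord_max * g ord_max ord0.
Proof.
rewrite (expand_det_row _ ord0) !big_ord_recl big_ord0 /cofactor !det_mx11 !mxE/=.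
rewrite !addr0 expr0 expr1 mul1r mulN1r mulrN; congr (_ * g _ _ - g _ _ * g _ _); exact/val_inj.
Qed.

Lemma mulmx_col2 (g : 'M[C]_2) x y : g *m col2 x y =
  col2 (g ord0 ord0 * x + g ord0 ord_max * y) (g ord_max ord0 * x + g ord_max ord_max * y).
Proof.
have l : lift ord0 ord0 = ord_max :> 'I_2 by exact/val_inj.
apply/matrixP => i j; rewrite !mxE !big_ord_recl big_ord0 l !mxE/= addr0.
by case: i => [[|[|//]] ?]; rewrite /=; congr (g _ _ * _ + g _ _ * _); exact/val_inj.
Qed.

Lemma SL2_unitmx (g : 'M[C]_2) : SL2 g -> g \in unitmx.
Proof. by move=> g1; rewrite unitmxE g1 unitr1. Qed.

Lemma invmx_SL2 (g : 'M[C]_2) x y : SL2 g -> invmx g *m col2 x y =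
  col2 (g ord_max ord_max * x - g ord0 ord_max * y) (g ord0 ord0 * y - g ord_max ord0 * x).
Proof.
move=> g1; have gU := SL2_unitmx g1.
rewrite -[RHS]mul1mx -(mulVmx gU) -mulmxA; congr (_ *m _).
move: g1; rewrite /SL2/= det2 mulmx_col2 => g1.
by congr col2; rewrite -[LHS]mul1r -g1; ring.
Qed.

Lemma ball_repE x : [/\ ball_rep x ord0 ord0 = (ball_scale x)%:C * entry_a x,
  ball_rep x ord0 ord_max = (ball_scale x)%:C * entry_b x,
  ball_rep x ord_max ord0 = (ball_scale x)%:C * entry_c x &
  ball_rep x ord_max ord_max = (ball_scale x)%:C * entry_e x].
Proof. by split; rewrite mxE. Qed.

Lemma SL2_ball_rep x : sqnorm x < 1 -> SL2 (ball_rep x).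
Proof.
move=> x1; rewrite /SL2/= det2; have [-> -> -> ->] := ball_repE x.
transitivity (((ball_scale x) ^+ 2 * (1 - sqnorm x))%:C).
  rewrite sqnorm3 /entry_a /entry_b /entry_c /entry_e.
  by apply/eqP; rewrite eq_complex /=; apply/andP; split; apply/eqP; ring.
by rewrite ball_scale_sqr// mulVf// gt_eqF// subr_gt0.
Qed.

Lemma ball_rep0 : ball_rep 0 = 1%:M.
Proof.
apply/matrixP => i j; rewrite !mxE /ball_scale sqnorm00 subr0 sqrtr1 invr1 mul1r.
rewrite /entry_a /entry_b /entry_c /entry_e !mxE addr0 subr0 oppr0.
by case: i j => [[|[|//]] ?] [[|[|//]] ?].
Qed.

(** Both bounds come from ln s <= s - 1, applied to the argument of the logarithm for the upper one
    and to its inverse for the lower one. *)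
Lemma log_expansion (r2 t : R) : 0 <= r2 -> r2 <= 1 / 16 -> t ^+ 2 <= r2 ->
  `|ln ((1 + r2 - 2 * t) / (1 - r2)) + 2 * t| <= 8 * r2.
Proof.
move=> r0 r16 tr.
have t4 : `|t| <= 1 / 4.
  by rewrite -(@ler_pXn2r _ 2)// ?nnegrE// real_normK ?num_real//; nra.
move: t4; rewrite ler_norml => /andP[t1 t2].
have N0 : 0 < 1 + r2 - 2 * t by lra.
have D0 : 0 < 1 - r2 by lra.
have T0 : 0 < (1 + r2 - 2 * t) / (1 - r2) by rewrite divr_gt0.
have lnle (s : R) : 0 < s -> ln s <= s - 1.
  move=> s0; have := @le_ln1Dx R (s - 1); rewrite addrCA subrr addr0; apply.
  by rewrite ltrBrDl subrr.
rewrite ler_norml; apply/andP; split.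
  have /lnle := T0; rewrite -invr_gt0 in T0; have := lnle _ T0.
  rewrite lnV ?posrE ?divr_gt0// => H _.
  suff : ((1 + r2 - 2 * t) / (1 - r2))^-1 - 1 <= 8 * r2 + 2 * t by lra.
  rewrite invf_div lerBlDr ler_pdivrMr//.
  nra.
rewrite (le_trans (lerD (lnle _ T0) (lexx _)))//.
suff : (1 + r2 - 2 * t) / (1 - r2) <= 8 * r2 - 2 * t + 1 by lra.
by rewrite ler_pdivrMr//; nra.
Qed.

End ball_matrices.

Lemma doubled_difference (R : realType) (p p0 t s a : R) :
  2 * p = a + s -> 2 * p0 = a -> 2 * (p - p0 + t) = s + 2 * t.
Proof. lra. Qed.

(** * Expansion of the energy at the origin *)

Section energy_expansion.
Context {R : realType} (sigma : probability 'rV[R]_4 R).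
Hypothesis sigma_rot : rotation_invariant_on_sphere sigma.
Local Notation C := R[i].
Local Notation P1 := (riemann_sphere R).
Local Notation S3 := (@unit_sphere R 4).
Variables (d : nat) (F : 'I_2 -> mpoly 2 C) (f : P1 -> P1).
Hypothesis d_gt0 : (0 < d)%N.
Hypothesis liftF : homogeneous_lift d F f.

Let mS3 : measurable S3. Proof. exact: measurable_unit_sphere. Qed.

Lemma Rintegral_sphereT (g : 'rV[R]_4 -> R) : sigma.-integrable setT (EFin \o g) ->
  Rintegral sigma setT g = Rintegral sigma S3 g.
Proof.
move=> Ig; congr fine; rewrite (@negligible_integral _ _ _ sigma setT (~` S3))//.
- by rewrite setTD setCK.
- exact: measurableC.
- exact: sigma_sphereC.
Qed.

Lemma Rintegral_sphere_bound (g : 'rV[R]_4 -> R) (M : R) : measurable_fun S3 g ->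
  (forall q, S3 q -> `|g q| <= M) -> `|Rintegral sigma S3 g| <= M.
Proof.
move=> mg gM; have Ig := bounded_integrable sigma mS3 mg gM.
have IN : sigma.-integrable S3 (EFin \o (fun q => `|g q|)).
  apply: (bounded_integrable sigma mS3 (M := M)) => [|q Sq]; last by rewrite normr_id gM.
  exact: measurableT_comp mg.
have IM : sigma.-integrable S3 (EFin \o cst M).
  by apply: (bounded_integrable sigma mS3 (M := `|M|)).
rewrite (le_trans (le_normr_Rintegral mS3 Ig))// (le_trans (le_Rintegral mS3 IN IM gM))//.
rewrite Rintegral_cst// [X in _ * fine X](_ : _ = 1%E); last exact: sigma_rot.1.
by rewrite mulr1.
Qed.

Lemma lift_of_homog (u v : C) : (u != 0) || (v != 0) -> f (of_homog_coord (col2 u v)) =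
  of_homog_coord (col2 (eval2 u v (F ord0)) (eval2 u v (F ord_max))).
Proof.
move=> uv; have [k k0 [ku kv]] := homog_scale uv.
set P := of_homog_coord _ in ku kv *; rewrite (liftE liftF) ku kv.
rewrite !(eval2_scale _ _ _ (lift_form liftF _)) ![k ^+ d * _]mulrC of_homog_scale//.
by rewrite expf_neq0.
Qed.

Let a (x : 'rV[R]_3) := ball_rep x ord0 ord0.
Let b (x : 'rV[R]_3) := ball_rep x ord0 ord_max.
Let c (x : 'rV[R]_3) := ball_rep x ord_max ord0.
Let e (x : 'rV[R]_3) := ball_rep x ord_max ord_max.

Let det1 (x : 'rV[R]_3) : sqnorm x < 1 -> a x * e x - b x * c x = 1.
Proof. by move=> x1; rewrite -det2; exact: SL2_ball_rep. Qed.

Let norm2_rep (x : 'rV[R]_3) (u v : C) : sqnorm x < 1 -> (u != 0) || (v != 0) ->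
  norm2 (a x * u + b x * v) (c x * u + e x * v) =
  norm2 u v * ((1 + sqnorm x + 2 * dot3 x (zvec u v)) / (1 - sqnorm x)).
Proof.
move=> x1 uv; rewrite /a /b /c /e; have [-> -> -> ->] := ball_repE x.
rewrite -!mulrA -!mulrDr norm2Z norm2_entries//.
rewrite /abs2/= expr0n addr0 ball_scale_sqr//; ring.
Qed.

Let dot_bound (x : 'rV[R]_3) (u v : C) : (u != 0) || (v != 0) -> dot3 x (zvec u v) ^+ 2 <= sqnorm x.
Proof.
by move=> uv; rewrite (le_trans (dot3_sqr_le _ _))// sqnorm_zvec ?mulr1.
Qed.

(** The threshold 1/16 forces |x| <= 1/4 and hence scalar products with unit vectors of at most 1/4
    in absolute value, which leaves the distortion well between 1/4 and 4. *)
Let quasi_isometry (x : 'rV[R]_3) : sqnorm x <= 1 / 16 -> forall u v,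
  norm2 u v / 4 <= norm2 (a x * u + b x * v) (c x * u + e x * v) <= 4 * norm2 u v.
Proof.
move=> x16 u v; have r0 := sqnorm_ge0 x.
have [uv|] := boolP ((u != 0) || (v != 0)); last first.
  rewrite negb_or !negbK => /andP[/eqP -> /eqP ->].
  by rewrite !mulr0 addr0 /norm2 abs20 addr0 mul0r mulr0 lexx.
have n0 : 0 < norm2 u v by rewrite norm2_gt0.
rewrite norm2_rep//; last by lra.
have D := dot_bound x uv; set t := dot3 _ _ in D *.
have t1 : -1 / 4 <= t by nra.
have t2 : t <= 1 / 4 by nra.
rewrite ler_pM2l// [4 * _]mulrC ler_pM2l// ler_pdivlMr ?ler_pdivrMr; lra.
Qed.

(** The inverse of [ball_rep x] is [ball_rep (- x)], so this is [norm2_rep] at -x. *)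
Let distortionE (x : 'rV[R]_3) P : sqnorm x < 1 -> inverse_distortion (a x) (b x) (c x) (e x) P =
  (1 + sqnorm x - 2 * dot3 x (zeta P)) / (1 - sqnorm x).
Proof.
move=> x1; rewrite /inverse_distortion.
have P0 : 0 < norm2 (h0 P) (h1 P) by rewrite norm2_gt0 h_neq0.
have xN : sqnorm (- x) < 1 by rewrite sqnormN.
have := norm2_rep xN (h_neq0 P); rewrite sqnormN dot3N mulrN -/(zeta P).
have -> : a (- x) * h0 P + b (- x) * h1 P = e x * h0 P - b x * h1 P.
  rewrite /a /b /e; have [-> -> _ _] := ball_repE (- x); have [_ -> _ ->] := ball_repE x.
  rewrite /ball_scale sqnormN /entry_a /entry_b /entry_e !mxE.
  by case: (h0 P) (h1 P) => [p p'] [s s']; apply/eqP; rewrite eq_complex /=;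
     apply/andP; split; apply/eqP; ring.
have -> : c (- x) * h0 P + e (- x) * h1 P = a x * h1 P - c x * h0 P.
  rewrite /a /c /e; have [_ _ -> ->] := ball_repE (- x); have [-> _ -> _] := ball_repE x.
  rewrite /ball_scale sqnormN /entry_a /entry_c /entry_e !mxE.
  by case: (h0 P) (h1 P) => [p p'] [s s']; apply/eqP; rewrite eq_complex /=;
     apply/andP; split; apply/eqP; ring.
by move=> ->; rewrite mulrAC divff ?mul1r// gt_eqF.
Qed.

Let image_point (x : 'rV[R]_3) (q : 'rV[R]_4) : P1 :=
  of_homog_coord (col2 (eval2 (a x * z1 q + b x * z2 q) (c x * z1 q + e x * z2 q) (F ord0))
                       (eval2 (a x * z1 q + b x * z2 q) (c x * z1 q + e x * z2 q) (F ord_max))).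

Let measurable_image_point x : measurable_fun setT (image_point x).
Proof. by apply: measurable_of_homog; exact: (cmeas_lift_image liftF). Qed.

Let S3_neq0 q : S3 q -> (z1 q != 0) || (z2 q != 0).
Proof. by move=> q1; rewrite -norm2_gt0 /norm2 -sqnorm4E q1. Qed.

(** With P the point below F(h v), |h^-1 F(h v)|^2 is |F(h v)|^2 times the inverse distortion at P.
    The factor 1/2 passes from the norm to its square. *)
Let log_norm_conj (x : 'rV[R]_3) q : sqnorm x <= 1 / 16 -> S3 q ->
  ln (hermitian_norm (conj_lift (ball_rep x) (poly_map F) (to_C2 q))) =
  2^-1 * (image_log_norm F (a x) (b x) (c x) (e x) q +
          ln (inverse_distortion (a x) (b x) (c x) (e x) (image_point x q))).
Proof.
move=> x16 Sq; have x1 : sqnorm x < 1 by lra.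
rewrite /conj_lift to_C2E mulmx_col2 (poly_mapE F) col20 col21.
rewrite invmx_SL2; last exact: SL2_ball_rep.
rewrite -/(a x) -/(b x) -/(c x) -/(e x).
set u := a x * z1 q + b x * z2 q; set v := c x * z1 q + e x * z2 q.
have uv : (u != 0) || (v != 0) by exact: (matrix_neq0 (quasi_isometry x16) (S3_neq0 Sq)).
have Fuv := lift_neq0 liftF uv.
have [k k0 [Fu Fv]] := homog_scale Fuv.
set P := of_homog_coord _ in Fu Fv.
have PE : image_point x q = P by [].
have P0 : 0 < norm2 (h0 P) (h1 P) by rewrite norm2_gt0 h_neq0.
have /andP[D1 _] := inverse_distortion_bounds (det1 x1) (quasi_isometry x16) P.
have D0 : 0 < inverse_distortion (a x) (b x) (c x) (e x) P.
  by rewrite (lt_le_trans _ D1)// invr_gt0.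
have L0 := lift_norm2_gt0 liftF uv.
have LD0 := mulr_gt0 L0 D0.
rewrite PE /image_log_norm -/u -/v -lnM ?posrE// -ln_powR powR12_sqrt ?(ltW LD0)//.
congr (ln (Num.sqrt _)); rewrite !big_ord_recl big_ord0 addr0.
rewrite (_ : lift ord0 ord0 = ord_max); last exact/val_inj.
rewrite col20 col21 /lift_norm2 Fu Fv norm2Z /inverse_distortion.
rewrite -[LHS]/(norm2 _ _) !(mulrCA _ k) -!mulrBr norm2Z.
by field; rewrite gt_eqF.
Qed.

Let Phi (x : 'rV[R]_3) := mean_log_norm sigma (conj_lift (ball_rep x) (poly_map F)).

(** Replacing F(h v) by F(v) moves the point of the sphere by O(|x|), because F is Lipschitz near
    the unit sphere and |F|^2 >= k on it. The Cauchy-Schwarz inequality with x supplies the second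
    factor |x|. *)
Let chordal_bound : exists2 K : R, 0 <= K & forall x q, sqnorm x <= 1 / 16 -> S3 q ->
  `|dot3 x (zeta (image_point x q)) - dot3 x (zeta (f (hopf q)))| <= K * sqnorm x.
Proof.
have [k k0 Fk] := lift_norm2_ge d_gt0 liftF.
have [L L0 FL] := lift_norm2_lipschitz liftF.
exists (1 + 4 * (L / k)); first by rewrite addr_ge0 ?mulr_ge0 ?invr_ge0 ?ltW.
move=> x q x16 Sq; have r0 := sqnorm_ge0 x; have x1 : sqnorm x < 1 by lra.
have zq := S3_neq0 Sq.
(* The normalizing factor of [ball_rep] is dropped: it does not change the point of P^1(C), and
   without it h v - v has norm exactly |x|. *)
set u := entry_a x * z1 q + entry_b x * z2 q.
set v := entry_c x * z1 q + entry_e x * z2 q.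
have q1 : norm2 (z1 q) (z2 q) = 1 by rewrite /norm2 -sqnorm4E.
have nuv : norm2 u v = 1 + sqnorm x + 2 * dot3 x (zvec (z1 q) (z2 q)).
  by rewrite norm2_entries// q1 mul1r.
have D := dot_bound x zq; set t := dot3 _ _ in D nuv.
have t1 : -1 / 4 <= t by nra.
have t2 : t <= 1 / 4 by nra.
have uv : (u != 0) || (v != 0) by rewrite -norm2_gt0 nuv; lra.
have Fuv := lift_neq0 liftF uv; have Fq := lift_neq0 liftF zq.
have -> : zeta (image_point x q) = zvec (eval2 u v (F ord0)) (eval2 u v (F ord_max)).
  rewrite /image_point /a /b /c /e; have [-> -> -> ->] := ball_repE x.
  rewrite -!mulrA -!mulrDr -/u -/v zeta_of_homog; last first.
    apply: (lift_neq0 liftF); rewrite !mulf_eq0 !negb_or.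
    by rewrite eq_complex /= eqxx andbT ball_scale_neq0.
  rewrite !(eval2_scale _ _ _ (lift_form liftF _)) zvec_scale// expf_neq0//.
  by rewrite eq_complex /= eqxx andbT ball_scale_neq0.
have -> : zeta (f (hopf q)) = zvec (eval2 (z1 q) (z2 q) (F ord0)) (eval2 (z1 q) (z2 q) (F ord_max)).
  by rewrite /hopf to_C2E lift_of_homog// zeta_of_homog.
rewrite -dot3B.
set w := eval2 u v (F ord0) in Fuv *; set w' := eval2 u v (F ord_max) in Fuv *.
set s := eval2 _ _ (F ord0) in Fq *; set s' := eval2 _ _ (F ord_max) in Fq *.
have E := sqnorm_zvecB Fuv Fq.
have W : abs2 (w * s' - w' * s) <= norm2 w w' * norm2 (w - s) (w' - s').
  (* Subtracting (w, w') from (s, s') leaves the wedge product unchanged up to sign and lets the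
     Lipschitz bound enter. *)
  rewrite (_ : w * s' - w' * s = - (w * (w' - s') - w' * (w - s))); last by ring.
  by rewrite abs2N abs2_wedge_le.
have Ls : norm2 (w - s) (w' - s') <= L * sqnorm x.
  (* h v - v = X v for the hermitian matrix X of square |x|^2, and v has norm 1. *)
  have -> : sqnorm x = norm2 (u - z1 q) (v - z2 q).
    rewrite -[LHS]mulr1 -q1 sqnorm3 /u /v /entry_a /entry_b /entry_c /entry_e.
    case: (z1 q) => y y'; case: (z2 q) => o o'; rewrite /norm2 /abs2 /=; ring.
  apply: FL; first by rewrite nuv; lra.
  by rewrite q1; lra.
have ks : k <= norm2 s s' by have := Fk (z1 q) (z2 q); rewrite q1 expr1n mulr1.
have s0 : 0 < norm2 s s' by exact: lt_le_trans ks.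
have w0 : 0 < norm2 w w' by rewrite norm2_gt0.
have Z : sqnorm (zvec w w' - zvec s s') <= 4 * (L / k) * sqnorm x.
  rewrite E ler_pdivrMr ?mulr_gt0//.
  have H1 : abs2 (w * s' - w' * s) <= norm2 w w' * (L * sqnorm x).
    by rewrite (le_trans W)// ler_pM2l.
  have H2 : L * sqnorm x <= L / k * sqnorm x * norm2 s s'.
    rewrite [leRHS](_ : _ = L * sqnorm x * (norm2 s s' / k)); last by ring.
    by rewrite ler_peMr ?mulr_ge0 ?(ltW L0)// ler_pdivlMr ?mul1r.
  have H3 := ler_wpM2l (ltW w0) H2.
  rewrite (_ : 4 * (L / k) * sqnorm x * (norm2 w w' * norm2 s s') =
    4 * (norm2 w w' * (L / k * sqnorm x * norm2 s s'))); last by ring.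
  by rewrite ler_pM2l// (le_trans H1).
have Lk : 0 <= L / k by rewrite divr_ge0 ?ltW.
have K0 : 0 <= (1 + 4 * (L / k)) * sqnorm x by apply: mulr_ge0 => //; rewrite addr_ge0// mulr_ge0.
rewrite -(@ler_pXn2r _ 2)// ?nnegrE//.
rewrite real_normK ?num_real// (le_trans (dot3_sqr_le _ _))//.
rewrite (le_trans (ler_wpM2l r0 Z))//.
rewrite [leLHS](_ : _ = 4 * (L / k) * sqnorm x ^+ 2); last by ring.
rewrite exprMn ler_wpM2r ?sqr_ge0//; nra.
Qed.

Theorem energy_expansion : exists2 K : R, 0 <= K & forall x, sqnorm x <= 1 / 16 ->
  `|Phi x - Phi 0 + dot3 x (first_moment (sphere_transport (omega f)))| <= K * sqnorm x.
Proof.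
have [r mr fiber_r] := measurable_fiber_points d_gt0 liftF.
have [k k0 chordal] := chordal_bound.
(* Half of 8 for each of the d + 1 branches, by [log_expansion], plus half of 2 k for the
   displacement in the last one. *)
exists (4 * d.+1%:R + k); first by rewrite addr_ge0 ?mulr_ge0.
move=> x x16; have r0 := sqnorm_ge0 x; have x1 : sqnorm x < 1 by lra.
(* Same indexing as [branch], except that the last point is that of F(h v) instead of F(v). *)
pose pts y (n : nat) q : P1 := if (n < d)%N then r n (hopf q) else image_point y q.
pose lnJ y n q := ln (inverse_distortion (a y) (b y) (c y) (e y) (pts y n q)).
have mpts y n : measurable_fun setT (pts y n).
  rewrite /pts; case: (n < d)%N => //.
  exact: measurableT_comp (mr n) (@measurable_hopf R).
have mJ y n : measurable_fun S3 (lnJ y n).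
  by apply: measurable_funTS; exact: measurable_inverse_distortion.
have JB y n q : sqnorm y <= 1 / 16 -> `|lnJ y n q| <= ln 4.
  move=> y16; apply: ln_abs_le; first lra.
  by apply: (inverse_distortion_bounds (det1 _) (quasi_isometry y16)); lra.
have IJ y n : sqnorm y <= 1 / 16 -> sigma.-integrable S3 (EFin \o lnJ y n).
  by move=> y16; apply: (bounded_integrable sigma mS3 (mJ y n)) => q _; exact: JB y16.
have a0 : [/\ a 0 = 1, b 0 = 0, c 0 = 0 & e 0 = 1].
  by rewrite /a /b /c /e ball_rep0 !mxE.
pose A := Rintegral sigma S3 (image_log_norm F 1 0 0 1).
have PhiE y : sqnorm y <= 1 / 16 ->
    2 * Phi y = A + \sum_(n < d.+1) Rintegral sigma S3 (lnJ y n).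
  move=> y16; have y1 : sqnorm y < 1 by lra.
  have IL := integrable_image_log_norm sigma d_gt0 liftF (quasi_isometry y16).
  rewrite /Phi /mean_log_norm.
  rewrite (@eq_Rintegral _ _ _ _ _ (fun q => 2^-1 *
     (image_log_norm F (a y) (b y) (c y) (e y) q + lnJ y d q))); last first.
    by move=> q; rewrite inE => Sq; rewrite log_norm_conj// /lnJ /pts ltnn.
  rewrite RintegralZl//; last first.
    by apply: integrable_EFinD => //; exact: IJ.
  rewrite mulrA divff ?mul1r// RintegralD//; last exact: IJ.
  rewrite (image_log_norm_diff sigma_rot d_gt0 liftF mr fiber_r (det1 y1) (quasi_isometry y16)).
  rewrite -addrA big_ord_recr/=; congr (_ + (_ + _)).
  by apply: eq_bigr => n _; rewrite /lnJ /pts ltn_ord.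
have J0 n : Rintegral sigma S3 (lnJ 0 n) = 0.
  rewrite (@eq_Rintegral _ _ _ _ _ (cst 0)) ?Rintegral_cst ?mul0r// => q _.
  by rewrite /lnJ distortionE ?sqnorm00// dot30 mulr0 addr0 subr0 divr1 ln1.
(* At the origin h is the identity and every J vanishes, which identifies the constant term. *)
have Phi0 : 2 * Phi 0 = A by rewrite PhiE ?sqnorm00// big1 ?addr0// => n _; exact: J0.
pose B := branch d f r.
have mB n : measurable_fun setT (B n) by exact: (measurable_branch liftF mr).
have coord (i : 'I_3) (y : 'rV[R]_3) : unit_sphere 3 y -> `|y ord0 i| <= 1.
  move=> y1; rewrite -(@ler_pXn2r _ 2)// ?nnegrE// real_normK ?num_real// expr1n.
  by rewrite -y1 /sqnorm (bigD1 i)//= lerDl sumr_ge0// => j _; exact: sqr_ge0.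
have mBi n i : measurable_fun setT (fun q => B n q ord0 i).
  exact: measurableT_comp (measurable_rV_coord i) (mB n).
have IB n i : sigma.-integrable S3 (EFin \o (fun q => B n q ord0 i)).
  apply: (bounded_integrable sigma mS3 (M := 1)) => [|q _]; first exact: measurable_funTS.
  exact/coord/branch_sphere.
have mE i : first_moment (sphere_transport (omega f)) ord0 i =
    \sum_(n < d.+1) Rintegral sigma S3 (fun q => B n q ord0 i).
  rewrite mxE (integral_transport sigma_rot liftF mr fiber_r
    (@measurable_rV_coord R 3 i) (coord i))/=.
  apply: eq_bigr => n _; rewrite Rintegral_sphereT//.
  apply: (bounded_integrable sigma measurableT (M := 1)) => // q _.
  exact/coord/branch_sphere.
have dotE : dot3 x (first_moment (sphere_transport (omega f))) =
    \sum_(n < d.+1) Rintegral sigma S3 (fun q => dot3 x (B n q)).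
  rewrite /dot3 !mE !mulr_sumr -!big_split/=; apply: eq_bigr => n _.
  have IZ i : sigma.-integrable S3 (EFin \o (fun q => x ord0 i * B n q ord0 i)).
    exact: integrable_EFinZ.
  rewrite RintegralD//; last exact: integrable_EFinD.
  by rewrite RintegralD// !RintegralZl.
have mdot n : measurable_fun S3 (fun q => dot3 x (B n q)).
  apply: measurable_funTS; rewrite /dot3.
  by apply: measurable_funD; [apply: measurable_funD|]; exact: measurable_funM.
have dotB n q : `|dot3 x (B n q)| <= 1.
  rewrite -(@ler_pXn2r _ 2)// ?nnegrE// real_normK ?num_real// expr1n.
  rewrite (le_trans (dot3_sqr_le _ _))// (branch_sphere d f r n q) mulr1; lra.
have Idot n : sigma.-integrable S3 (EFin \o (fun q => 2 * dot3 x (B n q))).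
  apply: (bounded_integrable sigma mS3 (M := 2)) => [|q _]; first exact: measurable_funM.
  by rewrite normrM ger0_norm//; have := dotB n q; lra.
have point n q : S3 q -> `|lnJ x n q + 2 * dot3 x (B n q)| <=
    8 * sqnorm x + (if (n < d)%N then 0 else 2 * k) * sqnorm x.
  move=> Sq; rewrite /lnJ distortionE//.
  have := @log_expansion R (sqnorm x) (dot3 x (zeta (pts x n q))) r0 x16.
  have zs := zeta_sphere (pts x n q).
  move=> /(_ (le_trans (dot3_sqr_le _ _) _)); rewrite zs mulr1 => /(_ (lexx _)).
  rewrite /pts /B /branch; case: ifP => nd H; first by rewrite mul0r addr0.
  set l := ln _ in H *; set t := dot3 x (zeta (image_point x q)) in H *.
  have := chordal x q x16 Sq; rewrite -/t; set t' := dot3 x _ => H'.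
  rewrite (_ : l + 2 * t' = l + 2 * t - 2 * (t - t')); last by ring.
  rewrite (le_trans (ler_normB _ _))// lerD// normrM ger0_norm// -mulrA ler_pM2l//.
have est n : `|Rintegral sigma S3 (lnJ x n) + 2 * Rintegral sigma S3 (fun q => dot3 x (B n q))|
    <= 8 * sqnorm x + (if (n < d)%N then 0 else 2 * k) * sqnorm x.
  rewrite -RintegralZl//; last first.
    by apply: (bounded_integrable sigma mS3 (M := 1)) => [|q _].
  rewrite -RintegralD//; last exact: IJ.
  apply: Rintegral_sphere_bound => [|q]; last exact: point.
  by apply: measurable_funD; [exact: mJ|apply: measurable_funM => //; exact: mdot].
set m := first_moment _ in dotE *.
have sumE : 2 * (Phi x - Phi 0 + dot3 x m) = \sum_(n < d.+1) (Rintegral sigma S3 (lnJ x n) +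
    2 * Rintegral sigma S3 (fun q => dot3 x (B n q))).
  rewrite dotE big_split/= -mulr_sumr.
  have E := @doubled_difference R (Phi x) (Phi 0) (\sum_(n < d.+1) Rintegral sigma S3 (fun q => dot3 x (B n q))) _ A (PhiE x x16) Phi0.
  exact: E.
have sum_le : `|2 * (Phi x - Phi 0 + dot3 x m)| <=
    \sum_(n < d.+1) (8 * sqnorm x + (if (n < d)%N then 0 else 2 * k) * sqnorm x).
  by rewrite sumE (le_trans (ler_norm_sum _ _ _))// ler_sum// => n _; exact: est.
move: sum_le; rewrite big_split/= sumr_const card_ord -mulr_suml big_ord_recr/= ltnn big1; last first.
  by move=> n _; rewrite ltn_ord.
rewrite add0r normrM ger0_norm// => H.
by rewrite -(@ler_pM2l _ 2)// (le_trans H)// le_eqVlt; apply/orP; left; apply/eqP; ring.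
Qed.

End energy_expansion.

(** * Hyperbolic geometry of the ball model *)

Section hyperbolic_geometry.
Context {R : realType}.
Local Notation C := R[i].

Lemma inversionK n (c x : 'rV[R]_n) (r : R) : r != 0 -> sqnorm (x - c) != 0 ->
  inversion c r (inversion c r x) = x.
Proof.
move=> r0 xc0; rewrite /inversion; set k := r ^+ 2 / sqnorm (x - c).
rewrite [c + k *: (x - c) - c]addrAC subrr add0r.
have -> : sqnorm (k *: (x - c)) = k ^+ 2 * sqnorm (x - c).
  by rewrite /sqnorm mulr_sumr; apply: eq_bigr => i _; rewrite mxE exprMn.
rewrite scalerA (_ : _ * k = 1) ?scale1r; last first.
  by rewrite /k; field; rewrite r0 xc0.
by rewrite addrC subrK.
Qed.

Lemma iota_inv_inj (p q : C * R) : 0 < p.2 -> 0 < q.2 ->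
  iota_inv p = iota_inv q -> p = q.
Proof.
have two0 : Num.sqrt 2 != 0 :> R by rewrite gt_eqF// sqrtr_gt0.
(* After reflection the third coordinate is negative, so the point differs from the centre (0, 0, 1)
   of the inversion. *)
have off (u : C * R) : 0 < u.2 -> sqnorm (reflection (row3 (complex.Re u.1) (complex.Im u.1) u.2)
    - row3 0 0 1) != 0.
  move=> u0; rewrite sqnorm3 /reflection !mxE/=.
  have := sqr_ge0 (complex.Re u.1 - 0); have := sqr_ge0 (complex.Im u.1 - 0).
  by move=> A B; rewrite gt_eqF//; nra.
case: p q => [[a b] s] [[a' b'] t] /= s0 t0 E.
have := congr1 (@ball_inversion R) E; rewrite /iota_inv /ball_inversion !inversionK//.
- move=> /(congr1 (@reflection R)); rewrite /reflection => /rowP H.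
  have := H ord0; have := H 1; have := H ord_max; rewrite !mxE/= !opprK.
  by move=> -> -> ->.
- exact: (off (a' +i* b', t)).
- exact: (off (a +i* b, s)).
Qed.

Lemma poincare_extension_j (g : 'M[C]_2) :
  let D := abs2 (g ord_max ord_max) + abs2 (g ord_max ord0) in
  poincare_extension g (0, 1) =
    ((g ord0 ord_max * (g ord_max ord_max)^* + g ord0 ord0 * (g ord_max ord0)^*) / D%:C,
     D^-1).
Proof. by rewrite /poincare_extension !mulr0 !add0r expr1n !mulr1 div1r. Qed.

Lemma bottom_row_gt0 (g : 'M[C]_2) : SL2 g ->
  0 < abs2 (g ord_max ord_max) + abs2 (g ord_max ord0).
Proof.
rewrite /SL2/= det2 => g1; apply: abs2D_gt0; apply/negPn; rewrite negb_or !negbK.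
apply/negP => /andP[/eqP d0 /eqP c0]; move/eqP: g1.
by rewrite d0 c0 !mulr0 subrr eq_sym oner_eq0.
Qed.

Lemma entry_mul2 (g h : 'M[C]_2) i j :
  (g *m h) i j = g i ord0 * h ord0 j + g i ord_max * h ord_max j.
Proof.
have l : lift ord0 ord0 = ord_max :> 'I_2 by exact/val_inj.
by rewrite mxE !big_ord_recl big_ord0 l addr0.
Qed.

Let norm_expand (c d z : C) (t : R) :
  abs2 (c * z + d) + abs2 c * t ^+ 2 =
  abs2 c * (abs2 z + t ^+ 2) + 2 * complex.Re (c * z * d^*) + abs2 d.
Proof. by case: c d z => [c c'] [d d'] [z z']; rewrite /abs2 /=; ring. Qed.

Let numerator_expand (a b c d z : C) (t : R) :
  (a * z + b) * (c * z + d)^* + a * c^* * (t ^+ 2)%:C =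
  a * c^* * (abs2 z + t ^+ 2)%:C + a * d^* * z + b * c^* * z^* + b * d^*.
Proof.
case: a b c d z => [a a'] [b b'] [c c'] [d d'] [z z'].
by apply/eqP; rewrite eq_complex /abs2 /=; apply/andP; split; apply/eqP; ring.
Qed.

Let norm_product (c d p q r s : C) :
  abs2 (c * q + d * s) + abs2 (c * p + d * r) =
  abs2 c * (abs2 p + abs2 q) + 2 * complex.Re (c * (q * s^* + p * r^*) * d^*) +
  abs2 d * (abs2 s + abs2 r).
Proof.
case: c d p q r s => [c c'] [d d'] [p p'] [q q'] [r r'] [s s'].
by rewrite /abs2 /=; ring.
Qed.

Let numerator_product (a b c d p q r s : C) :
  (a * q + b * s) * (c * q + d * s)^* + (a * p + b * r) * (c * p + d * r)^* =
  a * c^* * (abs2 p + abs2 q)%:C + a * d^* * (q * s^* + p * r^*) +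
  b * c^* * (q * s^* + p * r^*)^* + b * d^* * (abs2 s + abs2 r)%:C.
Proof.
case: a b c d p q r s => [a a'] [b b'] [c c'] [d d'] [p p'] [q q'] [r r'] [s s'].
by apply/eqP; rewrite eq_complex /abs2 /=; apply/andP; split; apply/eqP; ring.
Qed.

Let gram_det (p q r s : C) : (abs2 p + abs2 q) * (abs2 s + abs2 r) =
  abs2 (q * s^* + p * r^*) + abs2 (p * s - q * r).
Proof.
case: p q r s => [p p'] [q q'] [r r'] [s s'].
by rewrite /abs2 /=; ring.
Qed.

Let trace_identity (a b c d a' b' c' d' : C) :
  abs2 (d * a' - b * c') + abs2 (d * b' - b * d') +
  abs2 (a * c' - c * a') + abs2 (a * d' - c * b') =
  (abs2 d + abs2 c) * (abs2 a' + abs2 b') -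
  2 * complex.Re ((b * d^* + a * c^*)^* * (b' * d'^* + a' * c'^*)) +
  (abs2 a + abs2 b) * (abs2 d' + abs2 c').
Proof.
case: a b c d a' b' c' d' => [a1 a2] [b1 b2] [c1 c2] [d1 d2] [u1 u2] [v1 v2] [w1 w2] [s1 s2].
by rewrite /abs2 /=; ring.
Qed.

(** Let h . j = (z, 1/k). The product of h with its adjoint has entries k (|z|^2 + k^-2) and k on
    the diagonal and k z above it, because its determinant is 1. Expanded in these entries, the
    numerator and the denominator for g h . j are k times those for g . (h . j). *)
Lemma poincare_extension_mul_j (g h : 'M[C]_2) : SL2 h ->
  poincare_extension (g *m h) (0, 1) = poincare_extension g (poincare_extension h (0, 1)).
Proof.
move=> h1; have k0 := bottom_row_gt0 h1; rewrite !poincare_extension_j !entry_mul2.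
move: h1; rewrite /SL2/= det2.
move: (g ord0 ord0) (g ord0 ord_max) (g ord_max ord0) (g ord_max ord_max) => a b c d.
move: (h ord0 ord0) (h ord0 ord_max) (h ord_max ord0) (h ord_max ord_max) k0 => p q r s k0 h1.
rewrite norm_product numerator_product /poincare_extension.
rewrite norm_expand numerator_expand.
have G := gram_det p q r s; rewrite h1 abs21 in G.
set k := abs2 s + abs2 r in k0 G *; set w := q * s^* + p * r^* in G *.
set z := w / k%:C.
have kk0 : k != 0 by rewrite gt_eqF.
have kC : k%:C != 0 :> C by rewrite eq_complex /= eqxx andbT.
have wz : w = z * k%:C by rewrite /z divfK.
have n : abs2 p + abs2 q = (abs2 z + k^-1 ^+ 2) * k.
  apply: (mulIf kk0); rewrite G wz abs2M {2}/abs2/= expr0n addr0.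
  by field.
rewrite n wz; move: {G n wz} (abs2 z + k^-1 ^+ 2) => m; clearbody z.
set D := abs2 c * m + _ + _; set N := a * c^* * m%:C + _ + _ + _.
have -> : abs2 c * (m * k) + 2 * complex.Re (c * (z * k%:C) * d^*) + abs2 d * k = k * D.
  rewrite /D; case: (c) (d) (z) => [c1 c2] [d1 d2] [u u'] /=; ring.
have -> : a * c^* * (m * k)%:C + a * d^* * (z * k%:C) + b * c^* * (z * k%:C)^* + b * d^* * k%:C =
    k%:C * N.
  rewrite /N; case: (a) (b) (c) (d) (z) => [a1 a2] [b1 b2] [c1 c2] [d1 d2] [u u'].
  by apply/eqP; rewrite eq_complex /=; apply/andP; split; apply/eqP; ring.
congr pair; last by rewrite invfM.
by rewrite rmorphM/= invfM mulrACA divff// mul1r.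
Qed.

Lemma iota_ball_rep (x : 'rV[R]_3) : sqnorm x < 1 ->
  Defs.iota x = poincare_extension (ball_rep x) (0, 1).
Proof.
move=> x1; rewrite poincare_extension_j; have [-> -> -> ->] := ball_repE x.
have s2 := ball_scale_sqr x1; have s0 := ball_scale_neq0 x1.
set s := ball_scale x in s2 s0 *.
have N0 : 0 < x ord0 ord0 ^+ 2 + x ord0 1 ^+ 2 + (x ord0 ord_max - 1) ^+ 2.
  by move: x1; rewrite sqnorm3; nra.
rewrite /Defs.iota /reflection /ball_inversion /inversion sqr_sqrtr// sqnorm3 !mxE/= !subr0 !add0r.
rewrite -fmorphV mul_real_complex /entry_a /entry_b /entry_c /entry_e.
move: x1 s2; rewrite sqnorm3.
move: (x ord0 ord0) (x ord0 1) (x ord0 ord_max) N0 => u v w N0 x1 s2.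
have r0 : 1 - (u ^+ 2 + v ^+ 2 + w ^+ 2) != 0 by rewrite gt_eqF// subr_gt0.
have N00 : u ^+ 2 + v ^+ 2 + (w - 1) ^+ 2 != 0 by rewrite gt_eqF.
have DE : abs2 (s%:C * (1 - w)%:C) + abs2 (s%:C * (u -i* v)) =
    s ^+ 2 * (u ^+ 2 + v ^+ 2 + (w - 1) ^+ 2) by rewrite /abs2 /=; ring.
rewrite DE; congr (_ +i* _, _) => /=.
- by field; rewrite ?s0 ?N00.
- by field; rewrite ?s0 ?N00.
- by rewrite s2; field; rewrite r0.
Qed.

Lemma iota0 : Defs.iota (0 : 'rV[R]_3) = (0, 1).
Proof.
rewrite /Defs.iota /reflection /ball_inversion /inversion sqr_sqrtr// sqnorm3 !mxE/=.
rewrite !subr0 sub0r expr0n sqrrN expr1n /= !add0r !mulr0 divr1 mulrN1.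
by congr (_, _); lra.
Qed.

Lemma ball_action_ball_rep (g : 'M[C]_2) (x : 'rV[R]_3) : sqnorm x < 1 ->
  ball_action g x = ball_action (g *m ball_rep x) 0.
Proof.
move=> x1; rewrite /ball_action iota0 poincare_extension_mul_j; last exact: SL2_ball_rep.
by rewrite iota_ball_rep.
Qed.

(* The stabilizer of [j] in SL_2(C) is SU(2), read off the entries of [g g^*]. *)
Lemma ball_action0_inj (g g' : 'M[C]_2) : SL2 g -> SL2 g' ->
  ball_action g 0 = ball_action g' 0 ->
  exists p q : C, [/\ norm2 p q = 1, SL2 (invmx g *m g') &
    forall u v, invmx g *m g' *m col2 u v = col2 (p * u - q^* * v) (q * u + p^* * v)].
Proof.
move=> g1 g1'; rewrite /ball_action iota0 !poincare_extension_j => /iota_inv_inj/=.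
rewrite !invr_gt0 !bottom_row_gt0// => /(_ isT isT) [] E /(can_inj (@invrK _)) ED.
have k1 : SL2 (invmx g *m g').
  by rewrite /SL2/= det_mulmx det_inv g1 g1' mulr1 invr1.
exists ((invmx g *m g') ord0 ord0), ((invmx g *m g') ord_max ord0).
have D0 := bottom_row_gt0 g1; rewrite ED in E.
have kE u v : invmx g *m g' *m col2 u v =
    col2 ((g ord_max ord_max * g' ord0 ord0 - g ord0 ord_max * g' ord_max ord0) * u +
          (g ord_max ord_max * g' ord0 ord_max - g ord0 ord_max * g' ord_max ord_max) * v)
         ((g ord0 ord0 * g' ord_max ord0 - g ord_max ord0 * g' ord0 ord0) * u +
          (g ord0 ord0 * g' ord_max ord_max - g ord_max ord0 * g' ord0 ord_max) * v).
  rewrite -mulmxA mulmx_col2 invmx_SL2//; congr col2; ring.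
have e0 : (invmx g *m g') ord0 ord0 =
    g ord_max ord_max * g' ord0 ord0 - g ord0 ord_max * g' ord_max ord0.
  have := congr1 (fun w : 'cV[C]_2 => w ord0 ord0) (kE 1 0).
  by rewrite mulmx_col2 !col20 !mulr1 !mulr0 !addr0.
have e1 : (invmx g *m g') ord_max ord0 =
    g ord0 ord0 * g' ord_max ord0 - g ord_max ord0 * g' ord0 ord0.
  have := congr1 (fun w : 'cV[C]_2 => w ord_max ord0) (kE 1 0).
  by rewrite mulmx_col2 !col21 !mulr1 !mulr0 !addr0.
rewrite e0 e1; set D := abs2 (g' ord_max ord_max) + abs2 (g' ord_max ord0) in ED E.
have DC0 : D%:C != 0 :> C by rewrite -ED eq_complex /= eqxx andbT gt_eqF.
move/(mulIf (invr_neq0 DC0)) : E => E.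
have {}g1 : g ord0 ord0 * g ord_max ord_max - g ord0 ord_max * g ord_max ord0 = 1.
  by rewrite -det2.
have {}g1' : g' ord0 ord0 * g' ord_max ord_max - g' ord0 ord_max * g' ord_max ord0 = 1.
  by rewrite -det2.
move: kE E ED g1 g1' {e0 e1 DC0}; rewrite /D {D}; move: D0.
move: (g ord0 ord0) (g ord0 ord_max) (g ord_max ord0) (g ord_max ord_max) => a b c d.
move: (g' ord0 ord0) (g' ord0 ord_max) (g' ord_max ord0) (g' ord_max ord_max) => a' b' c' d'.
move=> D0 kE E ED g1 g1'.
have G := gram_det a b c d; have G' := gram_det a' b' c' d'.
rewrite g1 abs21 E in G; rewrite g1' abs21 -G ED in G'.
(* The products of g and of g' with their adjoints share the lower right entry ([ED]) and the
   off-diagonal entry ([E]), and both have determinant 1; hence the upper left entries agree too. *)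
have AE : abs2 a' + abs2 b' = abs2 a + abs2 b.
  by apply: (@mulIf _ (abs2 d' + abs2 c')); rewrite // -ED gt_eqF.
set k11 := d * a' - b * c'; set k12 := d * b' - b * d'.
set k21 := a * c' - c * a'; set k22 := a * d' - c * b'.
have det_k : k11 * k22 - k12 * k21 = 1.
  rewrite (_ : _ - _ = (a * d - b * c) * (a' * d' - b' * c')); first by rewrite g1 g1' mulr1.
  by rewrite /k11 /k12 /k21 /k22; ring.
have trace : abs2 k11 + abs2 k12 + abs2 k21 + abs2 k22 = 2.
  have -> : abs2 k11 + abs2 k12 + abs2 k21 + abs2 k22 =
      (abs2 d + abs2 c) * (abs2 a' + abs2 b') -
      2 * complex.Re ((b * d^* + a * c^*)^* * (b' * d'^* + a' * c'^*)) +
      (abs2 a + abs2 b) * (abs2 d' + abs2 c').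
    exact: trace_identity.
  rewrite E AE -ED [_^* * _]mulrC mulcJ /=; have := G; lra.
(* The sum of the squared moduli of the entries is at least twice the real part of the determinant.
   Here both are 2, and the equality case characterizes SU(2). *)
have [K1 K2] : k22 = k11^* /\ k12 = - k21^*.
  have : abs2 (k22 - k11^*) + abs2 (k12 + k21^*) = 0.
    have -> : abs2 (k22 - k11^*) + abs2 (k12 + k21^*) =
      abs2 k11 + abs2 k12 + abs2 k21 + abs2 k22 - 2 * complex.Re (k11 * k22 - k12 * k21).
      by move: (k11) (k12) (k21) (k22) => [u1 u2] [v1 v2] [w1 w2] [s1 s2]; rewrite /abs2 /=; ring.
    by rewrite det_k trace /= mulr1 subrr.
  move/eqP; rewrite paddr_eq0 ?abs2_ge0// !abs2_eq0 subr_eq0 addr_eq0.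
  by move=> /andP[/eqP -> /eqP ->].
split=> //.
  have := trace; rewrite K1 K2 abs2N !abs2_conj /norm2; lra.
by move=> u v; rewrite kE -/k11 -/k12 -/k21 -/k22 K1 K2 mulNr.
Qed.

End hyperbolic_geometry.

(** * Conjugation of lifts *)

Section linear_substitution.
Context {R : realType}.
Local Notation C := R[i].
Local Notation form := (mpoly 2 C).

Definition lin2 (a b : C) : form :=
  a *: mpolyX C (mnm1 ord0) + b *: mpolyX C (mnm1 ord_max).

Definition substitution (a b c e : C) (G : form) : form :=
  mmap (@mpolyC 2 C) (pt2 (lin2 a b) (lin2 c e)) G.

Lemma rmorph_mmap (S : comNzRingType) (phi : {rmorphism form -> S}) (x y : form) (G : form) :
  phi (mmap (@mpolyC 2 C) (pt2 x y) G) =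
  mmap (phi \o (@mpolyC 2 C)) (pt2 (phi x) (phi y)) G.
Proof.
rewrite /mmap rmorph_sum; apply: eq_bigr => m _; rewrite rmorphM; congr (_ * _).
by rewrite !mmap1_pt2 rmorphM !rmorphXn.
Qed.

Lemma eval2_lin2 x y a b : eval2 x y (lin2 a b) = a * x + b * y.
Proof. by rewrite /eval2 /lin2 mevalD !mevalZ !mevalXU. Qed.

Lemma is_form_lin2 a b : is_form 1 (lin2 a b).
Proof. by rewrite /is_form /lin2 rpredD// rpredZ// dhomogX; apply/eqP; exact: mdeg1. Qed.

Lemma is_form_exp (G : form) k : is_form 1 G -> is_form k (G ^+ k).
Proof.
move=> fG; elim: k => [|k IH]; first exact: dhomog1.
by rewrite exprS; apply: (dhomogM (d := 1%N)).
Qed.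

Lemma is_form_substitution a b c e d (G : form) : is_form d G ->
  is_form d (substitution a b c e G).
Proof.
move=> fG; rewrite /substitution (@mmap_form _ _ (@mpolyC 2 C : {rmorphism C -> form}) _ _ d G)//.
rewrite /is_form rpred_sum// => k _.
rewrite -mulrA mul_mpolyC rpredZ//.
have kd : (k <= d)%N by rewrite -ltnS ltn_ord.
have : is_form (k + (d - k)) (lin2 a b ^+ k * lin2 c e ^+ (d - k)).
  by apply: dhomogM; apply: is_form_exp; exact: is_form_lin2.
by rewrite subnKC.
Qed.

Lemma eval2_substitution x y a b c e (G : form) :
  eval2 x y (substitution a b c e G) = eval2 (a * x + b * y) (c * x + e * y) G.
Proof.
transitivity (mmap (meval (pt2 x y) \o @mpolyC 2 C)
    (pt2 (eval2 x y (lin2 a b)) (eval2 x y (lin2 c e))) G).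
  exact: (rmorph_mmap (meval (pt2 x y))).
rewrite !eval2_lin2.
by rewrite /eval2 /meval /mmap; apply: eq_bigr => m _; congr (_ * _); exact: mevalC.
Qed.

Lemma substitution_lin2 a b c e u v : substitution a b c e (lin2 u v) =
  lin2 (u * a + v * c) (u * b + v * e).
Proof.
rewrite /substitution /lin2 mmapD !mmapZ !mmapX !mmap1U /pt2/=.
rewrite !mul_mpolyC !scalerDr !scalerA addrACA -!scalerDl; congr (_ *: _ + _ *: _).
Qed.

Lemma substitutionK a b c e (G : form) : a * e - b * c = 1 ->
  substitution e (- b) (- c) a (substitution a b c e G) = G.
Proof.
move=> det1; transitivity (mmap (substitution e (- b) (- c) a \o @mpolyC 2 C)
    (pt2 (substitution e (- b) (- c) a (lin2 a b)) (substitution e (- b) (- c) a (lin2 c e))) G).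
  exact: (rmorph_mmap (mmap (@mpolyC 2 C) _)).
rewrite !substitution_lin2 -[RHS]mmap_mpolyC_id /mmap; apply: eq_bigr => m _.
congr (_ * _); first exact: mmapC.
congr (mmap1 (pt2 _ _) m); rewrite /lin2.
  rewrite (_ : a * e + b * - c = 1); last by rewrite -det1; ring.
  by rewrite (_ : a * - b + b * a = 0) ?scale1r ?scale0r ?addr0//; ring.
rewrite (_ : c * - b + e * a = 1); last by rewrite -det1; ring.
by rewrite (_ : c * e + e * - c = 0) ?scale1r ?scale0r ?add0r//; ring.
Qed.

Lemma substitution_comb a b c e s t (E p q : form) :
  substitution a b c e (E * (s *: p + t *: q)) =
  substitution a b c e E * (s *: substitution a b c e p + t *: substitution a b c e q).
Proof. by rewrite -!mul_mpolyC /substitution !(rmorphM, rmorphD)/= !mmapC. Qed.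

Lemma substitution_unit a b c e (E : form) : E \is a GRing.unit ->
  substitution a b c e E \is a GRing.unit.
Proof. exact: (rmorph_unit (mmap (@mpolyC 2 C) (pt2 (lin2 a b) (lin2 c e)))). Qed.

Lemma solve_forms (a b c e : C) (X Y E p q : form) : a * e - b * c = 1 ->
  e *: X - b *: Y = E * p -> a *: Y - c *: X = E * q ->
  X = E * (a *: p + b *: q) /\ Y = E * (c *: p + e *: q).
Proof.
move=> det1 Ep Eq; rewrite !mulrDr -!scalerAr -Ep -Eq !scalerBr !scalerA; split.
  by rewrite [b * a]mulrC addrA subrK -scalerBl det1 scale1r.
rewrite addrC [c * e]mulrC addrA subrK.
by rewrite -scalerBl [e * a]mulrC [c * b]mulrC det1 scale1r.
Qed.

End linear_substitution.

Section conjugate_lift.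
Context {R : realType}.
Local Notation C := R[i].
Local Notation P1 := (riemann_sphere R).
Local Notation form := (mpoly 2 C).

Lemma of_homog_mulmx (g : 'M[C]_2) (u v : C) : (u != 0) || (v != 0) ->
  mobius g (of_homog_coord (col2 u v)) = of_homog_coord (g *m col2 u v).
Proof.
move=> uv; have [k k0 [ku kv]] := homog_scale uv.
set P := of_homog_coord _ in ku kv *; rewrite /mobius homog_coordE ku kv !mulmx_col2.
rewrite -[LHS](of_homog_scale (g ord0 ord0 * h0 P + g ord0 ord_max * h1 P) _ k0).
by congr (of_homog_coord (col2 _ _)); ring.
Qed.

Lemma SL2_col2_neq0 (g : 'M[C]_2) (u v : C) : SL2 g -> (u != 0) || (v != 0) ->
  (g ord0 ord0 * u + g ord0 ord_max * v != 0) ||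
  (g ord_max ord0 * u + g ord_max ord_max * v != 0).
Proof.
move=> g1; apply: contraLR; rewrite !negb_or !negbK => /andP[/eqP A /eqP B].
have E : invmx g *m (g *m col2 u v) = col2 u v by rewrite mulKmx// SL2_unitmx.
move: E; rewrite mulmx_col2 A B invmx_SL2// !mulr0 subrr => E.
have := congr1 (fun w : 'cV[C]_2 => w ord0 ord0) E.
have := congr1 (fun w : 'cV[C]_2 => w ord_max ord0) E.
by rewrite !col20 !col21 => <- <-; rewrite eqxx.
Qed.

Definition conj_form (g : 'M[C]_2) (F : 'I_2 -> form) (i : 'I_2) : form :=
  let S G := substitution (g ord0 ord0) (g ord0 ord_max) (g ord_max ord0) (g ord_max ord_max) G in
  if i == ord0 then g ord_max ord_max *: S (F ord0) - g ord0 ord_max *: S (F ord_max)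
  else g ord0 ord0 *: S (F ord_max) - g ord_max ord0 *: S (F ord0).

Lemma conj_form0 (g : 'M[C]_2) (F : 'I_2 -> form) :
  let S := substitution (g ord0 ord0) (g ord0 ord_max) (g ord_max ord0) (g ord_max ord_max) in
  conj_form g F ord0 = g ord_max ord_max *: S (F ord0) - g ord0 ord_max *: S (F ord_max).
Proof. by []. Qed.

Lemma conj_form1 (g : 'M[C]_2) (F : 'I_2 -> form) :
  let S := substitution (g ord0 ord0) (g ord0 ord_max) (g ord_max ord0) (g ord_max ord_max) in
  conj_form g F ord_max = g ord0 ord0 *: S (F ord_max) - g ord_max ord0 *: S (F ord0).
Proof. by []. Qed.

Lemma eval2_comb x y (s t : C) (G H : form) :
  eval2 x y (s *: G - t *: H) = s * eval2 x y G - t * eval2 x y H.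
Proof. by rewrite -!eval2Z /eval2 mevalB. Qed.

Lemma poly_map_eval2 (F : 'I_2 -> form) (u v : C) :
  poly_map F (col2 u v) = col2 (eval2 u v (F ord0)) (eval2 u v (F ord_max)).
Proof.
rewrite [LHS]col2_eta !mxE /eval2.
have -> // : (fun j => col2 u v j ord0) = pt2 u v.
by apply/funext => j; rewrite mxE.
Qed.

Lemma poly_map_conj_form (g : 'M[C]_2) (F : 'I_2 -> form) : SL2 g ->
  poly_map (conj_form g F) = conj_lift g (poly_map F).
Proof.
move=> g1; apply/funext => w; rewrite (col2_eta w); move: (w ord0 ord0) (w ord_max ord0) => u v {w}.
rewrite poly_map_eval2 /conj_lift mulmx_col2 poly_map_eval2 invmx_SL2//.
by congr col2; rewrite -2!eval2_substitution; exact: eval2_comb.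
Qed.

Lemma homogeneous_lift_conj d (g : 'M[C]_2) (F : 'I_2 -> form) (f : P1 -> P1) : SL2 g ->
  homogeneous_lift d F f -> homogeneous_lift d (conj_form g F) (conj_self_map g f).
Proof.
move=> g1 liftF; have det1 : g ord0 ord0 * g ord_max ord_max - g ord0 ord_max * g ord_max ord0 = 1.
  by rewrite -det2.
have [_ cop _] := liftF; split.
- move=> i; rewrite /conj_form; case: ifP => _;
    by rewrite rpredB// rpredZ//; apply: is_form_substitution; exact: lift_form liftF _.
(* The inverse substitution T turns a common factor E of the conjugated forms into a common factor T
   E of the components of F. That one is a unit by coprimality, and so is E = S (T E). *)
- move=> E p q; rewrite conj_form0 conj_form1.
  set a := g ord0 ord0 in det1 *; set b := g ord0 ord_max in det1 *.
  set c := g ord_max ord0 in det1 *; set e := g ord_max ord_max in det1 *.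
  pose S := substitution a b c e; pose T := substitution e (- b) (- c) a.
  rewrite -!/(S _) => Ep Eq.
  have ST G : S (T G) = G.
    have det1' : e * a - - b * - c = 1 by rewrite -det1; ring.
    by have := substitutionK G det1'; rewrite !opprK.
  have TS G : T (S G) = G by exact: substitutionK.
  have [X0 X1] := solve_forms det1 Ep Eq.
  have F0E : F ord0 = T E * (a *: T p + b *: T q).
    by rewrite -[LHS]TS X0; exact: substitution_comb.
  have F1E : F ord_max = T E * (c *: T p + e *: T q).
    by rewrite -[LHS]TS X1; exact: substitution_comb.
  by rewrite -(ST E); apply: substitution_unit; exact: cop F0E F1E.
move=> P; rewrite (homog_coordE P) (poly_map_conj_form F g1).
have gP := SL2_col2_neq0 g1 (h_neq0 P).
set u := g ord0 ord0 * _ + _ in gP; set v := g ord_max ord0 * _ + _ in gP.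
have mgP : mobius g P = of_homog_coord (col2 u v) by rewrite /mobius homog_coordE mulmx_col2.
have -> : conj_lift g (poly_map F) (col2 (h0 P) (h1 P)) =
    invmx g *m col2 (eval2 u v (F ord0)) (eval2 u v (F ord_max)).
  by rewrite /conj_lift mulmx_col2 poly_map_eval2.
rewrite -(of_homog_mulmx (invmx g) (lift_neq0 liftF gP)) -(lift_of_homog liftF gP) -mgP.
by [].
Qed.

End conjugate_lift.

(** * The energy as a function on the ball *)

Section energy_on_ball.
Context {R : realType} (sigma : probability 'rV[R]_4 R).
Hypothesis sigma_rot : rotation_invariant_on_sphere sigma.
Local Notation C := R[i].
Local Notation P1 := (riemann_sphere R).
Local Notation S3 := (@unit_sphere R 4).

Lemma Rintegral_lquat (p q : C) (g : 'rV[R]_4 -> R) : norm2 p q = 1 ->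
  measurable_fun setT g ->
  Rintegral sigma S3 (fun x => g (x *m lquat p q)) = Rintegral sigma S3 g.
Proof.
move=> pq mg; congr fine; rewrite [LHS]integralE [RHS]integralE.
have mgE : measurable_fun setT (EFin \o g) by exact/measurable_EFinP.
have mgl : measurable_fun setT (EFin \o (fun x => g (x *m lquat p q))).
  apply/measurable_EFinP; apply: measurableT_comp mg _.
  exact: measurable_mulmxr.
congr (_ - _)%E.
  rewrite !(ge0_integral_sphereT sigma_rot)//; try exact: measurable_funepos.
  rewrite -(integral_lquat sigma_rot pq (measurable_funepos mgE))//.
  by apply: eq_integral => x _; rewrite !funeposE.
rewrite !(ge0_integral_sphereT sigma_rot)//; try exact: measurable_funeneg.
rewrite -(integral_lquat sigma_rot pq (measurable_funeneg mgE))//.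
by apply: eq_integral => x _; rewrite !funenegE.
Qed.

Lemma hermitian_norm_col2 (u v : C) : hermitian_norm (col2 u v) = Num.sqrt (norm2 u v).
Proof.
rewrite /hermitian_norm !big_ord_recl big_ord0 addr0.
by rewrite (_ : lift ord0 ord0 = ord_max) ?col20 ?col21//; exact/val_inj.
Qed.

Lemma ln_hermitian_norm (u v : C) :
  ln (hermitian_norm (col2 u v)) = 2^-1 * ln (norm2 u v).
Proof. by rewrite hermitian_norm_col2 -powR12_sqrt ?norm2_ge0// ln_powR. Qed.

Lemma invmx_mul_apply (g h : 'M[C]_2) (w : 'cV[C]_2) : SL2 g -> SL2 h ->
  invmx (g *m h) *m w = invmx h *m (invmx g *m w).
Proof.
move=> g1 h1; have gh : g *m h \in unitmx by rewrite unitmx_mul !SL2_unitmx.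
rewrite -[in RHS](mulKVmx gh w) -!mulmxA mulKmx ?SL2_unitmx//.
by rewrite mulKmx// SL2_unitmx.
Qed.

Lemma conj_lift_mul (g h : 'M[C]_2) G : SL2 g -> SL2 h ->
  conj_lift (g *m h) G = conj_lift h (conj_lift g G).
Proof.
move=> g1 h1; apply/funext => w.
by rewrite /conj_lift (invmx_mul_apply _ g1 h1) -(mulmxA g h w).
Qed.

Lemma SL2_mulmx (g h : 'M[C]_2) : SL2 g -> SL2 h -> SL2 (g *m h).
Proof. by rewrite /SL2/= => g1 h1; rewrite det_mulmx g1 h1 mulr1. Qed.

Section one_lift.
Variables (d : nat) (F : 'I_2 -> mpoly 2 C) (f : P1 -> P1).
Hypothesis liftF : homogeneous_lift d F f.

Lemma measurable_log_norm_conj (g : 'M[C]_2) : SL2 g -> measurable_fun setT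
  (fun x : 'rV[R]_4 => ln (hermitian_norm (conj_lift g (poly_map F) (to_C2 x)))).
Proof.
move=> g1; have liftF' := homogeneous_lift_conj g1 liftF.
rewrite -(poly_map_conj_form F g1).
under eq_fun do rewrite to_C2E poly_map_eval2 ln_hermitian_norm.
apply: measurable_funM => //; apply: measurableT_comp => //.
apply: measurable_funD; apply: measurable_abs2;
  exact: cmeas_eval2 (lift_form liftF' _) cmeas_z1 cmeas_z2.
Qed.

(** Two representatives of the same point differ by k in SU(2). On the left k preserves the
    hermitian norm; on the right it rotates the sphere and preserves [sigma]. *)
Lemma RF_class_ball_action (g g' : 'M[C]_2) : SL2 g -> SL2 g' ->
  ball_action g 0 = ball_action g' 0 -> RF_class sigma F g' = RF_class sigma F g.
Proof.
move=> g1 g1' E; have [p [q [pq k1 kE]]] := ball_action0_inj g1 g1' E.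
set k := invmx g *m g' in k1 kE.
have isometry w : hermitian_norm (k *m w) = hermitian_norm w.
  rewrite (col2_eta w); move: (w ord0 ord0) (w ord_max ord0) => u v.
  by rewrite kE !hermitian_norm_col2 norm2_quat pq mul1r.
have g'E : g' = g *m k by rewrite /k mulKVmx// SL2_unitmx.
have key x : hermitian_norm (conj_lift g' (poly_map F) (to_C2 x)) =
    hermitian_norm (conj_lift g (poly_map F) (to_C2 (x *m lquat p q))).
  have -> : conj_lift g' (poly_map F) (to_C2 x) =
      invmx k *m conj_lift g (poly_map F) (k *m to_C2 x).
    by rewrite {1}g'E (conj_lift_mul (poly_map F) g1 k1).
  rewrite -[LHS]isometry (mulKVmx (SL2_unitmx k1)) !to_C2E kE.
  by have [-> ->] := z_lquat p q x.
transitivity (Rintegral sigma S3 (fun x =>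
    ln (hermitian_norm (conj_lift g (poly_map F) (to_C2 (x *m lquat p q)))))).
  by apply: eq_Rintegral => x _; rewrite key.
exact: (Rintegral_lquat pq (measurable_log_norm_conj g1)).
Qed.

Lemma RF_class_mul (g h : 'M[C]_2) : SL2 g -> SL2 h ->
  RF_class sigma F (g *m h) = mean_log_norm sigma (conj_lift h (poly_map (conj_form g F))).
Proof. by move=> g1 h1; rewrite /RF_class (conj_lift_mul _ g1 h1) (poly_map_conj_form F g1). Qed.

(** The representative picked by [xget] and [g *m ball_rep x] carry the origin to the same point, so
    they have the same energy. *)
Lemma RF_ball_ball_action (g : 'M[C]_2) (x : 'rV[R]_3) : SL2 g -> sqnorm x < 1 ->
  RF_ball sigma F (ball_action g x) =
  mean_log_norm sigma (conj_lift (ball_rep x) (poly_map (conj_form g F))).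
Proof.
move=> g1 x1; have h1 := SL2_ball_rep x1; rewrite -(RF_class_mul g1 h1) /RF_ball.
have gh1 := SL2_mulmx g1 h1.
set A := [set _ | _].
have : A (xget 1%:M A).
  by apply: xgetPex; exists (g *m ball_rep x); split=> //; rewrite -(ball_action_ball_rep g x1).
case=> k1 kE; apply: (RF_class_ball_action gh1 k1).
by rewrite kE -(ball_action_ball_rep g x1).
Qed.

End one_lift.

End energy_on_ball.

(** * Gradient and barycenter *)

Section quadratic_expansion.
Context {R : realType}.

(** The candidate differential at the origin, with a linear structure so that uniqueness of the
    differential applies to it. *)
Definition neg_dot (m x : 'rV[R]_3) : R := - dot3 x m.

Lemma neg_dot_linear m : linear (neg_dot m).
Proof. by move=> k x y; rewrite /neg_dot /dot3 !mxE /GRing.scale/=; ring. Qed.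

HB.instance Definition _ m := GRing.isLinear.Build R 'rV[R]_3 R _ (neg_dot m)
  (neg_dot_linear m).

Lemma coord_le_norm (x : 'rV[R]_3) i : `|x ord0 i| <= `|x|.
Proof.
rewrite -[leRHS]/(mx_norm x) mx_normrE.
exact: (le_bigmax _ (fun ij : 'I_1 * 'I_3 => `|x ij.1 ij.2|) (ord0, i)).
Qed.

(** Here [|x|] is the maximum norm of the three coordinates, hence the factor 3. *)
Lemma sqnorm_le_norm (x : 'rV[R]_3) : sqnorm x <= 3 * `|x| ^+ 2.
Proof.
have le i : x ord0 i ^+ 2 <= `|x| ^+ 2.
  by rewrite -(real_normK (num_real (x ord0 i))) lerXn2r ?nnegrE// coord_le_norm.
by rewrite sqnorm3; have := le ord0; have := le 1; have := le ord_max; lra.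
Qed.

Lemma dot3_delta (m : 'rV[R]_3) i : dot3 (delta_mx ord0 i) m = m ord0 i.
Proof.
rewrite /dot3 -(sum3 (fun j => (delta_mx ord0 i : 'rV[R]_3) ord0 j * m ord0 j)).
rewrite (bigD1 i)//= big1 ?addr0 => [|j ji]; first by rewrite mxE !eqxx mul1r.
by rewrite mxE (negbTE ji) andbF mul0r.
Qed.

Lemma quadratic_expansion_gradient (rho : 'rV[R]_3 -> R) (m : 'rV[R]_3) (K : R) :
  0 <= K -> (forall x, sqnorm x <= 1 / 16 ->
    `|rho x - rho 0 + dot3 x m| <= K * sqnorm x) ->
  differentiable rho 0 /\ gradient rho 0 = - m.
Proof.
move=> K0 HK.
have cont : continuous (neg_dot m).
  move=> x.
  have c i : (fun y : 'rV[R]_3 => y ord0 i * m ord0 i : R) y @[y --> x] --> x ord0 i * m ord0 i.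
    exact: (cvgM (@coord_continuous R 1 3 ord0 i x) (cvg_cst (m ord0 i))).
  exact: (cvgN (cvgD (cvgD (c ord0) (c 1)) (c ord_max))).
have small eps : 0 < eps -> \forall h \near (0 : 'rV[R]_3),
    `|rho (h + 0) - (rho 0 + neg_dot m h)| <= eps * `|h|.
  move=> eps0.
  (* 1/8 gives sqnorm h <= 3/64 <= 1/16, within the range of the expansion; the other term makes the
     remainder 3 K |h|^2 at most eps |h|, the added 1 keeping the denominator positive. *)
  pose del := Num.min (1 / 8) (eps / (3 * K + 1)).
  have K1 : 0 < 3 * K + 1 by lra.
  have del0 : 0 < del by rewrite lt_min !divr_gt0.
  near=> h.
  have hd : `|h| < del.
    by near: h; apply/nbhs_ballP; exists del => //= h'; rewrite -ball_normE/= sub0r normrN.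
  have n0 := normr_ge0 h; have S := sqnorm_le_norm h.
  have [h8 he] : `|h| <= 1 / 8 /\ `|h| * (3 * K + 1) <= eps.
    move: hd; rewrite lt_min => /andP[/ltW h8 /ltW he]; split=> //.
    by rewrite -ler_pdivlMr.
  have h16 : sqnorm h <= 1 / 16 by nra.
  rewrite addr0 /neg_dot opprD opprK addrA.
  rewrite (le_trans (HK _ h16))// (le_trans (ler_wpM2l K0 S))//.
  rewrite [leLHS](_ : _ = `|h| * (3 * K) * `|h|); last by ring.
  by rewrite ler_wpM2r// (le_trans _ he)// ler_wpM2l//; lra.
have dE : 'd rho 0 = neg_dot m :> ('rV[R]_3 -> R).
  by apply: (diff_unique cont); apply/eqaddoP; exact: small.
have D : differentiable rho 0.
  by apply/diff_locallyP; rewrite dE; split=> //; apply/eqaddoP; exact: small.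
split=> //; apply/rowP => i; rewrite !mxE deriveE// dE.
by rewrite -[LHS]/(neg_dot m (delta_mx ord0 i)) /neg_dot dot3_delta.
Unshelve. all: by end_near. Qed.

(** Along t m the first-order term decreases by t |m|^2, which a remainder K t^2 |m|^2 cannot
    compensate for small t unless m = 0. *)
Lemma quadratic_expansion_min (rho : 'rV[R]_3 -> R) (m : 'rV[R]_3) (K : R) :
  0 <= K -> (forall x, sqnorm x <= 1 / 16 ->
    `|rho x - rho 0 + dot3 x m| <= K * sqnorm x) ->
  (forall x, sqnorm x <= 1 / 16 -> rho 0 <= rho x) -> m = 0.
Proof.
move=> K0 HK rho_min; pose n := sqnorm m.
have n0 : 0 <= n by exact: sqnorm_ge0.
(* This makes t, t K and t |m|^2 all at most 1/16: the point t m is in range, and t K stays below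
   1. *)
pose t := (16 * (1 + K + n))^-1.
have D0 : 0 < 1 + K + n by lra.
have t0 : 0 < t by rewrite invr_gt0 mulr_gt0.
have tE : t * (16 * (1 + K + n)) = 1 by rewrite mulVf// gt_eqF// mulr_gt0.
have tm : sqnorm (t *: m) = t ^+ 2 * n.
  by rewrite /n /sqnorm mulr_sumr; apply: eq_bigr => i _; rewrite mxE exprMn.
have dtm : dot3 (t *: m) m = t * n by rewrite /n sqnorm3 /dot3 !mxE; ring.
have t16 : t <= 1 / 16 by nra.
have tn : t * n <= 1 / 16 by nra.
have tK : t * K <= 1 / 16 by nra.
have small : sqnorm (t *: m) <= 1 / 16 by rewrite tm; nra.
have := HK _ small; have := rho_min _ small; rewrite tm dtm.
rewrite ler_norml => A /andP[_ B].
have tn0 : t * n = 0.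
  have tn0 : 0 <= t * n by rewrite mulr_ge0// ltW.
  apply/eqP; rewrite eq_le tn0 andbT.
  have C : t * n <= K * t * (t * n) by rewrite (le_trans _ (le_trans B _))//; [lra|rewrite le_eqVlt; apply/orP; left; apply/eqP; ring].
  nra.
have m0 : n = 0 by apply/eqP; move/eqP: tn0; rewrite mulf_eq0 (gt_eqF t0).
move: m0; rewrite /n sqnorm3 => m0.
have a0 := sqr_ge0 (m ord0 ord0); have b0 := sqr_ge0 (m ord0 1); have c0 := sqr_ge0 (m ord0 ord_max).
by apply: row3_eqP; rewrite mxE; apply/eqP; rewrite -sqrf_eq0 eq_le; apply/andP; split; lra.
Qed.

End quadratic_expansion.

Section log_chord.
Context {R : realType}.

(* Concavity of the logarithm: [1 + r^2 - 2 r s] is an affine function of [s]. *)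
Lemma log_chord (r s : R) : 0 < r < 1 -> -1 <= s <= 1 ->
  let L := ln ((1 + r) / (1 - r)) in
  [/\ 0 <= ln ((1 + r ^+ 2 - 2 * (r * s)) / (1 - r ^+ 2)) + s * L &
      -1 < s < 1 -> 0 < ln ((1 + r ^+ 2 - 2 * (r * s)) / (1 - r ^+ 2)) + s * L].
Proof.
move=> /andP[r0 r1] /andP[s1 s2] L.
have A0 : 0 < 1 + r by lra.
have B0 : 0 < 1 - r by lra.
have AB0 : 0 < (1 + r) / (1 - r) by rewrite divr_gt0.
have L0 : 0 < L by rewrite ln_gt0// ltr_pdivlMr//; lra.
have eL : expR L = (1 + r) / (1 - r) by rewrite lnK.
have eNL : expR (- L) = (1 - r) / (1 + r) by rewrite expRN eL invf_div.
(* The argument is affine in s, hence the convex combination of its values exp L at s = -1 and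
   exp(-L) at s = 1. *)
have TE : (1 + r ^+ 2 - 2 * (r * s)) / (1 - r ^+ 2) =
    (1 - s) / 2 * expR L + (1 + s) / 2 * expR (- L).
  rewrite eL eNL; field; apply/and3P; split; rewrite ?gt_eqF//; nra.
set E := expR (- (s * L)); have E0 : 0 < E by exact: expR_gt0.
have e1 : expR L = E * expR (L + s * L) by rewrite -expRD; congr expR; ring.
have e2 : expR (- L) = E * expR (- L + s * L) by rewrite -expRD; congr expR; ring.
have h1 := @expR_ge1Dx R (L + s * L); have h2 := @expR_ge1Dx R (- L + s * L).
(* After division by E, apply exp y >= 1 + y to both exponentials: the linear terms cancel, as (1 -
   s)(L + s L) + (1 + s)(s L - L) = 0. *)
have T_ge : E <= (1 - s) / 2 * expR L + (1 + s) / 2 * expR (- L).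
  rewrite e1 e2 mulrCA [X in _ + X]mulrCA -mulrDr ler_peMr ?(ltW E0)//.
  have w1 : 0 <= (1 - s) / 2 by lra.
  have w2 : 0 <= (1 + s) / 2 by lra.
  by have := ler_wpM2l w1 h1; have := ler_wpM2l w2 h2; nra.
have T0 : 0 < (1 - s) / 2 * expR L + (1 + s) / 2 * expR (- L) by exact: lt_le_trans T_ge.
have lnE : ln E = - (s * L) by rewrite expRK.
rewrite TE; split.
  by rewrite -[s * L]opprK -lnE subr_ge0 ler_ln ?posrE.
move=> /andP[s3 s4]; rewrite -[s * L]opprK -lnE subr_gt0 ltr_ln ?posrE//.
(* For s > -1 the exponent is non-zero, so the inequality is strict, and its weight (1 - s) / 2 is
   positive for s < 1. *)
have g1 : 1 + (L + s * L) < expR (L + s * L).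
  by apply: expR_gt1Dx; rewrite gt_eqF//; nra.
rewrite e1 e2 mulrCA [X in _ < _ + X]mulrCA -mulrDr ltr_pMr//.
have w1 : 0 < (1 - s) / 2 by lra.
have w2 : 0 <= (1 + s) / 2 by lra.
have := ler_wpM2l w2 h2; have : (1 - s) / 2 * (1 + (L + s * L)) < (1 - s) / 2 * expR (L + s * L).
  by rewrite ltr_pM2l.
nra.
Qed.

End log_chord.

(** * Barycenter of a measure with zero first moment *)

Section barycenter.
Context {R : realType} (sigma : probability 'rV[R]_4 R).
Hypothesis sigma_rot : rotation_invariant_on_sphere sigma.
Local Notation C := R[i].
Local Notation P1 := (riemann_sphere R).
Variables (d : nat) (F : 'I_2 -> mpoly 2 C) (f : P1 -> P1).
Hypothesis d_gt0 : (0 < d)%N.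
Hypothesis liftF : homogeneous_lift d F f.
Let mu := sphere_transport (omega f).
Hypothesis moment0 : first_moment mu = 0.

Lemma sqnormB (x y : 'rV[R]_3) : sqnorm (x - y) = sqnorm x + sqnorm y - 2 * dot3 x y.
Proof. by rewrite !sqnorm3 /dot3 !mxE; ring. Qed.

Lemma measurable_subr3 (x : 'rV[R]_3) : measurable_fun setT (fun y : 'rV[R]_3 => sqnorm (x - y)).
Proof.
apply: (measurableT_comp (@measurable_sqnorm R 3)).
apply/measurable_fun_rVP => i; under eq_fun do rewrite !mxE.
by apply: measurable_funB => //; exact: measurable_rV_coord.
Qed.

Lemma measurable_log_poisson (u : 'rV[R]_3) :
  measurable_fun setT (fun x : 'rV[R]_3 => ln ((1 - sqnorm u) / sqnorm (u - x))).
Proof.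
apply: measurableT_comp => //; apply: measurable_funM => //.
by apply: measurable_invr_nneg => [x|]; [exact: sqnorm_ge0|exact: measurable_subr3].
Qed.

Lemma bary_potential_origin : bary_potential mu 0 = 0.
Proof.
have [r mr fiber_r] := measurable_fiber_points d_gt0 liftF.
have h0 x : unit_sphere 3 x -> ln ((1 - sqnorm (0 : 'rV[R]_3)) / sqnorm (0 - x)) = 0.
  by move=> x1; rewrite sqnormB sqnorm00 dot30 x1 mulr0 !subr0 add0r divr1 ln1.
have hB x : unit_sphere 3 x -> `|ln ((1 - sqnorm (0 : 'rV[R]_3)) / sqnorm (0 - x))| <= 0.
  by move=> x1; rewrite h0// normr0.
rewrite /bary_potential (integral_transport sigma_rot liftF mr fiber_r (measurable_log_poisson 0) hB)/=.
rewrite big1 ?mulr0// => n _.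
rewrite (@eq_Rintegral _ _ _ _ _ (cst 0)) ?Rintegral_cst ?mul0r// => q _.
by rewrite h0//; exact: branch_sphere.
Qed.

Lemma measurable_point3 (x : 'rV[R]_3) : measurable [set x].
Proof.
have -> : [set x] = [set y | sqnorm (x - y) = 0].
  apply/seteqP; split=> y /= => [->|]; first by rewrite subrr sqnorm00.
  rewrite sqnorm3 => yx0; have a0 := sqr_ge0 ((x - y) ord0 ord0).
  have b0 := sqr_ge0 ((x - y) ord0 1); have c0 := sqr_ge0 ((x - y) ord0 ord_max).
  apply/esym/eqP; rewrite -subr_eq0; apply/eqP.
  by apply: row3_eqP; rewrite [RHS]mxE; apply/eqP; rewrite -sqrf_eq0 eq_le; apply/andP; split; lra.
have m := measurable_subr3 x.
by have := m measurableT [set 0] (measurable_set1 0); rewrite setTI.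
Qed.

Lemma bary_potential_gt0 (u : 'rV[R]_3) : sqnorm u < 1 -> u != 0 ->
  0 < bary_potential mu u.
Proof.
move=> u1 u0.
have [r mr fiber_r] := measurable_fiber_points d_gt0 liftF.
pose B := branch d f r.
have mB n : measurable_fun setT (B n) by exact: (measurable_branch liftF mr).
have BS n q : sqnorm (B n q) = 1 by exact: branch_sphere.
have n0 : 0 < sqnorm u.
  rewrite lt0r sqnorm_ge0 andbT; apply: contra_neq u0; rewrite sqnorm3 => u00.
  have a0 := sqr_ge0 (u ord0 ord0); have b0 := sqr_ge0 (u ord0 1); have c0 := sqr_ge0 (u ord0 ord_max).
  by apply: row3_eqP; rewrite mxE; apply/eqP; rewrite -sqrf_eq0 eq_le; apply/andP; split; lra.
pose t := Num.sqrt (sqnorm u); have t2 : t ^+ 2 = sqnorm u by rewrite sqr_sqrtr// ltW.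
have t0 : 0 < t by rewrite sqrtr_gt0.
have t1 : t < 1 by rewrite -(@ltr_pXn2r _ 2)// ?nnegrE ?ltW// expr1n t2.
have t01 : 0 < t < 1 by rewrite t0.
pose L := ln ((1 + t) / (1 - t)).
pose h (x : 'rV[R]_3) := ln ((1 - sqnorm u) / sqnorm (u - x)).
pose s (x : 'rV[R]_3) := dot3 u x / t.
have dots x : dot3 u x = t * s x by rewrite /s mulrC divfK// gt_eqF.
have s_bound x : sqnorm x = 1 -> -1 <= s x <= 1.
  move=> x1; rewrite -ler_norml -(@ler_pXn2r _ 2)// ?nnegrE// real_normK ?num_real//.
  by rewrite expr1n /s exprMn exprVn t2 ler_pdivrMr// mul1r (le_trans (dot3_sqr_le _ _))// x1 mulr1.
have hE x : sqnorm x = 1 ->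
    - h x = ln ((1 + t ^+ 2 - 2 * (t * s x)) / (1 - t ^+ 2)).
  move=> x1; rewrite /h sqnormB x1 dots t2.
  have := s_bound _ x1 => /andP[s1 s2].
  have p : 0 < 1 + sqnorm u - 2 * (t * s x).
    by rewrite -t2; have := sqr_ge0 (t - s x); nra.
  rewrite -lnV ?posrE ?divr_gt0//; first by rewrite invf_div [sqnorm u + 1]addrC.
    by rewrite subr_gt0.
  by rewrite [sqnorm u + 1]addrC.
have mh : measurable_fun setT h := measurable_log_poisson u.
(* The argument of the logarithm is extremal at s = 1 and s = -1, with values (1 - t) / (1 + t) and
   its inverse. *)
have hB x : unit_sphere 3 x -> `|h x| <= L.
  move=> x1; rewrite -normrN hE//; have /andP[s1 s2] := s_bound _ x1.
  have D0 : 0 < 1 - t ^+ 2 by rewrite t2 subr_gt0.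
  apply: ln_abs_le; first by rewrite ler_pdivlMr; lra.
  have A0 : 1 + t != 0 by rewrite gt_eqF//; lra.
  have B0 : 1 - t != 0 by rewrite gt_eqF//; lra.
  have C0 : 1 - t ^+ 2 != 0 by rewrite gt_eqF.
  rewrite invf_div (_ : (1 - t) / (1 + t) = (1 - t) ^+ 2 / (1 - t ^+ 2)); last by field; rewrite A0 C0.
  rewrite (_ : (1 + t) / (1 - t) = (1 + t) ^+ 2 / (1 - t ^+ 2)); last by field; rewrite B0 C0.
  by rewrite !ler_pM2r ?invr_gt0//; apply/andP; split; nra.
(* The term s L makes each integrand non-negative by [log_chord], and contributes nothing to the
   total since the first moment is zero. *)
pose psi n q := - h (B n q) + s (B n q) * L.
have psi_ge0 n q : 0 <= psi n q.
  by rewrite /psi hE//; have [] := log_chord t01 (s_bound _ (BS n q)).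
have Ih n := integrable_branch sigma liftF mr n mh hB.
have coord (i : 'I_3) (y : 'rV[R]_3) : unit_sphere 3 y -> `|y ord0 i| <= 1.
  move=> y1; rewrite -(@ler_pXn2r _ 2)// ?nnegrE// real_normK ?num_real// expr1n.
  by rewrite -y1 /sqnorm (bigD1 i)//= lerDl sumr_ge0// => j _; exact: sqr_ge0.
have mcoord i := @measurable_rV_coord R 3 i.
have Ic n i := integrable_branch sigma liftF mr n (mcoord i) (coord i).
have moment i : \sum_(n < d.+1) Rintegral sigma setT (fun q => B n q ord0 i) = 0.
  have := congr1 (fun v : 'rV[R]_3 => v ord0 i) moment0; rewrite !mxE.
  by rewrite (integral_transport sigma_rot liftF mr fiber_r (mcoord i) (coord i)).
have msx : measurable_fun setT s.
  rewrite /s /dot3; apply: measurable_funM => //.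
  by apply: measurable_funD; [apply: measurable_funD|]; exact: measurable_funM.
have sB x : unit_sphere 3 x -> `|s x| <= 1 by move=> x1; rewrite ler_norml; exact: s_bound.
have Is n := integrable_branch sigma liftF mr n msx sB.
have sum_s : \sum_(n < d.+1) Rintegral sigma setT (fun q => s (B n q)) = 0.
  have E n : Rintegral sigma setT (fun q => s (B n q)) =
     (u ord0 ord0 / t) * Rintegral sigma setT (fun q => B n q ord0 ord0) +
     (u ord0 1 / t) * Rintegral sigma setT (fun q => B n q ord0 1) +
     (u ord0 ord_max / t) * Rintegral sigma setT (fun q => B n q ord0 ord_max).
    have IZ i : sigma.-integrable setT (EFin \o (fun q => u ord0 i / t * B n q ord0 i)).
      exact: integrable_EFinZ (Ic n i).
    rewrite -!RintegralZl//; [|exact: Ic..].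
    rewrite -!RintegralD//; last exact: integrable_EFinD.
    by apply: eq_Rintegral => q _; rewrite /s /dot3; ring.
  rewrite (eq_bigr _ (fun (n : 'I_d.+1) _ => E n)) !big_split/= -!mulr_sumr.
  by rewrite (moment ord0) (moment 1) (moment ord_max) !mulr0 !addr0.
have IN n : sigma.-integrable setT (EFin \o (fun q => -1 * h (B n q))).
  exact: integrable_EFinZ (Ih n).
have IsL n : sigma.-integrable setT (EFin \o (fun q => L * s (B n q))).
  exact: integrable_EFinZ (Is n).
have psiE n : psi n = fun q => -1 * h (B n q) + L * s (B n q).
  by apply/funext => q; rewrite /psi mulN1r mulrC.
have Ipsi n : sigma.-integrable setT (EFin \o psi n).
  by rewrite psiE; exact: integrable_EFinD.
have potE : bary_potential mu u = 2^-1 * \sum_(n < d.+1) Rintegral sigma setT (psi n).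
  rewrite /bary_potential (integral_transport sigma_rot liftF mr fiber_r mh hB)/=.
  rewrite mulNr -mulrN -sumrN; congr (_ * _).
  have E n : Rintegral sigma setT (psi n) =
      - Rintegral sigma setT (fun q => h (B n q)) + L * Rintegral sigma setT (fun q => s (B n q)).
    by rewrite psiE RintegralD// !RintegralZl//; [rewrite mulN1r|exact: Ih|exact: Is].
  by rewrite (eq_bigr _ (fun (n : 'I_d.+1) _ => E n)) big_split/= -mulr_sumr sum_s mulr0 addr0.
have psi_int_ge0 n : 0 <= Rintegral sigma setT (psi n).
  by apply: Rintegral_ge0 => q _; exact: psi_ge0.
rewrite potE mulr_gt0// big_ord_recr/= ltr_wpDl ?sumr_ge0//.
(* One strictly positive branch is enough, and the last one, f itself, is taken. If its integral
   were 0, the integrand would vanish almost everywhere, which confines the image to the two points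
   where s = 1 or s = -1. *)
rewrite lt0r psi_int_ge0 andbT; apply/negP => /eqP psi0.
have int0 : (\int[sigma]_q (psi d q)%:E = 0)%E.
  by rewrite -[LHS]fineK ?(integrable_fin_num measurableT (Ipsi d))// -[fine _]/(Rintegral sigma setT (psi d)) psi0.
have ae : ae_eq sigma setT (EFin \o psi d) (cst 0%E).
  apply/ae_eq_integral_abs => //.
    by apply/measurable_EFinP; rewrite psiE; apply: measurable_funD;
      apply: measurable_funM => //; exact: measurableT_comp.
  by rewrite -[RHS]int0; apply: eq_integral => q _; rewrite gee0_abs// lee_fin.
(* The mass at x of the whole transported measure is 0, hence so is the contribution of this branch,
   one of its non-negative terms. *)
have neg x : unit_sphere 3 x -> sigma.-negligible (B d @^-1` [set x]).
  move=> Sx.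
  have mx : measurable (B d @^-1` [set x]).
    by rewrite -[X in measurable X]setTI; apply: mB => //; exact: measurable_point3.
  apply/negligibleP => //.
  have := transport_set1 liftF mr fiber_r Sx.
  rewrite (transport_omegaE sigma_rot liftF mr fiber_r (measurable_point3 x)).
  rewrite /branch_sum/= /msum big_ord_recr/= => sum0.
  apply/eqP; rewrite eq_le measure_ge0 andbT -[leRHS]sum0 leeDr//.
  by apply: sume_ge0 => n _; exact: measure_ge0.
pose v := t^-1 *: u.
have v1 : sqnorm v = 1.
  rewrite (_ : sqnorm v = t^-1 ^+ 2 * sqnorm u).
    by rewrite exprVn t2 mulVf// gt_eqF.
  by rewrite /sqnorm mulr_sumr; apply: eq_bigr => i _; rewrite mxE exprMn.
have dotv x : dot3 v x = s x by rewrite /s /dot3 !mxE; ring.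
have sphere_eq (x y : 'rV[R]_3) : sqnorm (x - y) = 0 -> y = x.
  rewrite sqnorm3 => xy0; have a0 := sqr_ge0 ((x - y) ord0 ord0).
  have b0 := sqr_ge0 ((x - y) ord0 1); have c0 := sqr_ge0 ((x - y) ord0 ord_max).
  apply/esym/eqP; rewrite -subr_eq0; apply/eqP.
  by apply: row3_eqP; rewrite [RHS]mxE; apply/eqP; rewrite -sqrf_eq0 eq_le; apply/andP; split; lra.
(* The values s = 1 and s = -1 are attained on the sphere only at v and -v, with v = u / |u|. The
   whole space would then be negligible, against total mass 1. *)
have cover : [set: 'rV[R]_4] `<=` (B d @^-1` [set v] `|` B d @^-1` [set - v]) `|`
    ~` [set q | setT q -> (EFin \o psi d) q = cst 0%E q].
  move=> q _; have /andP[s1 s2] := s_bound _ (BS d q).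
  have [sl|sl] := eqVneq (s (B d q)) 1.
    left; left; apply: sphere_eq; rewrite sqnormB v1 BS dotv sl; ring.
  have [sr|sr] := eqVneq (s (B d q)) (-1).
    by left; right; apply: sphere_eq; rewrite sqnormB sqnormN v1 BS dot3N dotv sr; ring.
  right => /= /(_ I) [] P.
  have [_] := log_chord t01 (s_bound _ (BS d q)); rewrite -hE// -/L -/(psi d q) P ltxx.
  by rewrite !lt_neqAle s1 s2 sl eq_sym sr => /(_ isT).
have negT : sigma.-negligible [set: 'rV[R]_4].
  apply: negligibleS cover _; apply: negligibleU; last exact: ae.
  by apply: negligibleU; apply: neg; rewrite /unit_sphere/= ?sqnormN.
have T0 := measure_negligible measurableT negT.
have T1 : sigma [set: 'rV[R]_4] = 1%E by exact: probability_setT.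
have : (1 = 0 :> \bar R)%E by rewrite -T1; exact: T0.
by move=> [] /eqP; rewrite oner_eq0.
Qed.

Lemma moment0_barycenter : is_conformal_barycenter mu 0.
Proof.
have [r mr fiber_r] := measurable_fiber_points d_gt0 liftF.
have muS : mu (unit_sphere 3) = d.+1%:R%:E by exact: (transport_sphere sigma_rot liftF mr fiber_r).
have ball0 : unit_ball 3 (0 : 'rV[R]_3) by rewrite /unit_ball/= sqnorm00.
have gt0 u : unit_ball 3 u -> u != 0 -> 0 < bary_potential mu u.
  exact: bary_potential_gt0.
split.
- by rewrite muS ltry.
- move=> x Sx; have x0 : mu [set x] = 0%E.
    by rewrite /mu; apply: (transport_set1 liftF mr fiber_r); exact: Sx.
  rewrite x0 muS.
  by rewrite -EFinM lte_fin mulr_gt0.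
- split=> // u uB; rewrite bary_potential_origin.
  by have [->|u0] := eqVneq u 0; [rewrite bary_potential_origin|rewrite ltW// gt0].
- move=> w [wB wmin]; apply/eqP; apply: contraT => w0.
  have := wmin _ ball0; rewrite bary_potential_origin => /(lt_le_trans (gt0 _ wB w0)).
  by rewrite ltxx.
Qed.

End barycenter.

Theorem theorem1p0p2 (R : realType) (sigma : probability 'rV[R]_4 R)
    (sigma_rot : rotation_invariant_on_sphere sigma)
    (d : nat) (d_gt0 : (1 <= d)%N)
    (f : riemann_sphere R -> riemann_sphere R) (F : 'I_2 -> mpoly 2 R[i])
    (F_lift : homogeneous_lift d F f) :
  (forall (xi : 'rV[R]_3) (g : 'M[R[i]]_2),
     unit_ball 3 xi -> SL2 g -> ball_action g 0 = xi ->
     differentiable (RF_ball sigma F \o ball_action g) 0 /\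
     hyperbolic_gradient (RF_ball sigma F) g =
       - first_moment (sphere_transport (omega (conj_self_map g f)))) /\
  (forall g : 'M[R[i]]_2, SL2 g ->
     (forall g' : 'M[R[i]]_2, SL2 g' ->
        RF_class sigma F g <= RF_class sigma F g') ->
     is_conformal_barycenter
       (sphere_transport (omega (conj_self_map g f))) 0).
Proof.
split=> [_ g _ g1 _|g g1 g_min].
  have liftF := homogeneous_lift_conj g1 F_lift.
  have [K K0 HK] := energy_expansion sigma_rot d_gt0 liftF.
  apply: (quadratic_expansion_gradient K0) => x x16.
  have x1 : sqnorm x < 1 by lra.
  rewrite /= (RF_ball_ball_action sigma_rot F_lift g1 x1).
  rewrite (RF_ball_ball_action sigma_rot F_lift g1 _) ?sqnorm00//.
  exact: HK.
have liftF := homogeneous_lift_conj g1 F_lift.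
have [K K0 HK] := energy_expansion sigma_rot d_gt0 liftF.
apply: (moment0_barycenter sigma_rot d_gt0 liftF).
(* Minimality is tested on the competitors [g *m ball_rep x] with x near the origin; at x = 0 this
   is g itself. *)
apply: (quadratic_expansion_min K0 HK) => x x16.
have x1 : sqnorm x < 1 by lra.
have ball1 (y : 'rV[R]_3) (y1 : sqnorm y < 1) := RF_class_mul sigma F g1 (SL2_ball_rep y1).
have zero1 : sqnorm (0 : 'rV[R]_3) < 1 by rewrite sqnorm00.
have origin : mean_log_norm sigma (conj_lift (ball_rep 0) (poly_map (conj_form g F))) =
    RF_class sigma F g.
  transitivity (RF_class sigma F (g *m ball_rep 0)); first exact/esym/(ball1 0 zero1).
  by rewrite ball_rep0 mulmx1.
have le := g_min _ (SL2_mulmx g1 (SL2_ball_rep x1)).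
rewrite (ball1 x x1) -origin in le.
exact: le.
Qed.
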